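(* Let $v$ and $k$ be positive integers such that $v+k$ is even. Let $b_1,\dots,b_v\in\{1,2,3,6\}$ and $c_1,\dots,c_k\in\{1,2,3,4,6\}$, and put $\mathbf{h}=c_1+\cdots+c_k$. Let $$\psi_{s,t}(\tau)=\prod_{i=1}^v\theta(b_i\tau)\prod_{j=1}^k\Psi(c_j\tau),$$ and set $M=\mathrm{lcm}\big[4\,\mathrm{lcm}[b_1,\dots,b_v],\;2\,\mathrm{lcm}[c_1,\dots,c_k]\big]$. Then the function $q^{\mathbf{h}/8}\psi_{s,t}(\tau)$ is a modular form in $M_{(v+k)/2}(\Gamma_0(M),\chi'')$ if and only if $\mathbf{h}\equiv 0\pmod 8$, where $$\chi''=\begin{cases}\left(\dfrac{(-1)^{(v+k)/2}\,4\prod_{i=1}^v b_i\prod_{j=1}^k c_j}{\cdot}\right) & \text{if } v \text{ and } k \text{ are even},\\[2mm] \left(\dfrac{(-1)^{(v+k)/2}\,8\prod_{i=1}^v b_i\prod_{j=1}^k c_j}{\cdot}\right) & \text{if } v \text{ and } k \text{ are odd}.\end{cases}$$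
   Context: Here $q=e^{2\pi i\tau}$ with $\tau$ in the upper half-plane, and $q^r=e^{2\pi i r\tau}$ for rational $r$. $\theta(\tau)=\sum_{n\in\mathbb{Z}}q^{n^2}$ and $\Psi(\tau)=\sum_{n\ge 0}q^{n(n+1)/2}$. The function $\psi_{s,t}$ is the generating function of the mixed form $\mathcal{M}_{s,t}(\mathbf{y},\mathbf{z})=\sum_{i=1}^v b_iy_i^2+\sum_{i=1}^k c_i\frac{z_i(z_i+1)}{2}$ with $\mathbf{y}\in\mathbb{Z}^v$, $\mathbf{z}\in\mathbb{Z}_{\ge 0}^k$. $M_w(\Gamma_0(N),\psi)$ is the space of (holomorphic) modular forms of weight $w$, level $N$ and character $\psi$. The symbol $\left(\frac{m}{\cdot}\right)$ is the Kronecker symbol. *)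

(* Defs.v *)
(* MathComp-Analysis, with the complex numbers R[i] of mathcomp-real-closed. *)
From HB Require Import structures.
From mathcomp Require Import all_boot all_order all_algebra.
From mathcomp Require Import all_classical all_reals all_analysis.
From mathcomp Require Import complex.

Set Implicit Arguments.
Unset Strict Implicit.
Unset Printing Implicit Defensive.

Import Order.TTheory GRing.Theory Num.Theory.
Import numFieldNormedType.Exports.

Local Open Scope complex_scope.
Local Open Scope classical_set_scope.
Local Open Scope ring_scope.

Section Analytic.
Variable R : realType.

(* The topology and the normed module structure of the complex numbers over
   themselves are those of R[i]^o, so that [derivable] over R[i]^o below is
   complex differentiability. *)
Local Notation C := (R[i]^o).

Definition cexp (z : C) : C :=
  (expR (complex.Re z))%:C * (cos (complex.Im z) +i* sin (complex.Im z)).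

(* q ^ r = exp (2 pi i r tau), for rational r. *)
Definition qpow (r : rat) (tau : C) : C :=
  cexp ((0 +i* (2 * pi)) * ratr r * tau).

Definition upper_half_plane (tau : C) : Prop := 0 < complex.Im tau.

Definition csum (u : nat -> C) : C := limn (series u).

(* [Negz n] is - (n + 1). *)
Definition csumZ (u : int -> C) : C :=
  csum (fun n => u (Posz n)) + csum (fun n => u (Negz n)).

Definition theta (tau : C) : C := csumZ (fun n => qpow (n ^+ 2)%:~R tau).

Definition Psi (tau : C) : C :=
  csum (fun n => qpow (n%:R * (n%:R + 1) / 2) tau).

Definition psi_st (v k : nat) (b : 'I_v -> nat) (c : 'I_k -> nat) (tau : C) : C :=
  (\prod_(i < v) theta ((b i)%:R * tau)) * (\prod_(j < k) Psi ((c j)%:R * tau)).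

Definition SL2Z (g : 'M[int]_2) : Prop := \det g = 1.

Definition Gamma0 (N : nat) (g : 'M[int]_2) : Prop :=
  SL2Z g /\ (N%:Z %| g 1%R 0%R)%Z.

Definition cocycle (g : 'M[int]_2) (tau : C) : C :=
  (g 1 0)%:~R * tau + (g 1 1)%:~R.

Definition moebius (g : 'M[int]_2) (tau : C) : C :=
  ((g 0 0)%:~R * tau + (g 0 1)%:~R) / cocycle g tau.

Definition slash (w : nat) (g : 'M[int]_2) (f : C -> C) (tau : C) : C :=
  cocycle g tau ^- w * f (moebius g tau).

Definition holomorphic_on_H (f : C -> C) : Prop :=
  forall tau, upper_half_plane tau -> derivable f tau 1.

(* A Fourier expansion in the nonnegative powers of q ^ (1 / h). *)
Definition holomorphic_at_infinity (f : C -> C) : Prop :=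
  exists (h : nat) (a : nat -> C), (0 < h)%N /\
    forall tau, upper_half_plane tau ->
      series (fun n => a n * qpow (n%:R / h%:R) tau) @ \oo --> f tau.

(* f is in M_w(Gamma_0(N), chi); only the values of f on the upper half-plane
   and of chi at integers prime to N matter.  The matrices of SL_2(Z) move the
   cusp at infinity to all the other cusps. *)
Definition modular_form (w N : nat) (chi : int -> C) (f : C -> C) : Prop :=
  [/\ holomorphic_on_H f,
      forall g tau, Gamma0 N g -> upper_half_plane tau ->
        f (moebius g tau) = chi (g 1 1) * cocycle g tau ^+ w * f tau
    & forall g, SL2Z g -> holomorphic_at_infinity (slash w g f)].

End Analytic.

(* (m / p) for p prime. *)
Definition kronecker_prime (m : int) (p : nat) : int :=
  if (p%:Z %| m)%Z then 0
  else if p == 2%N then (if (m %% 8)%Z \in [:: 1; 7] then 1 else -1)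
  else if [exists x : 'I_p, (x%:Z ^+ 2 == m %[mod p])%Z] then 1 else -1.

Definition kronecker (m n : int) : int :=
  if n == 0 then (if `|m|%N == 1%N then 1 else 0)
  else (if (n < 0) && (m < 0) then -1 else 1) *
       \prod_(p <- primes `|n|%N) kronecker_prime m p ^+ logn p `|n|%N.

(* The numerator of the Kronecker symbol defining the character chi''. *)
Definition chi_num (v k : nat) (b : 'I_v -> nat) (c : 'I_k -> nat) : int :=
  (-1) ^+ (v + k)./2 * (if ~~ odd v && ~~ odd k then 4 else 8)
  * (\prod_(i < v) b i)%N%:Z * (\prod_(j < k) c j)%N%:Z.

Definition chi'' (R : realType) (v k : nat) (b : 'I_v -> nat) (c : 'I_k -> nat)
  (d : int) : R[i]^o := (kronecker (chi_num b c) d)%:~R.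

(* Main.v *)
(* The series [theta] is the theta constant of nome [q ^ 2], and [q ^ (1/8) Psi (tau)] is
   half the difference of [theta (tau / 8)] and [theta (tau / 2)], because the odd squares
   are all squares minus the even ones.  So the function of the theorem is a polynomial in
   the [theta (r tau)] with [r] rational, homogeneous of degree [v + k].

   The inversion [sum_k exp (- pi al^2 (k + u)^2) = al^-1 sum_n exp (- pi n^2 / al^2 + 2 pi i n u)]
   is needed for complex [al].  Finite Fourier inversion over [Z / N] writes the left side
   as a sum over [|n| <= N / 2] of Riemann sums of a Gaussian; up to the factor
   [exp (- pi n^2 / al^2)] the [n]-th one is [al^-1] times a Riemann sum of
   [x |-> al exp (- pi (al x + be)^2)].  The derivative of this function along a path of
   parameters [(al, be)] is the derivative in [x] of a decaying function, so, letting [N]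
   tend to infinity, all these Riemann sums have the same asymptotics, and the remaining
   constant is 1 by the case [al = 1].

   For a matrix [(A, B; C, D)] of [Gamma0 (M)] with [D > 0], write the image of [tau] as
   [B / D + z]; inversion at [z], completion of the square modulo [D] and inversion at [tau]
   multiply [theta (r tau)] by the Gauss sum of [r B] modulo [D] times a square root of
   [(C tau + D) / D] that does not depend on [r].  Quotients of Gauss sums modulo [D] are
   Jacobi symbols, and the product over the [v + k] factors is the character.  At a cusp
   [A / C] the same computation modulo [8 C] gives the Fourier expansion.  Conversely,
   [tau |-> tau + 1] multiplies the function by [exp (2 pi i h / 8)]. *)
Require Import Defs.
From mathcomp Require Import all_boot all_order all_algebra.
From mathcomp Require Import all_classical all_reals all_analysis.
From mathcomp Require Import complex finmap ring lra zify.

Import Order.TTheory GRing.Theory Num.Theory.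
Import numFieldNormedType.Exports Normc.

Set Implicit Arguments.
Unset Strict Implicit.
Unset Printing Implicit Defensive.

(** Two signs are never computed: only the square of the automorphy factor of theta is known, and
    only products of two Gauss sums are evaluated. This suffices because [v + k] is even and every
    factor of the product carries the same square root. The inversion uses neither a Gaussian
    integral nor a contour shift. The Riemann sums keep no mesh factor, so they have size N, and a
    difference of two of them that stays bounded vanishes after division by N. Moving the parameters
    in N steps of length 1/N, the mesh of the grid itself, makes each step cost O(1/N). Letting N
    grow in the sum over frequencies requires a bound summable in n. Second differences give 1/(1 +
    n^2), but only for |n| <= N/2, whence the symmetric window of frequencies. Families are
    regrouped throughout (by residue class, by exponent, by coordinate), so all sums are
    unconditional sums over arbitrary index types; limits of partial sums appear only at the
    interface with the definitions. *)

(** * Unconditional summation of complex families *)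

Section Summation.
Local Open Scope complex_scope.
Local Open Scope ring_scope.
Variable R : realType.
Local Notation C := (R[i]).
Implicit Types (z w : C) (e : R).

Lemma normc_ge0 z : 0 <= normc z.
Proof. by case: z => a b; exact: sqrtr_ge0. Qed.

Lemma normcD z w : normc (z + w) <= normc z + normc w.
Proof. exact: le_normcD. Qed.

Lemma normcB z w : normc (z - w) <= normc z + normc w.
Proof. by rewrite -(normcN w) normcD. Qed.

Lemma normc_distC z w : normc (z - w) = normc (w - z).
Proof. by rewrite -normcN opprB. Qed.

Lemma normc_norm z : `|z| = (normc z)%:C.
Proof. by rewrite normc_def; case: z. Qed.

Lemma normc_real (x : R) : normc x%:C = `|x|.
Proof. by rewrite /= expr0n addr0 sqrtr_sqr. Qed.

Lemma normc_nonneg (x : R) : 0 <= x -> normc x%:C = x.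
Proof. by move=> x0; rewrite normc_real ger0_norm. Qed.

Lemma normc_nat n : normc (n%:R : C) = n%:R.
Proof. by rewrite -(rmorph_nat (real_complex R)) normc_nonneg. Qed.

Lemma normcX z n : normc (z ^+ n) = normc z ^+ n.
Proof.
elim: n => [|n IH]; first by rewrite !expr0 normc1.
by rewrite !exprS normcM IH.
Qed.

Lemma Re_le_normc z : `|complex.Re z| <= normc z.
Proof.
case: z => a b /=; rewrite -sqrtr_sqr ler_wsqrtr //.
by rewrite lerDl sqr_ge0.
Qed.

Lemma Im_le_normc z : `|complex.Im z| <= normc z.
Proof.
case: z => a b /=; rewrite -sqrtr_sqr ler_wsqrtr //.
by rewrite lerDr sqr_ge0.
Qed.

Lemma normc_le_ReIm z : normc z <= `|complex.Re z| + `|complex.Im z|.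
Proof.
case: z => a b /=; rewrite -(ger0_norm (addr_ge0 (normr_ge0 a) (normr_ge0 b))).
rewrite -sqrtr_sqr ler_wsqrtr // sqrrD !real_normK ?num_real //.
by rewrite -addrA [X in _ <= _ + X]addrC lerD2l lerDl mulrn_wge0 ?mulr_ge0.
Qed.

Lemma normc_le0 z : (forall e, 0 < e -> normc z <= e) -> z = 0.
Proof.
move=> h; apply: eq0_normc; apply/eqP; rewrite eq_le normc_ge0 andbT.
by apply/ler_addgt0Pl => e e0; rewrite addr0 h.
Qed.

Lemma normc_sum (I : Type) (r : seq I) (P : pred I) (f : I -> C) :
  normc (\sum_(i <- r | P i) f i) <= \sum_(i <- r | P i) normc (f i).
Proof.
elim/big_rec2 : _ => [|i y1 y2 _ h]; first by rewrite normc0.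
by apply: le_trans (normcD _ _) _; rewrite lerD2l.
Qed.

Definition absum (I : choiceType) (f : I -> C) : Prop :=
  exists B : R, forall A : {fset I}, \sum_(i <- A) normc (f i) <= B.

(** Convergence along the directed set of finite subsets, so that no enumeration of the index type
    enters. Absolute summability is carried along because regrouping and dominated convergence rest
    on it. *)
Definition hsum (I : choiceType) (f : I -> C) (S : C) : Prop :=
  absum f /\ forall e, 0 < e -> exists A : {fset I}, forall B : {fset I},
    (A `<=` B)%fset -> normc (\sum_(i <- B) f i - S) <= e.

Lemma hsum_absum (I : choiceType) (f : I -> C) S : hsum f S -> absum f.
Proof. by case. Qed.

Lemma eq_hsum (I : choiceType) (f g : I -> C) S : f =1 g -> hsum f S -> hsum g S.
Proof. by move=> /funext ->. Qed.

Lemma hsum_uniq (I : choiceType) (f : I -> C) S T : hsum f S -> hsum f T -> S = T.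
Proof.
move=> [_ hS] [_ hT]; apply/eqP; rewrite -subr_eq0; apply/eqP/normc_le0 => e e0.
have e20 : 0 < e / 2 by rewrite divr_gt0.
have [A hA] := hS _ e20; have [B hB] := hT _ e20.
have := hA _ (fsubsetUl A B); have := hB _ (fsubsetUr A B).
set X := \sum_(i <- _) _ => h1 h2.
have -> : S - T = (X - T) - (X - S) by ring.
by apply: le_trans (normcB _ _) _; rewrite (splitr e) lerD.
Qed.

Lemma absumD (I : choiceType) (f g : I -> C) :
  absum f -> absum g -> absum (fun i => f i + g i).
Proof.
move=> [B hB] [B' hB']; exists (B + B') => A.
apply: le_trans (lerD (hB A) (hB' A)); rewrite -big_split /=.
by apply: ler_sum => i _; exact: normcD.
Qed.

Lemma absum_le (I : choiceType) (f g : I -> C) (K : R) :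
  (forall i, normc (f i) <= K * normc (g i)) -> absum g -> absum f.
Proof.
move=> fg [B hB]; exists (`|K| * B) => A.
apply: le_trans (ler_wpM2l (normr_ge0 K) (hB A)); rewrite mulr_sumr.
apply: ler_sum => i _; apply: le_trans (fg i) _.
by rewrite ler_wpM2r ?normc_ge0 ?ler_norm.
Qed.

Lemma hsumD (I : choiceType) (f g : I -> C) S T :
  hsum f S -> hsum g T -> hsum (fun i => f i + g i) (S + T).
Proof.
move=> [af hS] [ag hT]; split; first exact: absumD.
move=> e e0; have e20 : 0 < e / 2 by rewrite divr_gt0.
have [A hA] := hS _ e20; have [B hB] := hT _ e20.
exists (A `|` B)%fset => D; rewrite fsubUset => /andP[AD BD].
rewrite big_split /= opprD addrACA (splitr e).
by apply: le_trans (normcD _ _) _; rewrite lerD ?hA ?hB.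
Qed.

Lemma hsumZ (I : choiceType) (f : I -> C) S (a : C) :
  hsum f S -> hsum (fun i => a * f i) (a * S).
Proof.
move=> [af hS]; split.
  by apply: absum_le af => i; rewrite normcM.
move=> e e0; have a0 : 0 < 1 + normc a by rewrite ltr_wpDr ?normc_ge0.
have [A hA] := hS (e / (1 + normc a)) (divr_gt0 e0 a0).
exists A => B AB; rewrite -mulr_sumr -mulrBr normcM.
apply: le_trans (ler_wpM2l (normc_ge0 a) (hA _ AB)) _.
rewrite mulrC -mulrA -[leRHS]mulr1 ler_wpM2l ?(ltW e0)//.
by rewrite ler_pdivrMl // mulr1 lerDr.
Qed.

Lemma hsumZr (I : choiceType) (f : I -> C) S (a : C) :
  hsum f S -> hsum (fun i => f i * a) (S * a).
Proof.
by move=> /(hsumZ a); rewrite mulrC; apply: eq_hsum => i; rewrite mulrC.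
Qed.

Lemma hsumB (I : choiceType) (f g : I -> C) S T :
  hsum f S -> hsum g T -> hsum (fun i => f i - g i) (S - T).
Proof.
move=> hf /(hsumZ (-1)) hg; have := hsumD hf hg.
by rewrite mulN1r; apply: eq_hsum => i; rewrite mulN1r.
Qed.

Lemma hsum_fin (I : choiceType) (A : {fset I}) (f : I -> C) :
  (forall i, i \notin A -> f i = 0) -> hsum f (\sum_(i <- A) f i).
Proof.
move=> fA.
have restr (V : zmodType) (g : I -> V) (B : {fset I}) :
    (forall i, i \notin A -> g i = 0) ->
    \sum_(i <- B) g i = \sum_(i <- (A `&` B)%fset) g i.
  move=> gA; rewrite (big_fsetID _ (mem A)) /= [X in _ + X]big1_fset ?addr0.
    by apply: eq_fbigl => i; rewrite !inE andbC.
  by move=> i; rewrite !inE => /andP[_ /gA].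
split.
  exists (\sum_(i <- A) normc (f i)) => B.
  rewrite (restr _ (fun i => normc (f i))); last by move=> i /fA ->; exact: normc0.
  rewrite [leRHS](big_fsetID _ (mem B)) /=.
  rewrite -[leLHS]addr0 lerD //; last by apply: sumr_ge0 => *; exact: normc_ge0.
  by rewrite le_eqVlt; apply/orP; left; apply/eqP/eq_fbigl => i; rewrite !inE.
move=> e e0; exists A => B AB.
by rewrite (restr _ f) // (fsetIidPl AB) subrr normc0 ltW.
Qed.

Lemma hsum0 (I : choiceType) : hsum (fun _ : I => 0) 0.
Proof.
by have := @hsum_fin I fset0 (fun _ => 0) (fun _ _ => erefl); rewrite big_seq_fset0.
Qed.

Lemma hsum_single (I : choiceType) (i0 : I) (f : I -> C) :
  (forall i, i != i0 -> f i = 0) -> hsum f (f i0).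
Proof.
move=> h; have := @hsum_fin I [fset i0]%fset f; rewrite big_seq_fset1.
by apply=> i; rewrite inE => /h.
Qed.

Lemma hsum_sum (I : choiceType) (J : Type) (r : seq J) (P : pred J)
    (f : J -> I -> C) (S : J -> C) :
  (forall j, P j -> hsum (f j) (S j)) ->
  hsum (fun i => \sum_(j <- r | P j) f j i) (\sum_(j <- r | P j) S j).
Proof.
move=> h; elim: r => [|j r IH].
  by rewrite big_nil; apply: eq_hsum (hsum0 I) => i; rewrite big_nil.
rewrite big_cons; case: ifPn => Pj.
  by apply: eq_hsum (hsumD (h j Pj) IH) => i; rewrite big_cons Pj.
by apply: eq_hsum IH => i; rewrite big_cons (negbTE Pj).
Qed.

Lemma hsum_normc_le (I : choiceType) (f : I -> C) S (K : R) :
  hsum f S -> (forall A : {fset I}, normc (\sum_(i <- A) f i) <= K) -> normc S <= K.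
Proof.
move=> [_ hS] hK; apply/ler_addgt0Pl => e e0.
have [A hA] := hS _ e0; have := hA _ (fsubset_refl A); set X := \sum_(i <- A) _.
rewrite normc_distC => h; have -> : S = (S - X) + X by ring.
by apply: le_trans (normcD _ _) _; rewrite lerD // hK.
Qed.

Lemma absum_subset (I : choiceType) (A B : {fset I}) (f : I -> R) :
  (forall i, 0 <= f i) -> (A `<=` B)%fset ->
  \sum_(i <- A) f i <= \sum_(i <- B) f i.
Proof.
move=> f0 AB; rewrite [leRHS](big_fsetID _ (mem A)) /=.
rewrite -[leLHS]addr0 lerD //; last by apply: sumr_ge0.
rewrite le_eqVlt; apply/orP; left; apply/eqP/eq_fbigl => i; rewrite !inE.
by rewrite andbC; case iA: (i \in A) => //=; rewrite (fsubsetP AB).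
Qed.

Lemma nonneg_sup (I : choiceType) (f : I -> R) (K : R) : (forall i, 0 <= f i) ->
  (forall A : {fset I}, \sum_(i <- A) f i <= K) ->
  exists s : R, (forall A : {fset I}, \sum_(i <- A) f i <= s) /\
    forall e, 0 < e -> exists A : {fset I}, s - e <= \sum_(i <- A) f i.
Proof.
move=> f0 fK.
pose E : set R := [set x | exists A : {fset I}, x = \sum_(i <- A) f i]%classic.
have hE : has_sup E.
  split; first by exists (\sum_(i <- fset0) f i), fset0.
  by exists K => _ [A ->].
exists (sup E); split.
  move=> A; apply: sup_upper_bound => //; by exists A.
move=> e e0; have [_ [A ->] h] := sup_adherent e0 hE.
by exists A; exact: ltW.
Qed.

Lemma hsum_nonneg (I : choiceType) (f : I -> R) (K : R) : (forall i, 0 <= f i) ->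
  (forall A : {fset I}, \sum_(i <- A) f i <= K) ->
  exists s : R, hsum (fun i => (f i)%:C) s%:C.
Proof.
move=> f0 fK; have [s [s1 s2]] := nonneg_sup f0 fK; exists s; split.
  by exists K => A; under eq_bigr do rewrite normc_nonneg //.
move=> e /s2[A hA]; exists A => B AB.
rewrite -rmorph_sum -rmorphB normc_real ler_norml.
have h := absum_subset f0 AB; have h1 := s1 B; apply/andP; split; lra.
Qed.

(** Take [A] whose sum of norms is within [e] of the supremum: a disjoint [B] can add at most [e] to
    it. *)
Lemma absum_tail (I : choiceType) (f : I -> C) e : absum f -> 0 < e ->
  exists A : {fset I}, forall B : {fset I}, [disjoint A & B]%fset ->
    \sum_(i <- B) normc (f i) <= e.
Proof.
move=> [K fK] e0.
have [s [s1 s2]] := nonneg_sup (fun i => normc_ge0 (f i)) fK.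
have [A hA] := s2 _ e0; exists A => B AB.
have := s1 (A `|` B)%fset.
have -> : \sum_(i <- (A `|` B)%fset) normc (f i) =
    \sum_(i <- A) normc (f i) + \sum_(i <- B) normc (f i).
  rewrite (big_fsetID _ (mem A)) /=; congr (_ + _); apply: eq_fbigl => i.
    by rewrite !inE andbC; case: (i \in A).
  by rewrite !inE; have := fdisjointP AB i; case: (i \in A) => /= [/(_ isT)/negbTE ->|_];
      rewrite ?andbF ?andbT.
lra.
Qed.

(** Suprema handle nonnegative families only, so [f] is written through |f|, |f| + Re f and |f| + Im
    f, all between 0 and 2 |f|. *)
Lemma absum_hsum (I : choiceType) (f : I -> C) : absum f -> exists S, hsum f S.
Proof.
move=> [K fK].
have pos (g : I -> R) : (forall i, 0 <= g i <= 2 * normc (f i)) ->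
    exists s : R, hsum (fun i => (g i)%:C) s%:C.
  move=> gf; apply: (@hsum_nonneg I g (2 * K)) => [i|A].
    by have /andP[] := gf i.
  apply: le_trans (ler_wpM2l _ (fK A)) => //; rewrite mulr_sumr.
  by apply: ler_sum => i _; have /andP[] := gf i.
have [s0 h0] : exists s : R, hsum (fun i => (normc (f i))%:C) s%:C.
  by apply: pos => i; have := normc_ge0 (f i); lra.
have [s1 h1] : exists s : R, hsum (fun i => (normc (f i) + complex.Re (f i))%:C) s%:C.
  by apply: pos => i; have := Re_le_normc (f i); rewrite ler_norml; lra.
have [s2 h2] : exists s : R, hsum (fun i => (normc (f i) + complex.Im (f i))%:C) s%:C.
  by apply: pos => i; have := Im_le_normc (f i); rewrite ler_norml; lra.
exists (s1%:C - s0%:C + 'i * (s2%:C - s0%:C)).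
apply: eq_hsum (hsumD (hsumB h1 h0) (hsumZ 'i (hsumB h2 h0))) => i.
rewrite !rmorphD /= ![(normc _)%:C + _]addrC !addrK; exact/esym/complexE.
Qed.

(* The summation is unconditional, so the fibers of any map [p] may be summed first. *)
Lemma hsum_regroup (I J : choiceType) (p : I -> J) (f : I -> C) (F : J -> C) S :
  hsum f S -> (forall j, hsum (fun i => if p i == j then f i else 0) (F j)) ->
  hsum F S.
Proof.
move=> hf hF.
have key (B : {fset J}) (g : I -> C) (G : J -> C) :
    (forall j, hsum (fun i => if p i == j then g i else 0) (G j)) ->
    hsum (fun i => if p i \in B then g i else 0) (\sum_(j <- B) G j).
  move=> hG; apply: eq_hsum (hsum_sum B (fun j _ => hG j)) => i /=.
  case: ifPn => piB.
    by rewrite (big_fsetD1 (p i)) //= eqxx big1_fset ?addr0 // => j;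
       rewrite !inE => /andP[/negbTE ji _] _; rewrite eq_sym ji.
  rewrite big1_fset // => j jB _; case: eqP => // E.
  by move: piB; rewrite E jB.
split.
  have [K fK] := hsum_absum hf; exists K => B.
  (* Rotate each fiber sum to the positive real axis. *)
  have [u hu] : {u : J -> C | forall j, normc (u j) <= 1 /\ u j * F j = (normc (F j))%:C}.
    suff H j : {v | normc v <= 1 /\ v * F j = (normc (F j))%:C}.
      by exists (fun j => sval (H j)) => j; exact: (svalP (H j)).
    apply: cid.
    have [->|F0] := eqVneq (F j) 0.
      by exists 0; rewrite normc0 mulr0.
    have N0 : normc (F j) != 0 by apply: contra F0 => /eqP/eq0_normc ->.
    exists ((normc (F j))%:C / F j); split; last by rewrite divfK.
    by rewrite normcM normcV normc_nonneg ?normc_ge0 // divff.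
  have h := key B (fun i => u (p i) * f i) (fun j => u j * F j) _.
  have {}h : hsum (fun i => if p i \in B then u (p i) * f i else 0)
      (\sum_(j <- B) u j * F j).
    apply: h => j; apply: eq_hsum (hsumZ (u j) (hF j)) => i.
    by case: eqP => [->//|]; rewrite mulr0.
  have -> : \sum_(j <- B) normc (F j) = normc (\sum_(j <- B) u j * F j).
    under [in RHS]eq_bigr do rewrite (hu _).2.
    by rewrite -rmorph_sum normc_nonneg // sumr_ge0 // => j _; exact: normc_ge0.
  apply: hsum_normc_le h _ => A; apply: le_trans (normc_sum _ _ _) _.
  apply: le_trans (fK A); apply: ler_sum => i _; case: ifP => _.
    by rewrite normcM ler_piMl ?normc_ge0 // (hu _).1.
  by rewrite normc0 normc_ge0.
(* Once [B] contains the image of [A], the fibers over [B] miss only indices outside [A], whose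
   total norm is at most [e]. *)
move=> e e0; have [A hA] := absum_tail (hsum_absum hf) e0.
exists [fset p i | i in A]%fset => B AB.
have h := hsumB (key B f F hF) hf.
apply: hsum_normc_le h _ => D; apply: le_trans (normc_sum _ _ _) _.
rewrite (big_fsetID _ (mem A)) /= big1_fset ?add0r.
  apply: le_trans (hA [fset x in D | x \notin A]%fset _).
    apply: ler_sum => i _; case: ifP => _; first by rewrite subrr normc0 normc_ge0.
    by rewrite sub0r normcN.
  apply/fdisjointP => x xA; rewrite !inE xA /=; by rewrite andbF.
move=> i; rewrite !inE => /andP[_ iA] _.
have -> : p i \in B by apply: (fsubsetP AB); apply/imfsetP; exists i.
by rewrite subrr normc0.
Qed.

(** Regrouping along [h] itself: each fiber has at most one element, so extension by zero keeps the
    sum. *)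
Lemma hsum_inj (I J : choiceType) (h : J -> I) (f : I -> C) S : injective h ->
  (forall i, (forall j, h j <> i) -> f i = 0) ->
  hsum (fun j => f (h j)) S -> hsum f S.
Proof.
move=> hinj f0 hS; apply: (hsum_regroup (p := h) hS) => i.
have [[j hj]|no] := pselect (exists j, h j = i).
  have := @hsum_single J j (fun j' => if h j' == i then f (h j') else 0).
  rewrite hj eqxx; apply=> j' j'j; case: ifP => // /eqP; rewrite -hj => E.
  by move: j'j; rewrite (hinj _ _ E) eqxx.
rewrite f0; last by move=> j hj; apply: no; exists j.
apply: eq_hsum (hsum0 J) => j; case: eqP => // E; case: no; by exists j.
Qed.

Lemma hsum_bij (I J : choiceType) (h : J -> I) (g : I -> J) (f : I -> C) S :
  cancel h g -> cancel g h -> hsum f S <-> hsum (fun j => f (h j)) S.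
Proof.
move=> hg gh; split => H; last first.
  apply: (hsum_inj (can_inj hg)) H => i /(_ (g i)); by rewrite gh.
apply: (hsum_inj (h := g) (can_inj gh)).
  by move=> j /(_ (h j)); rewrite hg.
by apply: eq_hsum H => i; rewrite gh.
Qed.

(** A finite set of pairs lies in a rectangle, which bounds the norms and gives some sum [U];
    regrouping by the first coordinate identifies it. *)
Lemma hsum_prod (I J : choiceType) (f : I -> C) (g : J -> C) S T :
  hsum f S -> hsum g T -> hsum (fun p : I * J => f p.1 * g p.2) (S * T).
Proof.
move=> hf hg.
have [U hU] : exists U, hsum (fun p : I * J => f p.1 * g p.2) U.
  apply: absum_hsum.
  have [K fK] := hsum_absum hf; have [L gL] := hsum_absum hg.
  exists (K * L) => A.
  pose A1 := [fset p.1 | p in A]%fset; pose A2 := [fset p.2 | p in A]%fset.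
  have sub : (A `<=` A1 `*` A2)%fset.
    apply/fsubsetP => -[i j] ijA; rewrite in_fsetM /=.
    by apply/andP; split; apply/imfsetP; exists (i, j).
  apply: le_trans (absum_subset _ sub) _; first by move=> *; exact: normc_ge0.
  have -> : \sum_(p <- (A1 `*` A2)%fset) normc (f p.1 * g p.2) =
      (\sum_(i <- A1) normc (f i)) * (\sum_(j <- A2) normc (g j)).
    rewrite big_distrlr /=.
    rewrite (perm_big [seq (i, j) | i <- A1, j <- A2]) /=.
      rewrite big_allpairs; apply: eq_bigr => i _.
      by apply: eq_bigr => j _; rewrite normcM.
    apply: uniq_perm; first exact: fset_uniq.
      by apply: allpairs_uniq; rewrite ?fset_uniq // => -[? ?] [].
    move=> [i j]; rewrite in_fsetM /=; apply/idP/allpairsP => [/andP[hi hj]|].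
      by exists (i, j).
    by case=> -[i' j'] /= [hi hj [-> ->]]; rewrite hi hj.
  by rewrite ler_pM // sumr_ge0 // => *; exact: normc_ge0.
suff h : hsum (fun i => f i * T) U by rewrite (hsum_uniq (hsumZr T hf) h).
apply: (hsum_regroup (p := fst) hU) => i.
apply: (hsum_inj (h := fun j => (i, j))) => [j j' []//|[i' j'] h /=|].
  case: eqP => // E; by case: (h j'); rewrite E.
by rewrite /= eqxx; apply: hsumZ.
Qed.

(** Dominated convergence for sums, in the case of limit zero: a finite set carries almost all of
    [d], and on it the convergence is uniform. *)
Lemma tannery (I : choiceType) (F : nat -> I -> C) (d : I -> C) (S : nat -> C) :
  absum d -> (forall n i, normc (F n i) <= normc (d i)) ->
  (forall i e, 0 < e -> exists n0, forall n, (n0 <= n)%N -> normc (F n i) <= e) ->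
  (forall n, hsum (F n) (S n)) ->
  forall e, 0 < e -> exists n0, forall n, (n0 <= n)%N -> normc (S n) <= e.
Proof.
move=> ad Fd F0 hS e e0; have e20 : 0 < e / 2 by rewrite divr_gt0.
have [A hA] := absum_tail ad e20.
have [n0 hn0] : exists n0, forall n, (n0 <= n)%N ->
    \sum_(i <- A) normc (F n i) <= e / 2.
  have : forall s : seq I, forall e, 0 < e -> exists n0, forall n, (n0 <= n)%N ->
      \sum_(i <- s) normc (F n i) <= e.
    elim=> [|i s IH] e' e'0; first by exists 0%N => n _; rewrite big_nil ltW.
    have e'20 : 0 < e' / 2 by rewrite divr_gt0.
    have [n1 h1] := F0 i _ e'20; have [n2 h2] := IH _ e'20.
    exists (maxn n1 n2) => n; rewrite geq_max => /andP[/h1 ? /h2 ?].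
    by rewrite big_cons (splitr e') lerD.
  exact.
exists n0 => n /hn0 hn; apply: hsum_normc_le (hS n) _ => B.
apply: le_trans (normc_sum _ _ _) _; rewrite (big_fsetID _ (mem A)) /= (splitr e).
apply: lerD.
  apply: le_trans hn; apply: absum_subset; first by move=> *; exact: normc_ge0.
  by apply/fsubsetP => i; rewrite !inE => /andP[].
apply: le_trans (hA [fset x in B | x \notin A]%fset _).
  by apply: ler_sum => i _; exact: Fd.
by apply/fdisjointP => x xA; rewrite !inE xA andbF.
Qed.

End Summation.

(** * The complex exponential and elementary estimates *)

Section ComplexExponential.
Local Open Scope complex_scope.
Local Open Scope classical_set_scope.
Local Open Scope ring_scope.
Variable R : realType.
Local Notation C := (R[i]).
Implicit Types (z w : C) (x y a b : R).

(* Locked, so that unification does not see through [ce] to the product defining [cexp]. *)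
Fact ce_key : unit. Proof. by []. Qed.
Definition ce : C -> C := locked_with ce_key (@cexp R).

Lemma ceE z : ce z = (expR (complex.Re z))%:C *
  (cos (complex.Im z) +i* sin (complex.Im z)).
Proof. by rewrite /ce unlock. Qed.

Lemma ReD z w : complex.Re (z + w) = complex.Re z + complex.Re w.
Proof. by case: z; case: w. Qed.
Lemma ImD z w : complex.Im (z + w) = complex.Im z + complex.Im w.
Proof. by case: z; case: w. Qed.
Lemma ReN z : complex.Re (- z) = - complex.Re z. Proof. by case: z. Qed.
Lemma ImN z : complex.Im (- z) = - complex.Im z. Proof. by case: z. Qed.
Lemma ReM z w : complex.Re (z * w) =
  complex.Re z * complex.Re w - complex.Im z * complex.Im w.
Proof. by case: z; case: w. Qed.
Lemma ImM z w : complex.Im (z * w) =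
  complex.Re z * complex.Im w + complex.Im z * complex.Re w.
Proof. by case: z; case: w. Qed.

Definition ReImE := (ReD, ImD, ReN, ImN, ReM, ImM).

Lemma complex_eq z w : complex.Re z = complex.Re w -> complex.Im z = complex.Im w ->
  z = w.
Proof. by case: z; case: w => /= ? ? ? ? -> ->. Qed.

Lemma ce0 : ce 0 = 1.
Proof. by rewrite ceE /= expR0 cos0 sin0 mul1r. Qed.

Lemma ceD z w : ce (z + w) = ce z * ce w.
Proof.
rewrite !ceE ReD ImD expRD cosD sinD; apply: complex_eq; rewrite /= ; ring.
Qed.

Lemma ce_neq0 z : ce z != 0.
Proof.
apply/eqP => h; have := ceD z (- z); rewrite subrr ce0 h mul0r => /eqP.
by rewrite oner_eq0.
Qed.

Lemma ceN z : ce (- z) = (ce z)^-1.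
Proof.
by apply: (mulfI (ce_neq0 z)); rewrite -ceD subrr ce0 divff // ce_neq0.
Qed.

Lemma ceMn (n : nat) z : ce (n%:R * z) = ce z ^+ n.
Proof.
elim: n => [|n IH]; first by rewrite mul0r ce0.
by rewrite -natr1 mulrDl mul1r ceD IH exprSr.
Qed.

Lemma normc_ce z : normc (ce z) = expR (complex.Re z).
Proof.
rewrite ceE normcM normc_nonneg ?expR_ge0 //= cos2Dsin2 sqrtr1 mulr1 //.
Qed.

Lemma ce_real x : ce x%:C = (expR x)%:C.
Proof. by rewrite ceE /= cos0 sin0 mulr1. Qed.

Definition cpi2i : C := 0 +i* (2 * pi).

Definition ee z : C := ce (cpi2i * z).

Lemma eeD z w : ee (z + w) = ee z * ee w.
Proof. by rewrite /ee mulrDr ceD. Qed.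
Lemma ee0 : ee 0 = 1. Proof. by rewrite /ee mulr0 ce0. Qed.
Lemma eeN z : ee (- z) = (ee z)^-1. Proof. by rewrite /ee mulrN ceN. Qed.
Lemma ee_neq0 z : ee z != 0. Proof. exact: ce_neq0. Qed.
Lemma eeMn (n : nat) z : ee (n%:R * z) = ee z ^+ n.
Proof. by rewrite /ee mulrCA ceMn. Qed.

Lemma ee1 : ee 1 = 1.
Proof.
rewrite /ee mulr1 ceE /= expR0 mul1r.
by rewrite mulrC mulr_natr cos2pi sin2pi.
Qed.

Lemma ee_nat (n : nat) : ee n%:R = 1.
Proof. by rewrite -[n%:R]mulr1 eeMn ee1 expr1n. Qed.

Lemma ee_int (n : int) : ee n%:~R = 1.
Proof.
case: n => n; first exact: ee_nat.
by rewrite NegzE mulrNz eeN ee_nat invr1.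
Qed.

Lemma normc_ee z : normc (ee z) = expR (- (2 * pi * complex.Im z)).
Proof. by rewrite /ee normc_ce /cpi2i ReM /= mul0r sub0r. Qed.

Lemma normc_ee_real z : complex.Im z = 0 -> normc (ee z) = 1.
Proof. by move=> h; rewrite normc_ee h mulr0 oppr0 expR0. Qed.

Lemma qpowE (r : rat) z : qpow r z = ee (ratr r * z).
Proof. rewrite /qpow /ee /ce unlock; congr cexp; exact: (esym (@mulrA C _ _ _)). Qed.

(** Only the tangent inequality exp x >= 1 + x is used, at [a] and at [- a]. *)
Lemma expR_sub1_bound a : `|expR a - 1| <= `|a| * expR `|a|.
Proof.
have h1 := expR_ge1Dx a; have h2 := expR_ge1Dx (- a).
rewrite expRN in h2; have p := expR_gt0 a.
have {}h2 : expR a - 1 <= a * expR a.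
  have : (1 + - a) * expR a <= 1 by rewrite -ler_pdivlMr // div1r.
  by rewrite mulrDl; lra.
have [a0|a0] := leP 0 a.
  rewrite (ger0_norm a0) ger0_norm //; lra.
rewrite (ltr0_norm a0) ler0_norm; last by have := expR_lt1 a; rewrite a0; lra.
have h3 := expR_ge1Dx (- a).
have : - a <= - a * expR (- a) by rewrite ler_peMr //; lra.
lra.
Qed.

Lemma expR_sub1a_bound a : `|expR a - 1 - a| <= a ^+ 2 * expR `|a|.
Proof.
have h1 := expR_ge1Dx a; have h2 := expR_ge1Dx (- a).
rewrite expRN in h2; have p := expR_gt0 a.
have {}h2 : expR a - 1 <= a * expR a.
  have : (1 + - a) * expR a <= 1 by rewrite -ler_pdivlMr // div1r.
  by rewrite mulrDl; lra.
rewrite ger0_norm; last by lra.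
apply: (@le_trans _ _ (a * (expR a - 1))); first by lra.
apply: le_trans (ler_norm _) _; rewrite normrM -(real_normK (num_real a)) expr2.
rewrite -mulrA ler_wpM2l //; exact: expR_sub1_bound.
Qed.

Lemma sin_bound b : `|sin b| <= `|b|.
Proof.
wlog b0 : b / 0 <= b.
  move=> h; have [/h//|b0] := leP 0 b.
  by rewrite -normrN -sinN -[leRHS]normrN; apply: h; lra.
have [|c _] := @MVT_segment R sin cos 0 b b0 (fun x _ => is_derive_sin x).
  by apply: continuous_subspaceT => x; exact: continuous_sin.
rewrite sin0 !subr0 => ->; rewrite normrM ler_piMl //; exact: cos_max.
Qed.

Lemma cos_sub1_bound b : `|cos b - 1| <= b ^+ 2 / 2.
Proof.
have -> : cos b = 1 - 2 * sin (b / 2) ^+ 2.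
  by rewrite {1}(splitr b) cosD -!expr2 cos2sin2; ring.
have -> : 1 - 2 * sin (b / 2) ^+ 2 - 1 = - (2 * sin (b / 2) ^+ 2) by ring.
rewrite normrN ger0_norm; last by have := sqr_ge0 (sin (b / 2)); lra.
have := sin_bound (b / 2); rewrite -ler_sqr ?nnegrE // !real_normK ?num_real //.
rewrite expr_div_n; lra.
Qed.

Lemma cos_sub1_bound1 b : `|cos b - 1| <= `|b|.
Proof.
have h := cos_sub1_bound b; have h1 := cos_le1 b; have h2 := cos_geN1 b.
rewrite -(real_normK (num_real b)) in h.
have h3 : `|cos b - 1| <= 2 by rewrite ler_norml; lra.
have := normr_ge0 b; have [b2|b2] := leP `|b| 2; nra.
Qed.

Lemma sin_sub_MVT b : 0 <= b -> exists2 c, 0 <= c <= b & sin b - b = (cos c - 1) * b.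
Proof.
move=> b0.
have D x : x \in `]0, b[%R -> is_derive x 1 (fun x => sin x - x) (cos x - 1).
  by move=> _; apply: is_deriveB.
have K : {within `[0, b], continuous (fun x : R => sin x - x)}.
  apply: continuous_subspaceT => x; apply: continuousB; first exact: continuous_sin.
  exact: cvg_id.
have [c hc] := MVT_segment b0 D K.
rewrite sin0 !subr0 => h; exists c => //; by move: hc; rewrite in_itv.
Qed.

Lemma sin_sub_bound b : `|sin b - b| <= b ^+ 2.
Proof.
wlog b0 : b / 0 <= b.
  move=> h; have [/h//|b0] := leP 0 b.
  have := h (- b); rewrite sinN sqrrN -opprD normrN; apply; lra.
have [c /andP[c0 cb] ->] := sin_sub_MVT b0.
rewrite normrM (ger0_norm b0) expr2 ler_wpM2r //.
apply: le_trans (cos_sub1_bound1 c) _; by rewrite ger0_norm.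
Qed.

(** Up to 1 the mean value form of sin y - y loses at most half of y. Beyond 1 the sine increases,
    so it stays above 1/2, and x <= pi/2 < 2. The bound later keeps a phase factor away from
    zero. *)
Lemma sin_lower x : 0 <= x <= pi / 2 -> x / 4 <= sin x.
Proof.
have small y : 0 <= y <= 1 -> y / 2 <= sin y.
  move=> /andP[y0 y1]; have [c /andP[c0 cy]] := sin_sub_MVT y0.
  have := cos_sub1_bound c; rewrite ler_norml => /andP[+ _].
  set k := cos c; move=> h1 h2.
  have : c ^+ 2 <= 1 by rewrite expr_le1 //; lra.
  nra.
move=> /andP[x0 xp]; have p2 := pihalf_lt2 R; have p1 := pihalf_ge1 R.
have [x1|x1] := leP x 1; first by have := @small x; rewrite x0 x1 => /(_ isT); lra.
have := @small 1; rewrite ler01 lexx => /(_ isT) s1.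
have : sin 1 < sin x.
  rewrite ltr_sin // in_itv /=; apply/andP; split; lra.
lra.
Qed.

(** The real and the imaginary part of the remainder are each split in two; every one of the four
    pieces is at most |z|^2 exp |z|. *)
Lemma ce_sub1z_bound z : normc (ce z - 1 - z) <= 4 * normc z ^+ 2 * expR (normc z).
Proof.
apply: le_trans (normc_le_ReIm _) _; rewrite ceE !ReImE /=.
have ha := Re_le_normc z; have hb := Im_le_normc z.
move: (complex.Re z) (complex.Im z) (normc z) ha hb (normc_ge0 z) => a b N ha hb N0.
have eN : expR `|a| <= expR N by rewrite ler_expR.
have ea : expR a <= expR N by rewrite ler_expR; apply: le_trans ha; exact: ler_norm.
have pa := expR_gt0 a; have pN := expR_gt0 N.
have e1 : 1 <= expR N by have := expR_ge1Dx N; lra.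
have a2 : a ^+ 2 <= N ^+ 2 by rewrite -(real_normK (num_real a)) ler_sqr ?nnegrE.
have b2 : b ^+ 2 <= N ^+ 2 by rewrite -(real_normK (num_real b)) ler_sqr ?nnegrE.
have N2 := sqr_ge0 N.
have -> : expR a * cos b - 0 * sin b - 1 - a =
  (expR a - 1 - a) + expR a * (cos b - 1) by ring.
have -> : expR a * sin b + 0 * cos b - 0 - b =
  (expR a - 1) * sin b + (sin b - b) by ring.
have h1 : `|expR a - 1 - a| <= N ^+ 2 * expR N.
  by apply: le_trans (expR_sub1a_bound a) _; rewrite ler_pM ?expR_ge0 ?sqr_ge0.
have h2 : `|expR a * (cos b - 1)| <= N ^+ 2 * expR N.
  rewrite normrM (ger0_norm (ltW pa)) mulrC ler_pM ?(ltW pa) //.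
  apply: le_trans (cos_sub1_bound b) _; have := sqr_ge0 b; lra.
have h3 : `|(expR a - 1) * sin b| <= N ^+ 2 * expR N.
  rewrite normrM expr2 -mulrA [N * expR N]mulrC mulrA ler_pM //.
    by apply: le_trans (expR_sub1_bound a) _; rewrite ler_pM ?expR_ge0.
  exact: le_trans (sin_bound b) hb.
have h4 : `|sin b - b| <= N ^+ 2 * expR N.
  apply: le_trans (sin_sub_bound b) _; apply: le_trans b2 _.
  by rewrite ler_peMr.
have := ler_normD (expR a - 1 - a) (expR a * (cos b - 1)).
have := ler_normD ((expR a - 1) * sin b) (sin b - b); lra.
Qed.

End ComplexExponential.

(** * Sums over the integers; the series theta and Psi *)

Section SeriesAndSums.
Local Open Scope complex_scope.
Local Open Scope classical_set_scope.
Local Open Scope ring_scope.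
Variable R : realType.
Local Notation C := (R[i]).

Lemma absum_comp (I J : choiceType) (h : J -> I) (f : I -> C) :
  injective h -> absum f -> absum (f \o h).
Proof.
move=> hi [B hB]; exists B => A; apply: le_trans (hB [fset h a | a in A]%fset).
by rewrite big_imfset //= => x y _ _ /hi.
Qed.

Lemma big_fset_iota (V : zmodType) (F : nat -> V) n :
  \sum_(i <- [fset i | i in iota 0 n]%fset) F i = \sum_(i < n) F i.
Proof.
rewrite big_imfset //=.
by rewrite undup_id ?iota_uniq // -[in LHS](subn0 n) -/(index_iota 0 n) big_mkord.
Qed.

Lemma hsum_series (f : nat -> C) (S : C) : hsum f S ->
  (series (f : nat -> R[i]^o) @ \oo --> (S : R[i]^o)).
Proof.
move=> [_ hS]; apply/cvgrPdist_le => /= e e0.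
(* In the order of [R[i]], a positive element is real. *)
have [er e0'] : e = (complex.Re e)%:C /\ 0 < complex.Re e.
  by move: e0; rewrite ltcE /= => /andP[/eqP E ?]; split => //; exact: complex_eq.
have [A hA] := hS _ e0'.
exists (\max_(i <- A) i).+1 => // n /= hn.
rewrite normc_norm er lecR normc_distC /series /=.
have := hA [fset i | i in iota 0 n]%fset; rewrite big_fset_iota big_mkord; apply.
apply/fsubsetP => i iA; apply/imfsetP; exists i => //=.
rewrite mem_iota /= add0n; apply: leq_trans hn; rewrite ltnS.
by apply: (leq_bigmax_seq (F := id)) => //.
Qed.

Lemma csum_hsum (f : nat -> C) (S : C) : hsum f S -> csum f = S.
Proof. by move=> /hsum_series h; apply: cvg_lim => //; exact: norm_hausdorff. Qed.

Lemma hsum_int (f : int -> C) (S T : C) :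
  hsum (f \o Posz) S -> hsum (f \o Negz) T -> hsum f (S + T).
Proof.
move=> hS hT.
have iP : injective Posz by move=> ? ? [].
have iN : injective Negz by move=> ? ? [].
have g1 : hsum (fun n : int => if n is Posz _ then f n else 0) S.
  apply: (hsum_inj iP) hS; by case=> // n /(_ n).
have g2 : hsum (fun n : int => if n is Negz _ then f n else 0) T.
  apply: (hsum_inj iN) hT; by case=> // n /(_ n).
by apply: eq_hsum (hsumD g1 g2) => -[n|n]; rewrite ?addr0 ?add0r.
Qed.

Lemma csumZ_hsum (f : int -> C) (S : C) : hsum f S -> csumZ f = S.
Proof.
move=> hf; have af := hsum_absum hf.
have iP : injective Posz by move=> ? ? [].
have iN : injective Negz by move=> ? ? [].
have [S1 h1] := absum_hsum (absum_comp iP af).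
have [S2 h2] := absum_hsum (absum_comp iN af).
rewrite /csumZ (csum_hsum h1) (csum_hsum h2).
exact: hsum_uniq (hsum_int h1 h2) hf.
Qed.

Lemma sum_geometric_nat (r : R) (A : {fset nat}) : 0 <= r < 1 ->
  \sum_(n <- A) r ^+ n <= (1 - r)^-1.
Proof.
move=> /andP[r0 r1].
have sub : (A `<=` [fset i | i in iota 0 (\max_(i <- A) i).+1])%fset.
  apply/fsubsetP => i iA; have : (i < (\max_(i <- A) i).+1)%N.
    by rewrite ltnS; apply: (leq_bigmax_seq (F := id)).
  move: (\max_(i <- A) i).+1 => n iN; apply/imfsetP; exists i => //=.
  by rewrite mem_iota /= add0n.
apply: le_trans (absum_subset (fun n => exprn_ge0 n r0) sub) _.
rewrite big_fset_iota; move: (\max_(i <- A) i).+1 => n.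
have r1' : 0 < 1 - r by rewrite subr_gt0.
rewrite -[leRHS]mul1r ler_pdivlMr // mulrC -opprB mulNr -subrX1 opprB.
by rewrite gerBl exprn_ge0.
Qed.

(** Each half-line costs 1/(1 - exp(-y)) <= 1 + 1/y. With y = 1/N this is the O(N) size of a sum
    over the grid of mesh 1/N. *)
Lemma sum_geometric_int (y : R) (A : {fset int}) : 0 < y ->
  \sum_(m <- A) expR (- (y * `|m|%N%:R)) <= 2 * (1 + y^-1).
Proof.
move=> y0.
have e1 : 0 <= expR (- y) < 1 by rewrite expR_ge0 expR_lt1 oppr_lt0.
have half (B : {fset int}) : {in B &, injective absz} ->
    \sum_(m <- B) expR (- (y * `|m|%N%:R)) <= 1 + y^-1.
  move=> iB.
  have -> : \sum_(m <- B) expR (- (y * `|m|%N%:R)) =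
      \sum_(n <- [fset absz m | m in B]%fset) expR (- y) ^+ n.
    rewrite big_imfset //=; apply: eq_bigr => m _.
    by rewrite -expRM_natl; congr expR; ring.
  apply: le_trans (sum_geometric_nat _ e1) _.
  have h := expR_ge1Dx y; have p : 0 < 1 - expR (- y).
    by rewrite subr_gt0; case/andP: e1.
  rewrite -[leLHS]mul1r ler_pdivrMr // expRN.
  have E : (expR y)^-1 <= (1 + y)^-1 by rewrite lef_pV2 // posrE; lra.
  apply: (@le_trans _ _ ((1 + y^-1) * (1 - (1 + y)^-1))).
    have -> : (1 + y^-1) * (1 - (1 + y)^-1) = 1 :> R.
      by field; rewrite !gt_eqF //; lra.
    by [].
  rewrite ler_wpM2l //; last by lra.
  by rewrite addr_ge0 // invr_ge0 ltW.
rewrite (big_fsetID _ (fun m : int => 0 <= m)) /= mulr2n mulrDl mul1r.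
apply: lerD; apply: half => i j; rewrite !inE => /andP[_ hi] /andP[_ hj]; lia.
Qed.

Lemma absum_geometric_int (y : R) : 0 < y ->
  absum (fun m : int => (expR (- (y * `|m|%N%:R)))%:C : C).
Proof.
move=> y0; exists (2 * (1 + y^-1)) => A; apply: le_trans (sum_geometric_int A y0).
by apply: ler_sum => m _; rewrite normc_nonneg ?expR_ge0.
Qed.

Lemma ratr_intE (n : int) : ratr n%:~R = n%:~R :> C.
Proof. exact: ratr_int. Qed.

Lemma intC (n : int) : n%:~R = (n%:~R : R)%:C :> C.
Proof. by rewrite rmorph_int. Qed.

Lemma natC (n : nat) : n%:R = (n%:R : R)%:C :> C.
Proof. by rewrite rmorph_nat. Qed.

Lemma ReMr (x : R) (z : C) : complex.Re (x%:C * z) = x * complex.Re z.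
Proof. by rewrite ReM /= mul0r subr0. Qed.

Lemma ImMr (x : R) (z : C) : complex.Im (x%:C * z) = x * complex.Im z.
Proof. by rewrite ImM /= mul0r addr0. Qed.

Lemma intr_sqr_absz (n : int) : (n%:~R : R) ^+ 2 = (`|n|%N%:R) ^+ 2.
Proof. by rewrite natr_absz intr_norm real_normK ?num_real. Qed.

Lemma le_natr_sqr (n : nat) : n%:R <= n%:R ^+ 2 :> R.
Proof. by rewrite -natrX ler_nat; case: n => // n; rewrite leq_pmulr. Qed.

(** Since n^2 >= |n|, a geometric series dominates. *)
Lemma absum_theta (a : int -> C) (K x : R) (tau : C) : 0 < complex.Im tau -> 0 < x ->
  (forall n, normc (a n) <= K) ->
  absum (fun n : int => a n * ee ((x * n%:~R ^+ 2)%:C * tau)).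
Proof.
move=> t0 x0 aK; have y0 : 0 < 2 * pi * (x * complex.Im tau).
  by rewrite !mulr_gt0 // pi_gt0.
have K0 : 0 <= K := le_trans (normc_ge0 _) (aK 0).
apply: absum_le (absum_geometric_int y0) => n; instantiate (1 := K).
rewrite normcM ler_pM ?normc_ge0 // normc_nonneg ?expR_ge0 // normc_ee ler_expR lerN2.
rewrite ImMr intr_sqr_absz -mulrA ler_wpM2l ?mulr_ge0 ?pi_ge0 // -mulrA.
rewrite -mulrA !ler_wpM2l ?(ltW x0) // mulrC ler_wpM2r ?(ltW t0) //.
exact: le_natr_sqr.
Qed.

Lemma theta_hsum (tau : C) : 0 < complex.Im tau ->
  hsum (fun n : int => ee (n%:~R ^+ 2 * tau)) (theta tau).
Proof.
move=> t0; have [S hS] : exists S, hsum (fun n : int => ee (n%:~R ^+ 2 * tau)) S.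
  apply: absum_hsum; have := @absum_theta (fun _ => 1) 1 1 tau t0 ltr01.
  have -> : (fun n : int => 1 * ee ((1 * n%:~R ^+ 2)%:C * tau)) =
            (fun n : int => ee (n%:~R ^+ 2 * tau)).
    by apply/funext => n; rewrite !mul1r rmorphXn /= -intC.
  by apply => n; rewrite normc1.
suff -> : theta tau = S by [].
rewrite /theta; apply: csumZ_hsum; apply: eq_hsum hS => n.
by rewrite qpowE ratr_intE rmorphXn.
Qed.

Lemma psi_exponent (n : nat) :
  ratr (n%:R * (n%:R + 1) / 2) = n%:R * (n%:R + 1) / 2 :> C.
Proof. by rewrite fmorph_div rmorphM rmorphD /= !rmorph_nat rmorph1. Qed.

(** The reflection n -> -1 - n preserves (2n + 1)^2 and exchanges the two half-lines, so the sum
    over all integers is twice the series of [Psi]. Also (2n + 1)^2 / 8 = n(n + 1)/2 + 1/8. *)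
Lemma two_psi (tau : C) : 0 < complex.Im tau ->
  hsum (fun n : int => ee ((2 * n%:~R + 1) ^+ 2 / 8 * tau))
    (2 * (ee (tau / 8) * Psi tau)).
Proof.
move=> t0; pose f (n : int) := ee ((2 * n%:~R + 1) ^+ 2 / 8 * tau).
have x0 : 0 < 8^-1 :> R by [].
have inj : injective (fun n : int => 2 * n + 1) by move=> i j /=; lia.
have af : absum f.
  have h1 : normc (1 : C) <= 1 by rewrite normc1.
  have /(absum_comp inj) := @absum_theta (fun _ => 1) 1 8^-1 tau t0 x0 (fun _ => h1).
  congr absum; apply/funext => n; rewrite /f /= mul1r; congr ee; congr (_ * _).
  rewrite rmorphM rmorphXn /= -intC rmorphD rmorphM /= fmorphV rmorph_nat.
  by rewrite mulrC.
have iP : injective Posz by move=> ? ? [].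
have [S hS] := absum_hsum (absum_comp iP af).
have fE (j : nat) : f j = ee (tau / 8) * ee (j%:R * (j%:R + 1) / 2 * tau).
  rewrite -eeD /f; congr ee; rewrite -[j%:~R]/(j%:R : C); by field.
have fN (j : nat) : f (Negz j) = f j.
  rewrite /f NegzE mulrNz -[j.+1%:~R]/(j.+1%:R : C) -[j%:~R]/(j%:R : C) -natr1.
  by congr ee; ring.
have -> : ee (tau / 8) * Psi tau = S.
  have := hsumZ (ee (tau / 8))^-1 hS.
  have -> : (fun i : nat => (ee (tau / 8))^-1 * (f \o Posz) i) =
    (fun n : nat => qpow (n%:R * (n%:R + 1) / 2) tau).
    apply/funext => n; rewrite /= fE mulKf ?ee_neq0 //.
    by rewrite qpowE psi_exponent.
  move=> /csum_hsum; rewrite -/(Psi tau) => ->.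
  by rewrite mulVKf ?ee_neq0.
rewrite mulr2n mulrDl mul1r; apply: hsum_int => //.
by apply: eq_hsum hS => j; exact/esym/fN.
Qed.

Lemma psi_theta (tau : C) : 0 < complex.Im tau ->
  ee (tau / 8) * Psi tau = (theta (tau / 8) - theta (tau / 2)) / 2.
Proof.
move=> t0.
have im8 : complex.Im (tau / 8) = complex.Im tau / 8.
  rewrite mulrC (_ : 8^-1 = (8^-1 : R)%:C) ?ImMr 1?mulrC //.
  by rewrite fmorphV rmorph_nat.
have im2 : complex.Im (tau / 2) = complex.Im tau / 2.
  rewrite mulrC (_ : 2^-1 = (2^-1 : R)%:C) ?ImMr 1?mulrC //.
  by rewrite fmorphV rmorph_nat.
have h8 := @theta_hsum (tau / 8); have h2 := @theta_hsum (tau / 2).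
rewrite im8 in h8; rewrite im2 in h2.
have {}h8 := h8 (divr_gt0 t0 (ltr0Sn _ _)); have {}h2 := h2 (divr_gt0 t0 (ltr0Sn _ _)).
pose g (n : int) : C := ee (n%:~R ^+ 2 * (tau / 8)).
have odd_part : hsum (fun n : int => if odd `|n|%N then g n else 0)
    (2 * (ee (tau / 8) * Psi tau)).
  apply: (hsum_inj (h := fun n : int => 2 * n + 1)).
  - by move=> i j /=; lia.
  - move=> i hi; case: ifP => // oi; case: (hi ((i - 1) %/ 2)%Z); lia.
  - apply: eq_hsum (two_psi t0) => n.
    have -> : odd (absz (2 * (n : int) + 1)) by lia.
    by rewrite /g rmorphD rmorphM /=; congr ee; field.
have even_part : hsum (fun n : int => if odd `|n|%N then 0 else g n) (theta (tau / 2)).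
  apply: (hsum_inj (h := fun n : int => 2 * n)).
  - by move=> i j /=; lia.
  - move=> i hi; case: ifP => // oi; case: (hi (i %/ 2)%Z); lia.
  - apply: eq_hsum h2 => n.
    have -> : odd (absz (2 * (n : int))) = false by lia.
    by rewrite /g rmorphM /=; congr ee; field.
have := hsumD odd_part even_part.
have -> : (fun i : int => (if odd `|i|%N then g i else 0) +
    (if odd `|i|%N then 0 else g i)) = g.
  by apply/funext => n; case: ifP; rewrite ?addr0 ?add0r.
move=> /(hsum_uniq h8) ->; by field.
Qed.

End SeriesAndSums.

(** * Expansions in powers of q^(1/h) *)

Section FourierSeries.
Local Open Scope complex_scope.
Local Open Scope classical_set_scope.
Local Open Scope ring_scope.
Variable R : realType.
Local Notation C := (R[i]).

(** Serves both for holomorphy on the upper half-plane and for the behaviour at the cusps;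
    unconditional convergence makes the notion stable under products. *)
Definition qseries (h : nat) (F : C -> C) : Prop :=
  exists a : nat -> C, forall tau, 0 < complex.Im tau ->
    hsum (fun n => a n * ee (n%:R / h%:R * tau)) (F tau).

Lemma ImMnat (n h : nat) (tau : C) :
  complex.Im (n%:R / h%:R * tau) = n%:R / h%:R * complex.Im tau.
Proof.
rewrite (_ : n%:R / h%:R = (n%:R / h%:R : R)%:C) ?ImMr //.
by rewrite fmorph_div !rmorph_nat.
Qed.

(** Terms of equal exponent are collected. The coefficients of one fiber are summable because, at
    the point ['i], the exponential is a nonzero constant on that fiber. *)
Lemma qseries_gen (I : choiceType) (w : I -> nat) (a : I -> C) h F :
  (forall tau, 0 < complex.Im tau ->
    hsum (fun i => a i * ee ((w i)%:R / h%:R * tau)) (F tau)) ->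
  qseries h F.
Proof.
move=> hF; have hi : 0 < complex.Im ('i : C) by rewrite /= ltr01.
have fib n : {A | hsum (fun i => if w i == n then a i else 0) A}.
  apply: cid; apply: absum_hsum.
  pose K := normc (ee (n%:R / h%:R * 'i) : C)^-1.
  apply: absum_le (hsum_absum (hF _ hi)) => i; instantiate (1 := K).
  case: eqP => [->|_]; last by rewrite normc0 mulr_ge0 ?normc_ge0.
  by rewrite mulrC -normcM mulfK ?ee_neq0.
exists (fun n => sval (fib n)) => tau t0.
apply: (hsum_regroup (p := w) (hF _ t0)) => n.
apply: eq_hsum (hsumZr (ee (n%:R / h%:R * tau)) (svalP (fib n))) => i.
by case: eqP => [->|_] //; rewrite mul0r.
Qed.

Lemma qseries_eq h F G : (forall tau, 0 < complex.Im tau -> F tau = G tau) ->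
  qseries h F -> qseries h G.
Proof. by move=> FG [a ha]; exists a => tau t0; rewrite -FG //; exact: ha. Qed.

Lemma qseriesM h F G : qseries h F -> qseries h G ->
  qseries h (fun tau => F tau * G tau).
Proof.
move=> [a ha] [b hb].
apply: (@qseries_gen (nat * nat)%type (fun p => p.1 + p.2)%N
  (fun p => a p.1 * b p.2)) => tau t0.
apply: eq_hsum (hsum_prod (ha _ t0) (hb _ t0)) => -[i j] /=.
by rewrite natrD mulrDl mulrDl eeD; ring.
Qed.

Lemma qseries_cst h (c : C) : qseries h (fun=> c).
Proof.
apply: (@qseries_gen nat (fun n => n) (fun n => if n == 0%N then c else 0)) => tau t0.
have := @hsum_single R nat 0%N
  (fun n => (if n == 0%N then c else 0) * ee (n%:R / h%:R * tau)).
rewrite eqxx mul0r mul0r ee0 mulr1; apply => i /negbTE ->; by rewrite mul0r.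
Qed.

Lemma qseries_prod h (I : Type) (r : seq I) (F : I -> C -> C) :
  (forall i, qseries h (F i)) -> qseries h (fun tau => \prod_(i <- r) F i tau).
Proof.
move=> hF; elim: r => [|i r IH].
  by apply: qseries_eq (qseries_cst h 1) => tau _; rewrite big_nil.
by apply: qseries_eq (qseriesM (hF i) IH) => tau _; rewrite big_cons.
Qed.

Lemma qseriesD h F G : qseries h F -> qseries h G ->
  qseries h (fun tau => F tau + G tau).
Proof.
move=> [a ha] [b hb]; exists (fun n => a n + b n) => tau t0.
by apply: eq_hsum (hsumD (ha _ t0) (hb _ t0)) => n; rewrite mulrDl.
Qed.

Lemma qseriesZ h c F : qseries h F -> qseries h (fun tau => c * F tau).
Proof. by move=> hF; apply: qseriesM => //; exact: qseries_cst. Qed.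

Lemma qseries_scale (h m : nat) F : (0 < h)%N -> (0 < m)%N -> qseries h F ->
  qseries (h * m) F.
Proof.
move=> h0 m0 [a ha].
have E (n : nat) : n%:R / h%:R = (n * m)%N%:R / (h * m)%N%:R :> C.
  rewrite (natrM _ n) (natrM _ h) -mulf_div divff ?mulr1 //.
  by rewrite pnatr_eq0 -lt0n.
apply: (@qseries_gen nat (fun n => n * m)%N a) => tau t0.
by apply: eq_hsum (ha _ t0) => n; rewrite E.
Qed.

Lemma qseries_theta (a : int -> C) (K : R) (h : nat) : (0 < h)%N ->
  (forall n, normc (a n) <= K) ->
  exists2 F, qseries h F & forall tau, 0 < complex.Im tau ->
    hsum (fun n : int => a n * ee (n%:~R ^+ 2 / h%:R * tau)) (F tau).
Proof.
move=> h0 aK.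
have E (n : int) : ((h%:R)^-1 * n%:~R ^+ 2 : R)%:C = n%:~R ^+ 2 / h%:R :> C.
  by rewrite rmorphM rmorphXn /= -intC fmorphV rmorph_nat mulrC.
have E2 (n : int) : n%:~R ^+ 2 / h%:R = (`|n| ^ 2)%N%:R / h%:R :> C.
  by rewrite (intC R n) -rmorphXn intr_sqr_absz -natrX rmorph_nat.
have hs tau : {S | 0 < complex.Im tau ->
    hsum (fun n : int => a n * ee (n%:~R ^+ 2 / h%:R * tau)) S}.
  apply: cid; have [t0|t0] := ltP 0 (complex.Im tau); last by exists 0.
  have hR : 0 < (h%:R)^-1 :> R by rewrite invr_gt0 ltr0n.
  have [S hS] := absum_hsum (absum_theta t0 hR aK); exists S => _.
  by apply: eq_hsum hS => n; rewrite E.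
exists (fun tau => sval (hs tau)) => [|tau t0]; last exact: svalP (hs tau) t0.
apply: (@qseries_gen int (fun n => `|n| ^ 2)%N a) => tau t0.
by apply: eq_hsum (svalP (hs tau) t0) => n; rewrite E2.
Qed.

(** The decay rate y is split as y/2 + y/4 + y/4. One quarter absorbs the power of [rho]: with x =
    rho y / 4, x <= exp x gives 4/y and x^2/2 <= exp x gives 32/y^2. The half is compared with the
    series at height y/2, and the other quarter pays for moving the point by at most y/4. *)
Lemma ee_poly_bound (rho y : R) : 0 < rho -> 0 < y -> forall (k : nat), (k <= 2)%N ->
  rho ^+ k * expR (- (rho * y)) <=
  (1 + 4 / y + 32 / y ^+ 2) * expR (- (rho * (y / 2))) * expR (- (rho * (y / 4))).
Proof.
move=> r0 y0 k k2; rewrite -mulrA -expRD.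
have -> : - (rho * y) = - (rho * (y / 2)) + - (rho * (y / 4)) - (rho * (y / 4)).
  by field.
move: (- (rho * (y / 2)) + - (rho * (y / 4))) => s.
rewrite expRD mulrCA mulrC ler_wpM2r ?expR_ge0 // expRN ler_pdivrMr ?expR_gt0 //.
have x0 : 0 < rho * (y / 4) by rewrite mulr_gt0 // divr_gt0.
have h1 := expR_ge1Dxn 1 (ltW x0).
have h0 := expR_ge1Dxn 0 (ltW x0).
have y4 : 0 < 4 / y by rewrite divr_gt0.
have y32 : 0 < 32 / y ^+ 2 by rewrite divr_gt0 // exprn_gt0.
move: h0 h1; rewrite -[1%N`!]/1%N -[2%N`!]/2%N divr1 expr1.
set E := expR _; have yn0 : y != 0 by rewrite gt_eqF.
move=> h0 h1; have E1 : 1 <= E by lra.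
case: k k2 => [|[|[|//]]] _.
- rewrite expr0; nra.
- have -> : rho ^+ 1 = 4 / y * (rho * (y / 4)) by field.
  apply: (@le_trans _ _ (4 / y * E)); first by rewrite ler_wpM2l ?(ltW y4) //; lra.
  by rewrite ler_wpM2r; lra.
- have -> : rho ^+ 2 = 32 / y ^+ 2 * ((rho * (y / 4)) ^+ 2 / 2) by field.
  apply: (@le_trans _ _ (32 / y ^+ 2 * E)).
    by rewrite ler_wpM2l ?(ltW y32) //; lra.
  by rewrite ler_wpM2r; lra.
Qed.

(** Termwise differentiation: [L] is the sum of the derivatives, and the second-order remainders are
    dominated by the series at the point [tau1] of half the height. *)
Lemma qseries_taylor h F (tau : C) : qseries h F -> 0 < complex.Im tau ->
  exists (L : C) (M : R), 0 <= M /\ forall d : C, normc d <= complex.Im tau / 4 ->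
    normc (F (d + tau) - F tau - d * L) <= M * normc d ^+ 2.
Proof.
move=> [a ha] t0; set y := complex.Im tau in t0 *.
pose tau1 : C := 0 +i* (y / 2).
have t1 : 0 < complex.Im tau1 by rewrite /= divr_gt0.
have [B hB] := hsum_absum (ha _ t1).
pose c (n : nat) : C := cpi2i R * (n%:R / h%:R).
pose rho (n : nat) : R := 2 * pi * (n%:R / h%:R).
have rho0 n : 0 <= rho n by rewrite /rho !mulr_ge0 ?pi_ge0 ?invr_ge0.
have pi2 : normc (cpi2i R) = 2 * pi.
  by rewrite /= expr0n /= add0r sqrtr_sqr ger0_norm // mulr_ge0 // pi_ge0.
have nq n : n%:R / h%:R = (n%:R / h%:R : R)%:C :> C by rewrite fmorph_div !rmorph_nat.
have cn n : normc (c n) = rho n.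
  rewrite /c normcM pi2 /rho; congr (_ * _); rewrite nq.
  by apply: normc_nonneg; rewrite divr_ge0.
have een n t : normc (ee (n%:R / h%:R * t)) = expR (- (rho n * complex.Im t)).
  by rewrite normc_ee ImMnat /rho !mulrA.
pose K := 1 + 4 / y + 32 / y ^+ 2.
have K0 : 0 <= K by rewrite /K !addr_ge0 // divr_ge0 ?exprn_ge0 // ltW.
have bnd n k : (k <= 2)%N -> rho n ^+ k * expR (- (rho n * y)) <=
    K * expR (- (rho n * (y / 2))) * expR (- (rho n * (y / 4))).
  move=> k2; have := rho0 n; rewrite le_eqVlt => /orP[/eqP <-|r0]; last first.
    exact: ee_poly_bound.
  rewrite !mul0r oppr0 expR0 !mulr1 expr0n; case: eqP => _ //=.
  rewrite /K -addrA lerDl addr_ge0 // divr_ge0 ?exprn_ge0 // ltW //.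
have [L hL] : exists L, hsum (fun n => c n * (a n * ee (n%:R / h%:R * tau))) L.
  apply: absum_hsum; apply: absum_le (hsum_absum (ha _ t1)) => n; instantiate (1 := K).
  rewrite (normcM (c n)) cn !(normcM (a n)) !een mulrCA [leRHS]mulrCA ler_wpM2l ?normc_ge0 //.
  have := bnd n 1%N isT; rewrite expr1 -/y => h1; apply: le_trans h1 _.
  rewrite ler_piMr ?mulr_ge0 ?expR_ge0 // expR_le1 oppr_le0 mulr_ge0 //.
  by rewrite divr_ge0 // ltW.
have B0 : 0 <= B by have := hB fset0; rewrite big_seq_fset0.
exists L, (4 * K * B); split; first by rewrite !mulr_ge0.
  move=> d dy; have dI := Im_le_normc d.
  have td : 0 < complex.Im (d + tau).
    rewrite ImD -/y; move: dI; rewrite ler_norml; lra.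
  apply: hsum_normc_le (hsumB (hsumB (ha _ td) (ha _ t0)) (hsumZ d hL)) _ => A.
  apply: le_trans (normc_sum _ _ _) _.
  apply: (@le_trans _ _ (\sum_(n <- A) (4 * K * normc d ^+ 2) *
     normc (a n * ee (n%:R / h%:R * tau1)))); last first.
    by rewrite -mulr_sumr [leRHS]mulrAC ler_wpM2l ?mulr_ge0 ?normc_ge0 //; exact: hB.
  apply: ler_sum => n _.
  have -> : a n * ee (n%:R / h%:R * (d + tau)) - a n * ee (n%:R / h%:R * tau) -
      d * (c n * (a n * ee (n%:R / h%:R * tau))) =
      a n * (ee (n%:R / h%:R * tau) * (ce (c n * d) - 1 - c n * d)).
    have E : ee (n%:R / h%:R * d) = ce (c n * d) by rewrite /ee /c mulrA.
    rewrite mulrDr eeD E; move: (ee _) (ce _) => u v; ring.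
  rewrite !(normcM (a n)) (normcM (ee _)) [leRHS]mulrCA ler_wpM2l ?normc_ge0 // !een -/y.
  apply: le_trans (ler_wpM2l (expR_ge0 _) (ce_sub1z_bound _)) _.
  rewrite (normcM (c n)) cn exprMn.
  have e4 : expR (rho n * normc d) <= expR (rho n * (y / 4)).
    by rewrite ler_expR ler_wpM2l.
  have := bnd n 2%N isT; rewrite [expR (- (rho n * (y / 4)))]expRN.
  rewrite -ler_pdivrMr ?invr_gt0 ?expR_gt0 // invrK => h2.
  rewrite -[complex.Im tau1]/(y / 2).
  apply: (@le_trans _ _ (4 * normc d ^+ 2 *
     (rho n ^+ 2 * expR (- (rho n * y)) * expR (rho n * (y / 4))))).
    rewrite [leLHS](_ : _ = 4 * normc d ^+ 2 *
      (rho n ^+ 2 * expR (- (rho n * y)) * expR (rho n * normc d))); last by ring.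
    rewrite ler_wpM2l ?mulr_ge0 ?normc_ge0 // ler_wpM2l //.
    by rewrite mulr_ge0 ?sqr_ge0 ?expR_ge0.
  apply: le_trans (ler_wpM2l _ h2) _; first by rewrite !mulr_ge0 ?normc_ge0.
  by rewrite le_eqVlt; apply/orP; left; apply/eqP; ring.
Qed.

Lemma qseries_derivable h F : qseries h F -> holomorphic_on_H F.
Proof.
move=> qF tau t0; rewrite /upper_half_plane in t0.
have [L [M [M0 key]]] := qseries_taylor qF t0.
set y := complex.Im tau in t0 key.
apply/cvg_ex; exists (L : R[i]^o); apply/cvgrPdist_le => /= e e0.
have [er e0'] : e = (complex.Re e)%:C /\ 0 < complex.Re e.
  move: e0; rewrite ltcE /= => /andP[/eqP E ?]; split => //; exact: complex_eq.
have quot (u l x : C) : u != 0 -> l - u^-1 * x = - (u^-1 * (x - u * l)).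
  by move=> u0; field.
have M1 : 0 < M + 1 by rewrite ltr_wpDl.
pose r := Num.min (y / 4) (complex.Re e / (M + 1)).
have r0 : 0 < r by rewrite lt_min !divr_gt0.
have rC : 0 < r%:C by rewrite ltcR.
near=> d.
have dn0 : (d : R[i]^o) != (0 : R[i]^o).
  by near: d; exact: (@nbhs_dnbhs_neq (R[i]^o) 0).
have dr : normc d <= r.
  rewrite -lecR -normc_norm; near: d.
  exact: (@dnbhs0_le _ (R[i]^o) r%:C rC).
rewrite normc_norm er lecR.
have -> : (L : R[i]^o) - d^-1 *: (F (d *: 1 + tau) - F tau) =
    - (d^-1 * (F (d + tau) - F tau - d * L)) :> C.
  rewrite -[d *: 1]/(d * 1 : C) mulr1; exact: quot.
rewrite normcN normcM normcV.
have nd : 0 < normc d.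
  by rewrite lt_neqAle normc_ge0 andbT eq_sym; apply: contra dn0 => /eqP/eq0_normc ->.
rewrite ler_pdivrMl //; move: dr; rewrite le_min => /andP[d1 d2].
apply: le_trans (key d d1) _; rewrite expr2 mulrCA ler_wpM2l ?(ltW nd) //.
rewrite ler_pdivlMr // in d2; apply: le_trans d2; rewrite mulrC ler_wpM2l ?(ltW nd) //.
by rewrite lerDl.
Unshelve. all: by end_near.
Qed.

End FourierSeries.

(** * Bounds for the complex Gaussian *)

Section GaussianEstimates.
Local Open Scope complex_scope.
Local Open Scope ring_scope.
Variable R : realType.
Local Notation C := (R[i]).

Definition gs (y : C) : C := ce (- (pi%:C * y ^+ 2)).

Lemma normc_pi : normc ((pi : R)%:C) = pi.
Proof. by rewrite normc_nonneg // pi_ge0. Qed.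

Lemma pi_lt4 : (pi : R) < 4.
Proof. by have := pihalf_lt2 R; lra. Qed.

Lemma normc_gs y : normc (gs y) =
  expR (- (pi * (complex.Re y ^+ 2 - complex.Im y ^+ 2))).
Proof. by rewrite normc_ce ReN ReMr expr2 ReM !expr2. Qed.

(** First-order expansion in [k]. The change [w] of the exponent is at most 4 (2 k W^2 + k^2 W^2) <=
    12 k W^2 as pi < 4. The constant is 580 = 4 * 12^2 + 4: the remainder of the exponential at [w],
    and the quadratic part of [w]. *)
Lemma gs_taylor : exists2 c : R, 0 <= c &
  forall (W k : R) (y H : C), 1 <= W -> 0 <= k <= 1 ->
  normc y <= W -> normc H <= W ->
  normc (gs (y + k%:C * H) - gs y * (1 - 2 * pi%:C * k%:C * y * H)) <=
  normc (gs y) * (k ^+ 2 * (c * W ^+ 4 * expR (12 * k * W ^+ 2))).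
Proof.
exists 580; first exact: ler0n.
move=> W k y H W1 /andP[k0 k1] yY HY.
have W0 : 0 <= W by lra.
have p4 := pi_lt4; have p0 := @pi_ge0 R.
pose w : C := - (pi%:C * (2 * y * (k%:C * H) + (k%:C * H) ^+ 2)).
have -> : gs (y + k%:C * H) - gs y * (1 - 2 * pi%:C * k%:C * y * H) =
    gs y * ((ce w - 1 - w) - pi%:C * (k%:C * H) ^+ 2).
  have -> : gs (y + k%:C * H) = gs y * ce w.
    by rewrite /gs -ceD /w; congr ce; ring.
  rewrite /w; move: (ce _) => c; ring.
rewrite normcM ler_wpM2l ?normc_ge0 //.
have kH : normc (k%:C * H) <= k * W.
  by rewrite normcM normc_nonneg // ler_wpM2l.
have nkH := normc_ge0 (k%:C * H).
have kH2 : normc (k%:C * H) ^+ 2 <= (k * W) ^+ 2 by rewrite ler_sqr ?nnegrE // mulr_ge0.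
have w12 : normc w <= 12 * k * W ^+ 2.
  rewrite /w normcN normcM normc_pi.
  apply: (@le_trans _ _ (4 * (2 * W * (k * W) + (k * W) ^+ 2))).
    apply: (ler_pM p0 (normc_ge0 _) (ltW p4)).
    apply: le_trans (normcD _ _) _; apply: lerD; last by rewrite normcX.
    rewrite normcM; apply: ler_pM; rewrite ?normc_ge0 // normcM normc_nat.
    by rewrite ler_wpM2l.
  have : (k * W) ^+ 2 <= k * W ^+ 2.
    by rewrite exprMn ler_wpM2r ?sqr_ge0 // expr2 ler_piMl.
  nra.
have w0 := normc_ge0 w.
apply: le_trans (normcB _ _) _.
rewrite normcM normc_pi normcX.
have h1 := ce_sub1z_bound w.
have e12 : expR (normc w) <= expR (12 * k * W ^+ 2) by rewrite ler_expR.
set e := expR (12 * k * W ^+ 2) in e12 *.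
have e1 : 1 <= e.
  by rewrite /e -expR0 ler_expR !mulr_ge0 ?sqr_ge0.
have h2 : normc w ^+ 2 <= (12 * k * W ^+ 2) ^+ 2.
  by rewrite ler_sqr ?nnegrE // !mulr_ge0 ?sqr_ge0.
have h3 : 4 * normc w ^+ 2 * expR (normc w) <= 4 * (12 * k * W ^+ 2) ^+ 2 * e.
  by rewrite ler_pM ?mulr_ge0 ?sqr_ge0 ?expR_ge0 // ler_wpM2l.
have h4 : pi * normc (k%:C * H) ^+ 2 <= 4 * (k * W) ^+ 2.
  by rewrite ler_pM ?sqr_ge0 // ltW.
have h5 : (k * W) ^+ 2 <= k ^+ 2 * W ^+ 4 * e.
  rewrite exprMn -mulrA ler_wpM2l ?sqr_ge0 //.
  apply: (@le_trans _ _ (W ^+ 4)); first by rewrite ler_weXn2l.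
  by rewrite ler_peMr // exprn_ge0.
have -> : k ^+ 2 * (580 * W ^+ 4 * e) = 4 * (12 * k * W ^+ 2) ^+ 2 * e +
  4 * (k ^+ 2 * W ^+ 4 * e) by ring.
lra.
Qed.

(** The condition Re - |Im| > 0 is convex, so along the segment from 1 to 1 + a it holds with a
    uniform gap [mu], and Re^2 - Im^2 >= mu^2. The shift by [s b] adds a cross term, absorbed by
    completing the square. *)
Lemma gs_path_bound (a b : C) : `|complex.Im a| < 1 + complex.Re a ->
  exists kappa B : R, 0 < kappa /\ forall s x : R, 0 <= s <= 1 ->
    normc (gs ((1 + s%:C * a) * x%:C + s%:C * b)) <= expR (B - kappa * x ^+ 2).
Proof.
case: a => ar ai; case: b => br bi hab; rewrite /= in hab.
pose mu := Num.min 1 (1 + ar - `|ai|).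
have mu0 : 0 < mu by rewrite lt_min; apply/andP; split; lra.
pose Z := (1 + `|ar|) * `|br| + `|ai| * `|bi|.
pose Z2 := `|bi| ^+ 2.
exists (mu ^+ 2), (4 * (2 * Z ^+ 2 / mu ^+ 2 + Z2)); split; first by rewrite exprn_gt0.
move=> s x /andP[s0 s1]; rewrite normc_gs ler_expR !ReImE /=.
rewrite !(mul0r, mulr0, subr0, addr0, add0r).
set p := 1 + s * ar; set q := s * ai.
have pmu : mu <= p - `|q|.
  rewrite /p /q normrM (ger0_norm s0).
  have m1 : mu <= 1 by rewrite ge_min lexx.
  have m2 : mu <= 1 + ar - `|ai| by rewrite ge_min lexx orbT.
  have : (1 - s) * mu + s * mu <= (1 - s) * 1 + s * (1 + ar - `|ai|).
    by rewrite lerD // ler_wpM2l //; lra.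
  lra.
have q0 := normr_ge0 q.
have pq : mu ^+ 2 <= p ^+ 2 - q ^+ 2.
  rewrite -(real_normK (num_real q)); nra.
have pb : `|p| <= 1 + `|ar|.
  apply: le_trans (ler_normD _ _) _; rewrite normr1 lerD2l normrM (ger0_norm s0).
  by apply: ler_piMl.
have qb : `|q| <= `|ai|.
  by rewrite /q normrM (ger0_norm s0); apply: ler_piMl.
clearbody p q.
have cross : `|s * (p * br - q * bi)| <= Z.
  rewrite normrM (ger0_norm s0).
  apply: (@le_trans _ _ (1 * `|p * br - q * bi|)); first by rewrite ler_wpM2r.
  rewrite mul1r; apply: le_trans (ler_normB _ _) _; rewrite !normrM.
  by apply: lerD; apply: ler_wpM2r.
have s2 : s ^+ 2 * bi ^+ 2 <= Z2.
  by rewrite /Z2 real_normK ?num_real // ler_piMl ?sqr_ge0 // expr_le1.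
have Z0 : 0 <= Z by rewrite addr_ge0 // mulr_ge0 // addr_ge0.
have Z20 : 0 <= Z2 by exact: sqr_ge0.
have m2 : 0 < mu ^+ 2 by rewrite exprn_gt0.
pose U := 2 * Z ^+ 2 / mu ^+ 2 + Z2.
have U0 : 0 <= U by rewrite addr_ge0 // divr_ge0 ?(ltW m2) // mulr_ge0 ?sqr_ge0.
have val : mu ^+ 2 / 2 * x ^+ 2 - U <= (p * x + s * br) ^+ 2 - (q * x + s * bi) ^+ 2.
  have -> : (p * x + s * br) ^+ 2 - (q * x + s * bi) ^+ 2 =
    (p ^+ 2 - q ^+ 2) * x ^+ 2 + 2 * (s * (p * br - q * bi)) * x +
    (s ^+ 2 * br ^+ 2 - s ^+ 2 * bi ^+ 2) by ring.
  have h1 : mu ^+ 2 * x ^+ 2 <= (p ^+ 2 - q ^+ 2) * x ^+ 2 by rewrite ler_wpM2r ?sqr_ge0.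
  have h2 : - (Z * `|x|) <= (s * (p * br - q * bi)) * x.
    rewrite lerNl; apply: le_trans (ler_norm _) _; rewrite normrN normrM.
    by rewrite ler_wpM2r.
  have h3 : 0 <= s ^+ 2 * br ^+ 2 by rewrite mulr_ge0 ?sqr_ge0.
  have h4 : 2 * (Z * `|x|) <= mu ^+ 2 / 2 * x ^+ 2 + 2 * Z ^+ 2 / mu ^+ 2.
    rewrite -(real_normK (num_real x)).
    have : 0 <= (mu / 2 * `|x| - Z / mu) ^+ 2 by exact: sqr_ge0.
    have -> : (mu / 2 * `|x| - Z / mu) ^+ 2 =
      (mu ^+ 2 / 2 * `|x| ^+ 2 + 2 * Z ^+ 2 / mu ^+ 2 - 2 * (Z * `|x|)) / 2.
      by field; rewrite gt_eqF.
    lra.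
  rewrite /U; lra.
have X0 : 0 <= mu ^+ 2 / 2 * x ^+ 2 by rewrite mulr_ge0 ?sqr_ge0 // divr_ge0 // ltW.
(* The factor pi >= 2 restores the half of mu^2 spent on the cross term, and pi < 4 gives the factor
   4 in the constant. *)
have p4 := pi_lt4; have p2 := @pi_ge2 R.
rewrite -/U; move: val.
set v := _ - _ ^+ 2; set X := mu ^+ 2 / 2 * x ^+ 2 in X0 *.
have -> : mu ^+ 2 * x ^+ 2 = 2 * X by rewrite /X; field.
nra.
Qed.

(** The 6 is 5 + 1: five for the fifth power of 1 + |x| in the error terms, one for the decay
    exp(-|x|) that must remain. *)
Lemma gauss_dominates (kappa x : R) : 0 < kappa ->
  expR (6 * `|x| - kappa * x ^+ 2) <= expR (9 / kappa).
Proof.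
move=> k0; rewrite ler_expR -(real_normK (num_real x)).
have : 0 <= kappa * (`|x| - 3 / kappa) ^+ 2 by rewrite mulr_ge0 ?sqr_ge0 // ltW.
have -> : kappa * (`|x| - 3 / kappa) ^+ 2 =
   kappa * `|x| ^+ 2 - 6 * `|x| + 9 / kappa by field; rewrite gt_eqF.
lra.
Qed.

Lemma poly_le_exp (x : R) n : (1 + `|x|) ^+ n <= expR (n%:R * `|x|).
Proof.
rewrite expRM_natl; apply: lerXn2r; rewrite ?nnegrE ?addr_ge0 ?expR_ge0 //.
exact: expR_ge1Dx.
Qed.

(* The error factors in the Taylor steps are at most [k^2 (1 + |x|)^5 exp (e (1 + |x|)^2)],
   which is absorbed by the Gaussian. *)
Lemma gauss_absorb (kappa B e x : R) : 0 < kappa -> 0 <= e -> e <= kappa / 4 ->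
  expR (B - kappa * x ^+ 2) * ((1 + `|x|) ^+ 5 * expR (e * (1 + `|x|) ^+ 2)) <=
  expR (B + kappa / 2 + 18 / kappa) * expR (- `|x|).
Proof.
move=> k0 e0 ek.
apply: (@le_trans _ _ (expR (B - kappa * x ^+ 2) *
   (expR (5 * `|x|) * expR (kappa / 4 * (2 + 2 * x ^+ 2))))).
  rewrite ler_wpM2l ?expR_ge0 // ler_pM ?expR_ge0 ?exprn_ge0 ?addr_ge0 //.
    exact: poly_le_exp.
  rewrite ler_expR ler_pM ?sqr_ge0 // -(real_normK (num_real x)).
  by have := sqr_ge0 (`|x| - 1); lra.
have k20 : 0 < kappa / 2 by rewrite divr_gt0.
have := gauss_dominates x k20; rewrite -!expRD !ler_expR.
have -> : 9 / (kappa / 2) = 18 / kappa by field; rewrite gt_eqF.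
lra.
Qed.

End GaussianEstimates.

(** * Asymptotics of Riemann sums of Gaussians *)

Section RiemannSums.
Local Open Scope complex_scope.
Local Open Scope ring_scope.
Variable R : realType.
Local Notation C := (R[i]).

(** The bound W of [gs_taylor] is factored into a part Y fixed by the parameters and a part V, to be
    1 + |x|. This is the form that [gauss_absorb] accepts. *)
Lemma gs_taylor_dom : exists2 c : R, 0 <= c &
  forall (Y e k V : R) (y H : C), 1 <= Y -> 1 <= V -> 0 <= k <= 1 ->
  12 * k * Y ^+ 2 <= e -> normc y <= Y * V -> normc H <= Y * V ->
  normc (gs (y + k%:C * H) - gs y * (1 - 2 * pi%:C * k%:C * y * H)) <=
  k ^+ 2 * (c * Y ^+ 4) * (normc (gs y) * (V ^+ 4 * expR (e * V ^+ 2))).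
Proof.
have [c c0 taylor] := @gs_taylor R; exists c => //.
move=> Y e k V y H Y1 V1 k01 ek yY HY.
have W1 : 1 <= Y * V by nra.
have ler_e : expR (12 * k * (Y * V) ^+ 2) <= expR (e * V ^+ 2).
  rewrite ler_expR; have -> : 12 * k * (Y * V) ^+ 2 = 12 * k * Y ^+ 2 * V ^+ 2 by ring.
  by rewrite ler_wpM2r ?sqr_ge0.
have YV0 : 0 <= Y * V by lra.
apply: le_trans (taylor _ _ _ _ W1 k01 yY HY) _.
have -> : k ^+ 2 * (c * Y ^+ 4) * (normc (gs y) * (V ^+ 4 * expR (e * V ^+ 2))) =
  normc (gs y) * (k ^+ 2 * (c * (Y * V) ^+ 4 * expR (e * V ^+ 2))) by ring.
apply: ler_wpM2l; first exact: normc_ge0.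
apply: ler_wpM2l; first exact: sqr_ge0.
by apply: ler_wpM2l => //; rewrite mulr_ge0 // exprn_ge0.
Qed.

(** Discrete form of d/ds [al gs(al x + be)] = d/dx [(a x + b) gs(al x + be)] for al = 1 + s a and
    be = s b. The step [k] is the same in [s] and in [x], so that the difference in [x] becomes a
    shift of the grid by one point. *)
Lemma path_step (a b : C) : `|complex.Im a| < 1 + complex.Re a ->
  exists K k0 : R, [/\ 0 <= K, 0 < k0 & forall k s x : R, 0 < k <= k0 -> 0 <= s <= 1 ->
    normc ((1 + (s%:C + k%:C) * a) * gs ((1 + (s%:C + k%:C) * a) * x%:C + (s%:C + k%:C) * b)
      - (1 + s%:C * a) * gs ((1 + s%:C * a) * x%:C + s%:C * b)
      - ((a * (x%:C + k%:C) + b) * gs ((1 + s%:C * a) * (x%:C + k%:C) + s%:C * b)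
         - (a * x%:C + b) * gs ((1 + s%:C * a) * x%:C + s%:C * b)))
    <= K * k ^+ 2 * expR (- `|x|)].
Proof.
move=> hab; have [kappa [B [kap0 hB]]] := gs_path_bound b hab.
have [c c0 taylor] := gs_taylor_dom.
pose Y := 2 + normc a + normc b.
have na := normc_ge0 a; have nb := normc_ge0 b.
have Y1 : 1 <= Y by rewrite /Y; lra.
have Y0 : 0 < Y by lra.
(* Keeps the exponent 12 k Y^2 of the Taylor error below kappa/4, the limit in [gauss_absorb]. *)
pose k0 := Num.min 1 (kappa / 4 / (12 * Y ^+ 2)).
have Y20 : 0 < 12 * Y ^+ 2 by rewrite mulr_gt0 // exprn_gt0.
exists ((16 * Y ^+ 3 + 4 * c * Y ^+ 5) * expR (B + kappa / 2 + 18 / kappa)), k0.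
split.
- rewrite mulr_ge0 ?expR_ge0 // addr_ge0 // !mulr_ge0 ?exprn_ge0 // ltW //.
- by rewrite lt_min ltr01 !divr_gt0.
move=> k s x /andP[kp kk0] s01; have /andP[s0 s1] := s01.
have k1 : k <= 1 by move: kk0; rewrite le_min => /andP[].
have ke : 12 * k * Y ^+ 2 <= kappa / 4.
  move: kk0; rewrite le_min => /andP[_]; rewrite ler_pdivlMr // => h.
  by rewrite [leLHS](_ : _ = k * (12 * Y ^+ 2)) //; ring.
set V := 1 + `|x|; have V1 : 1 <= V by rewrite lerDl.
have x0 := normr_ge0 x.
set al := 1 + s%:C * a; set y := al * x%:C + s%:C * b; set H := a * x%:C + b.
have -> : (1 + (s%:C + k%:C) * a) * x%:C + (s%:C + k%:C) * b = y + k%:C * H.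
  by rewrite /y /al /H; ring.
have -> : al * (x%:C + k%:C) + s%:C * b = y + k%:C * al by rewrite /y; ring.
have -> : 1 + (s%:C + k%:C) * a = al + k%:C * a by rewrite /al; ring.
have -> : a * (x%:C + k%:C) + b = H + k%:C * a by rewrite /H; ring.
have nsa : normc (s%:C * a) <= normc a.
  by rewrite normcM normc_nonneg // ler_piMl.
have nsb : normc (s%:C * b) <= normc b.
  by rewrite normcM normc_nonneg // ler_piMl.
have nal : normc al <= 1 + normc a.
  by apply: le_trans (normcD _ _) _; rewrite normc1 lerD2l.
have naal := normc_ge0 al.
have ny : normc y <= Y * V.
  apply: le_trans (normcD _ _) _; rewrite normcM normc_real /Y /V.
  have : normc al * `|x| <= (1 + normc a) * `|x| by rewrite ler_wpM2r.
  have : 0 <= (normc b) * `|x| by rewrite mulr_ge0.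
  rewrite [X in _ -> _ -> _ <= X](_ : _ = 1 + `|x| + (1 + normc a) * `|x| + 1 + normc a
    + normc b + normc b * `|x|); last by ring.
  lra.
have nH : normc H <= Y * V.
  apply: le_trans (normcD _ _) _; rewrite normcM normc_real /Y /V.
  have : 0 <= (normc b) * `|x| by rewrite mulr_ge0.
  rewrite [X in _ -> _ <= X](_ : _ = 2 + 2 * `|x| + normc a * `|x| + normc a
    + normc b + normc b * `|x|); last by ring.
  lra.
have YV : Y <= Y * V by rewrite ler_peMr // ltW.
have nalV : normc al <= Y * V.
  by apply: le_trans nal _; apply: le_trans YV; rewrite /Y; lra.
have naY : normc a <= Y by rewrite /Y; lra.
have k01 : 0 <= k <= 1 by rewrite k1 ltW.
have T1 := taylor _ _ _ _ _ _ Y1 V1 k01 ke ny nH.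
have T2 := taylor _ _ _ _ _ _ Y1 V1 k01 ke ny nalV.
set G1 := gs (y + k%:C * H) in T1 *; set G2 := gs (y + k%:C * al) in T2 *.
(* The terms of order [k] cancel. What remains is one explicit term of order k^2 and the two Taylor
   remainders. *)
have -> : (al + k%:C * a) * G1 - al * gs y - ((H + k%:C * a) * G2 - H * gs y) =
  (k ^+ 2)%:C * (gs y * (2 * pi%:C * (a * (y * (al - H))))) +
  ((al + k%:C * a) * (G1 - gs y * (1 - 2 * pi%:C * k%:C * y * H)) -
   (H + k%:C * a) * (G2 - gs y * (1 - 2 * pi%:C * k%:C * y * al))).
  rewrite rmorphXn /=; ring.
set D1 := G1 - _ in T1 *; set D2 := G2 - _ in T2 *.
have nka : normc (k%:C * a) <= Y.
  by rewrite normcM normc_nonneg ?(ltW kp) //; apply: le_trans naY; rewrite ler_piMl.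
have ex1 : 1 <= expR (kappa / 4 * V ^+ 2).
  by rewrite -expR0 ler_expR mulr_ge0 ?sqr_ge0 // ltW // divr_gt0.
set ex := expR (kappa / 4 * V ^+ 2) in T1 T2 ex1.
set g := normc (gs y) in T1 T2.
have g0 : 0 <= g by exact: normc_ge0.
have ex0 : 0 <= ex by lra.
have V0 : 0 <= V by lra.
have part (u D : C) : normc u <= Y * V -> normc D <=
    k ^+ 2 * (c * Y ^+ 4) * (g * (V ^+ 4 * ex)) ->
    normc ((u + k%:C * a) * D) <= k ^+ 2 * (2 * c * Y ^+ 5) * (g * (V ^+ 5 * ex)).
  move=> hu hD; rewrite normcM.
  have hu2 : normc (u + k%:C * a) <= 2 * (Y * V).
    apply: le_trans (normcD _ _) _; lra.
  apply: le_trans (ler_pM (normc_ge0 _) (normc_ge0 _) hu2 hD) _.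
  by rewrite le_eqVlt; apply/orP; left; apply/eqP; ring.
have P1 := part _ _ nalV T1; have P2 := part _ _ nH T2.
have P0 : normc ((k ^+ 2)%:C * (gs y * (2 * pi%:C * (a * (y * (al - H)))))) <=
    k ^+ 2 * (16 * Y ^+ 3) * (g * (V ^+ 5 * ex)).
  rewrite normcM normc_nonneg ?sqr_ge0 // -[leRHS]mulrA ler_wpM2l ?sqr_ge0 //.
  rewrite normcM [leRHS]mulrCA -/g ler_wpM2l // !normcM normc_nat normc_pi.
  have hal : normc (al - H) <= 2 * (Y * V).
    apply: le_trans (normcB _ _) _; lra.
  apply: (@le_trans _ _ (2 * 4 * (Y * ((Y * V) * (2 * (Y * V)))))).
    apply: ler_pM; rewrite ?mulr_ge0 ?normc_ge0 ?pi_ge0 //.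
      by rewrite ler_wpM2l // ltW // pi_lt4.
    apply: ler_pM; rewrite ?mulr_ge0 ?normc_ge0 //.
    by apply: ler_pM; rewrite ?normc_ge0.
  rewrite [leLHS](_ : _ = 16 * Y ^+ 3 * V ^+ 2); last by ring.
  rewrite ler_wpM2l ?mulr_ge0 ?exprn_ge0 ?(ltW Y0) //.
  apply: (@le_trans _ _ (V ^+ 5)); first by rewrite ler_weXn2l.
  by rewrite ler_peMr // exprn_ge0.
apply: le_trans (normcD _ _) _.
apply: le_trans (lerD P0 (le_trans (normcB _ _) (lerD P1 P2))) _.
have : g * (V ^+ 5 * ex) <= expR (B + kappa / 2 + 18 / kappa) * expR (- `|x|).
  apply: le_trans (gauss_absorb B x kap0 _ (lexx _)); last by rewrite ltW // divr_gt0.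
  by rewrite ler_wpM2r ?hB // mulr_ge0 ?exprn_ge0 ?expR_ge0.
move: (g * _) => G hG.
rewrite [leLHS](_ : _ = k ^+ 2 * (16 * Y ^+ 3 + 4 * c * Y ^+ 5) * G); last by ring.
rewrite [leRHS](_ : _ = k ^+ 2 * (16 * Y ^+ 3 + 4 * c * Y ^+ 5) *
  (expR (B + kappa / 2 + 18 / kappa) * expR (- `|x|))); last by ring.
have Yg := ltW Y0.
by rewrite ler_wpM2l // mulr_ge0 ?sqr_ge0 // addr_ge0 // !mulr_ge0 ?exprn_ge0.
Qed.

Lemma gs_ray_bound (al b : C) : `|complex.Im al| < complex.Re al ->
  exists2 K : R, 0 <= K & forall x : R,
    normc (gs (al * x%:C + b)) <= K * expR (- `|x|).
Proof.
move=> hal; have hab : `|complex.Im (al - 1)| < 1 + complex.Re (al - 1).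
  by rewrite !ReImE /= oppr0 addr0 addrCA subrr addr0.
have [kappa [B [kap0 hB]]] := gs_path_bound b hab.
exists (expR (B + kappa / 2 + 18 / kappa)); first exact: expR_ge0.
move=> x; have := hB 1 x; rewrite !mul1r addrCA subrr addr0 => /(_ _)/le_trans; apply.
  by rewrite ler01 lexx.
apply: le_trans (gauss_absorb B x kap0 (lexx 0) _); last by rewrite ltW // divr_gt0.
by rewrite mul0r expR0 mulr1 ler_peMr ?expR_ge0 // exprn_ege1 // lerDl.
Qed.

(** In the sum of the Taylor expansions in the directions [al] and [- al] the first-order terms
    cancel. *)
Lemma second_difference (al : C) : `|complex.Im al| < complex.Re al ->
  exists K k0 : R, [/\ 0 <= K, 0 < k0 & forall k x : R, 0 < k <= k0 ->
    normc (gs (al * (x%:C + k%:C)) - 2 * gs (al * x%:C) + gs (al * (x%:C - k%:C)))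
    <= K * k ^+ 2 * expR (- `|x|)].
Proof.
move=> hal; have hab : `|complex.Im (al - 1)| < 1 + complex.Re (al - 1).
  by rewrite !ReImE /= oppr0 addr0 addrCA subrr addr0.
have [kappa [B [kap0 hB]]] := gs_path_bound 0 hab.
have [c c0 taylor] := gs_taylor_dom.
pose Y := 1 + normc al; have na := normc_ge0 al.
have Y1 : 1 <= Y by rewrite /Y; lra.
have Y0 : 0 < Y by lra.
pose k0 := Num.min 1 (kappa / 4 / (12 * Y ^+ 2)).
have Y20 : 0 < 12 * Y ^+ 2 by rewrite mulr_gt0 // exprn_gt0.
exists (2 * c * Y ^+ 4 * expR (B + kappa / 2 + 18 / kappa)), k0; split.
- rewrite mulr_ge0 ?expR_ge0 // !mulr_ge0 ?exprn_ge0 // ltW //.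
- by rewrite lt_min ltr01 !divr_gt0.
move=> k x /andP[kp kk0].
have k1 : k <= 1 by move: kk0; rewrite le_min => /andP[].
have ke : 12 * k * Y ^+ 2 <= kappa / 4.
  move: kk0; rewrite le_min => /andP[_]; rewrite ler_pdivlMr // => h.
  by rewrite [leLHS](_ : _ = k * (12 * Y ^+ 2)) //; ring.
have k01 : 0 <= k <= 1 by rewrite k1 ltW.
set V := 1 + `|x|; have V1 : 1 <= V by rewrite lerDl.
have x0 := normr_ge0 x; have V0 : 0 <= V by lra.
set y := al * x%:C.
have -> : al * (x%:C + k%:C) = y + k%:C * al by rewrite /y; ring.
have -> : al * (x%:C - k%:C) = y + k%:C * (- al) by rewrite /y; ring.
have ny : normc y <= Y * V.
  rewrite normcM normc_real /Y /V; nra.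
have nal : normc al <= Y * V by rewrite /Y /V; nra.
have nal' : normc (- al) <= Y * V by rewrite normcN.
have T1 := taylor _ _ _ _ _ _ Y1 V1 k01 ke ny nal.
have T2 := taylor _ _ _ _ _ _ Y1 V1 k01 ke ny nal'.
have -> : gs (y + k%:C * al) - 2 * gs y + gs (y + k%:C * - al) =
   (gs (y + k%:C * al) - gs y * (1 - 2 * pi%:C * k%:C * y * al)) +
   (gs (y + k%:C * - al) - gs y * (1 - 2 * pi%:C * k%:C * y * - al)).
  by ring.
apply: le_trans (normcD _ _) _; apply: le_trans (lerD T1 T2) _.
have g0 := normc_ge0 (gs y).
have : normc (gs y) * (V ^+ 4 * expR (kappa / 4 * V ^+ 2)) <=
    expR (B + kappa / 2 + 18 / kappa) * expR (- `|x|).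
  apply: le_trans (gauss_absorb B x kap0 _ (lexx _)); last by rewrite ltW // divr_gt0.
  apply: ler_pM => //; first by rewrite mulr_ge0 ?exprn_ge0 ?expR_ge0.
    have := hB 1 x; rewrite mulr0 addr0 mul1r addrCA subrr addr0; apply.
    by rewrite ler01 lexx.
  by rewrite ler_wpM2r ?expR_ge0 // ler_weXn2l.
move: (normc _ * _) => G hG.
rewrite [leLHS](_ : _ = k ^+ 2 * (2 * c * Y ^+ 4) * G); last by ring.
rewrite [leRHS](_ : _ = k ^+ 2 * (2 * c * Y ^+ 4) *
  (expR (B + kappa / 2 + 18 / kappa) * expR (- `|x|))); last by ring.
have Yg := ltW Y0.
by rewrite ler_wpM2l // mulr_ge0 ?sqr_ge0 // !mulr_ge0 ?exprn_ge0.
Qed.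

Definition grid (N : nat) (m : int) : R := m%:~R / N%:R.

Lemma grid_norm N m : `|grid N m| = (N%:R)^-1 * `|m|%N%:R.
Proof.
by rewrite /grid normrM normfV normr_nat mulrC natr_absz intr_norm.
Qed.

Lemma gridS N m : grid N (m + 1) = grid N m + (N%:R)^-1.
Proof. by rewrite /grid rmorphD mulrDl /= div1r. Qed.

(** The sums carry no factor 1/N, so exponential decay on the grid bounds them by O(N) only; a
    summand with the extra factor 1/N^2 has a sum of order 1/N. *)
Lemma grid_dominated (f : int -> C) (K : R) N : (0 < N)%N -> 0 <= K ->
  (forall m, normc (f m) <= K * expR (- `|grid N m|)) ->
  absum f /\ forall S, hsum f S -> normc S <= K * (2 * (1 + N%:R)).
Proof.
move=> N0 K0 fK.
have N1 : 0 < (N%:R)^-1 :> R by rewrite invr_gt0 ltr0n.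
have bd (A : {fset int}) : \sum_(m <- A) normc (f m) <= K * (2 * (1 + N%:R)).
  have := sum_geometric_int A N1; rewrite invrK => /(ler_wpM2l K0); apply: le_trans.
  rewrite mulr_sumr; apply: ler_sum => m _.
  by rewrite -grid_norm.
split; first by exists (K * (2 * (1 + N%:R))).
move=> S hS; apply: hsum_normc_le hS _ => A.
exact: le_trans (normc_sum _ _ _) (bd A).
Qed.

(** N steps of length 1/N, each changing the sum by at most 4K/N. The total change stays bounded
    while the sums themselves have size N. *)
Lemma total_path (a b : C) : `|complex.Im a| < 1 + complex.Re a ->
  exists (K : R) (N0 : nat), 0 <= K /\ forall N T0 T1, (N0 <= N)%N -> (0 < N)%N ->
    hsum (fun m : int => gs ((grid N m)%:C)) T0 ->
    hsum (fun m : int => (1 + a) * gs ((1 + a) * (grid N m)%:C + b)) T1 ->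
    normc (T1 - T0) <= K.
Proof.
move=> hab; have [K [k0 [K0 k00 step]]] := path_step b hab.
have [kappa [B [kap0 hB]]] := gs_path_bound b hab.
exists (4 * K), (Num.bound k0^-1); split; first by rewrite mulr_ge0.
move=> N T0 T1 N0N N0 hT0 hT1.
have NR : 0 < N%:R :> R by rewrite ltr0n.
set k : R := (N%:R)^-1; have kp : 0 < k by rewrite invr_gt0.
have kk0 : 0 < k <= k0.
  rewrite kp /= /k -[leRHS]invrK lef_pV2 ?posrE ?invr_gt0 //.
  apply: le_trans (_ : (Num.bound k0^-1)%:R <= _); last by rewrite ler_nat.
  by rewrite ltW //; apply: le_lt_trans (archi_boundP _) => //; rewrite invr_ge0 ltW.
pose f (s : R) (m : int) : C :=
  (1 + s%:C * a) * gs ((1 + s%:C * a) * (grid N m)%:C + s%:C * b).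
have fs s : 0 <= s <= 1 -> absum (f s).
  move=> s01; apply: (grid_dominated N0 (_ : 0 <=
    normc (1 + s%:C * a) * expR (B + kappa / 2 + 18 / kappa)) _).1.
    by rewrite mulr_ge0 ?normc_ge0 ?expR_ge0.
  move=> m; rewrite normcM -mulrA ler_wpM2l ?normc_ge0 //.
  apply: le_trans (hB _ _ s01) _.
  apply: le_trans (gauss_absorb B _ kap0 (lexx 0) _); last by rewrite ltW // divr_gt0.
  by rewrite mul0r expR0 mulr1 ler_peMr ?expR_ge0 // exprn_ege1 // lerDl.
have T i : {t | (i <= N)%N -> hsum (f (i%:R * k)) t}.
  apply: cid; have [iN|iN] := leqP i N; last by exists 0.
  have [|t ht] := absum_hsum (fs (i%:R * k) _); last by exists t.
  by rewrite mulr_ge0 //= /k ?ler_pdivrMr ?mul1r ?ler_nat // ltW.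
have stepT i : (i < N)%N -> normc (sval (T i.+1) - sval (T i)) <= 4 * K * k.
  move=> iN; have hS := svalP (T i.+1) iN; have hs := svalP (T i) (ltnW iN).
  have s01 : 0 <= i%:R * k <= 1.
    by rewrite mulr_ge0 //= /k ?ler_pdivrMr ?mul1r ?ler_nat ?(ltnW iN) // ltW.
  set s := i%:R * k in s01 hs.
  (* The difference of [psi] between neighbouring grid points sums to zero, so subtracting it leaves
     the sum unchanged and reduces the summand to the error of [path_step]. *)
  pose psi (m : int) : C := (a * (grid N m)%:C + b) *
    gs ((1 + s%:C * a) * (grid N m)%:C + s%:C * b).
  have sE : (i.+1%:R * k)%:C = s%:C + k%:C by rewrite -natr1 mulrDl mul1r rmorphD.
  have gE m : (grid N (m + 1))%:C = (grid N m)%:C + k%:C by rewrite gridS rmorphD.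
  have [U hU] : exists U, hsum psi U.
    apply: absum_hsum; apply: (grid_dominated N0 (_ : 0 <=
      (normc a + normc b) * expR (B + kappa / 2 + 18 / kappa)) _).1.
      by rewrite mulr_ge0 ?addr_ge0 ?normc_ge0 ?expR_ge0.
    move=> m; rewrite normcM -mulrA.
    have na := normc_ge0 a; have nb := normc_ge0 b.
    have hV : normc (a * (grid N m)%:C + b) <= (normc a + normc b) * (1 + `|grid N m|).
      apply: le_trans (normcD _ _) _; rewrite normcM normc_real.
      have := normr_ge0 (grid N m); nra.
    apply: le_trans (ler_pM (normc_ge0 _) (normc_ge0 _) hV (hB _ _ s01)) _.
    rewrite -mulrA ler_wpM2l ?addr_ge0 //.
    apply: le_trans (gauss_absorb B _ kap0 (lexx 0) _); last by rewrite ltW // divr_gt0.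
    rewrite mulrC ler_wpM2l ?expR_ge0 // mul0r expR0 mulr1.
    by rewrite ler_eXnr // lerDl.
  have hU1 : hsum (fun m => psi (m + 1)) U.
    have sK : cancel (fun m : int => m + 1) (fun m => m - 1) by move=> m; rewrite addrK.
    have pK : cancel (fun m : int => m - 1) (fun m => m + 1) by move=> m; rewrite subrK.
    exact: (hsum_bij psi U sK pK).1 hU.
  have hd := hsumB (hsumB hS hs) (hsumB hU1 hU); rewrite subrr subr0 in hd.
  have [|_ h] := grid_dominated N0 (mulr_ge0 K0 (sqr_ge0 k)) (f :=
    (fun m => f (i.+1%:R * k) m - f s m - (psi (m + 1) - psi m))).
    by move=> m; rewrite /f /psi sE gE; exact: step.
  apply: le_trans (h _ hd) _.
  have kN : k * N%:R = 1 by rewrite /k mulVf // gt_eqF.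
  have N1 : 1 <= N%:R :> R by rewrite ler1n.
  have -> : 4 * K * k = K * k ^+ 2 * (4 * N%:R).
    have -> : K * k ^+ 2 * (4 * N%:R) = 4 * K * k * (k * N%:R) by ring.
    by rewrite kN mulr1.
  rewrite ler_wpM2l ?mulr_ge0 ?sqr_ge0 //; lra.
have tot n : (n <= N)%N -> normc (sval (T n) - sval (T 0%N)) <= n%:R * (4 * K * k).
  elim: n => [|n IH] nN; first by rewrite subrr normc0 mul0r.
  rewrite [leRHS](_ : _ = n%:R * (4 * K * k) + 4 * K * k); last first.
    by rewrite -natr1 mulrDl mul1r.
  have -> : sval (T n.+1) - sval (T 0%N) =
     (sval (T n) - sval (T 0%N)) + (sval (T n.+1) - sval (T n)) by ring.
  by apply: le_trans (normcD _ _) _; rewrite lerD ?IH ?stepT // ltnW.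
have -> : T0 = sval (T 0%N).
  apply: hsum_uniq hT0 _; apply: eq_hsum (svalP (T 0%N) isT) => m.
  by rewrite /f !mul0r !addr0 !mul1r.
have -> : T1 = sval (T N).
  apply: hsum_uniq hT1 _; apply: eq_hsum (svalP (T N) (leqnn N)) => m.
  by rewrite /f /k divff ?gt_eqF // rmorph1 !mul1r.
apply: le_trans (tot N (leqnn N)) _.
by rewrite /k mulrCA divff ?gt_eqF // mulr1.
Qed.

End RiemannSums.

(** * The inversion formula *)

Section ThetaInversion.
Local Open Scope complex_scope.
Local Open Scope ring_scope.
Variable R : realType.
Local Notation C := (R[i]).

Lemma ee_realE (x : R) : ee x%:C = cos (2 * pi * x) +i* sin (2 * pi * x).
Proof.
rewrite /ee ceE ReM ImM /= !mul0r !mulr0 subr0 add0r expR0.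
by rewrite rmorph1 mul1r.
Qed.

Lemma ee_ratio_neq1 (r N : nat) : (0 < r < N)%N -> ee (r%:R / N%:R : C) != 1.
Proof.
move=> /andP[r0 rN]; have N0 : 0 < N%:R :> R by rewrite ltr0n (leq_trans _ rN).
rewrite (_ : r%:R / N%:R = (r%:R / N%:R : R)%:C); last by rewrite fmorph_div !rmorph_nat.
set x : R := _ / _; rewrite ee_realE; apply/eqP => -[h _].
have x0 : 0 < x by rewrite divr_gt0 // ltr0n.
have x1 : x < 1 by rewrite ltr_pdivrMr // mul1r ltr_nat.
have : 0 < sin (pi * x).
  by apply: sin_gt0_pi; rewrite mulr_gt0 ?pi_gt0 //= gtr_pMr ?pi_gt0.
have : cos (2 * pi * x) = 1 - 2 * sin (pi * x) ^+ 2.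
  have -> : 2 * pi * x = pi * x + pi * x by ring.
  by rewrite cosD -!expr2 cos2sin2; ring.
rewrite h => E p; have : 0 < sin (pi * x) ^+ 2 by rewrite exprn_gt0.
lra.
Qed.

Lemma sum_ee_orth (N : nat) (d : int) : (0 < N)%N ->
  \sum_(i < N) ee (i%:R * (d%:~R / N%:R) : C) = if (N %| d)%Z then N%:R else 0.
Proof.
move=> N0; have NC : N%:R != 0 :> C by rewrite pnatr_eq0 -lt0n.
set z := ee (d%:~R / N%:R : C).
have zE i : ee (i%:R * (d%:~R / N%:R) : C) = z ^+ i by rewrite eeMn.
under eq_bigr do rewrite zE.
have zN : z ^+ N = 1 by rewrite -zE mulrC divfK // ee_int.
case: ifP => Nd.
  have -> : z = 1.
    rewrite /z; have /dvdzP[q ->] := Nd.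
    by rewrite rmorphM /= -[(Posz N)%:~R]/(N%:R : C) mulfK // ee_int.
  by under eq_bigr do rewrite expr1n; rewrite sumr_const card_ord.
have z1 : z != 1.
  have E := divz_eq d N; set r := (d %% N)%Z in E.
  have r0 : 0 <= r by apply: modz_ge0; lia.
  have rN : r < N by apply: ltz_pmod.
  have rn0 : r != 0 by apply: contraFN Nd => /eqP r00; apply/dvdz_mod0P.
  have rE : r = `|r|%N by rewrite gez0_abs.
  rewrite /z E rmorphD rmorphM /= mulrDl -[(Posz N)%:~R]/(N%:R : C) mulfK //.
  rewrite eeD ee_int mul1r rE; apply: ee_ratio_neq1.
  by apply/andP; split; lia.
apply/eqP; have := subrX1 z N; rewrite zN subrr => /esym/eqP.
by rewrite mulf_eq0 subr_eq0 (negbTE z1).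
Qed.

(** The left factor of a summation by parts: its norm is 4 sin^2(pi x), and [sin_lower] applies
    because pi |x| <= pi/2. *)
Lemma ee_second_difference (x : R) : `|x| <= 1 / 2 ->
  x ^+ 2 <= normc (ee x%:C - 2 + ee (- x%:C) : C).
Proof.
move=> hx; have -> : - x%:C = (- x)%:C by rewrite rmorphN.
rewrite !ee_realE mulrN cosN sinN.
have -> : cos (2 * pi * x) +i* sin (2 * pi * x) - 2 + cos (2 * pi * x) -i* sin (2 * pi * x) =
    (2 * (cos (2 * pi * x) - 1))%:C.
  by apply: complex_eq; rewrite /=; ring.
rewrite normc_real.
wlog x0 : x hx / 0 <= x.
  move=> h; have [/h//|x0] := leP 0 x; first exact.
  have := h (- x); rewrite normrN sqrrN mulrN cosN; apply => //; lra.
rewrite ger0_norm // in hx.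
have p0 := @pi_gt0 R; have p2 := @pi_ge2 R.
have s : pi * x / 4 <= sin (pi * x).
  by apply: sin_lower; apply/andP; split; nra.
have -> : cos (2 * pi * x) - 1 = - (2 * sin (pi * x) ^+ 2).
  have -> : 2 * pi * x = pi * x + pi * x by ring.
  by rewrite cosD -!expr2 cos2sin2; ring.
rewrite mulrN normrN ger0_norm; last by rewrite mulr_ge0 // mulr_ge0 // sqr_ge0.
have : x / 2 <= sin (pi * x) by nra.
move: (sin _) => S hS; nra.
Qed.

(** The principal square roots of the open right half-plane: both [al] and its square have positive
    real part, hence [gs (al x)] decays in real x. *)
Definition sector (al : C) := `|complex.Im al| < complex.Re al.

Lemma sector_neq0 al : sector al -> al != 0.
Proof. by rewrite /sector; case: eqP => // -> /=; rewrite normr0 ltxx. Qed.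

Lemma sector_inv al : sector al -> sector al^-1.
Proof.
case: al => a b; rewrite /sector /= => h.
have n0 : 0 < a ^+ 2 + b ^+ 2.
  by have := normr_ge0 b; have := sqr_ge0 b; nra.
by rewrite normrN normrM normfV (gtr0_norm n0) ltr_pM2r ?invr_gt0.
Qed.

Lemma absum_gs_int al : sector al -> absum (fun n : int => gs (al * n%:~R)).
Proof.
move=> hal; have [K K0 hK] := gs_ray_bound 0 hal.
apply: (@grid_dominated R _ K 1%N isT K0 _).1 => m; have := hK (grid R 1 m).
by rewrite addr0 /grid divr1 -intC.
Qed.

Lemma absum_gs_grid al b N : sector al -> (0 < N)%N ->
  absum (fun m : int => gs (al * (grid R N m)%:C + b)).
Proof.
move=> hal N0; have [K K0 hK] := gs_ray_bound b hal.
by apply: (grid_dominated N0 K0 _).1 => m; exact: hK.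
Qed.

Lemma sector_sub1 al : sector al -> `|complex.Im (al - 1)| < 1 + complex.Re (al - 1).
Proof. by rewrite /sector => h; rewrite !ReImE /= oppr0 addr0 addrCA subrr addr0. Qed.

Definition fourier_term al N (n m : int) : C :=
  gs (al * (grid R N m)%:C) * ee (- (n%:~R * (grid R N m)%:C)).

Lemma normc_ee_realM (x y : R) : normc (ee (- (x%:C * y%:C))) = 1.
Proof. by rewrite normc_ee_real // ImN ImMr /= mulr0 oppr0. Qed.

Lemma normc_fourier_term al N n m :
  normc (fourier_term al N n m) = normc (gs (al * (grid R N m)%:C)).
Proof.
by rewrite /fourier_term normcM (intC R n) normc_ee_realM mulr1.
Qed.

(** Completing the square, gs(al x) e(-n x) = gs(w) gs(al x + i w) with w = n / al. So the Fourier
    sum is, up to a constant, the endpoint of the path towards (al, i w). *)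
Lemma fourier_limit al (n : int) : sector al ->
  exists (K : R) (N0 : nat), 0 <= K /\ forall N T0 B, (N0 <= N)%N -> (0 < N)%N ->
    hsum (fun m : int => gs ((grid R N m)%:C)) T0 -> hsum (fourier_term al N n) B ->
    normc (al * B - gs (al^-1 * n%:~R) * T0) <= K.
Proof.
move=> hal; set w := al^-1 * n%:~R; pose b : C := 'i * w.
have al0 := sector_neq0 hal.
have [K [N0 [K0 h]]] := total_path b (sector_sub1 hal).
exists (normc (gs w) * K), N0; split; first by rewrite mulr_ge0 ?normc_ge0.
move=> N T0 B N0N Np hT0 hB; set g := gs w.
have g0 : g != 0 by exact: ce_neq0.
have gE m : gs (al * (grid R N m)%:C + b) = g^-1 * fourier_term al N n m.
  have i2 : 'i ^+ 2 = -1 :> C by exact: sqr_i.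
  set x := (grid R N m)%:C.
  have sqE : (al * x + b) ^+ 2 = (al * x) ^+ 2 + 2 * (al * x) * ('i * w) - w ^+ 2.
    have -> : (al * x + b) ^+ 2 =
      (al * x) ^+ 2 + 2 * (al * x) * ('i * w) + 'i ^+ 2 * w ^+ 2 by rewrite /b; ring.
    by rewrite i2 mulN1r.
  have cE : cpi2i R = 2 * pi%:C * 'i.
    by apply: complex_eq; rewrite !ReImE /=; ring.
  rewrite /fourier_term /g /gs /ee -ceN -!ceD sqE cE; congr ce.
  by rewrite /w; field.
have hT1 : hsum (fun m => (1 + (al - 1)) * gs ((1 + (al - 1)) * (grid R N m)%:C + b))
    (al * (g^-1 * B)).
  have -> : 1 + (al - 1) = al by ring.
  apply: hsumZ; apply: eq_hsum (hsumZ g^-1 hB) => m; by rewrite gE.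
have := h N T0 _ N0N Np hT0 hT1; set X := _ - T0 => hX.
have -> : al * B - g * T0 = g * X by rewrite /X; field.
by rewrite normcM ler_wpM2l ?normc_ge0.
Qed.

(** Two summations by parts: shifting the grid by one point either way turns the phases into the
    factor of [ee_second_difference] at n/N, so (n/N)^2 |B| is at most a sum of second differences,
    of order 1/N. Adding the trivial bound |B| = O(N) gives the denominator 1 + n^2. *)
Lemma fourier_bound al : sector al ->
  exists (K : R) (N0 : nat), 0 <= K /\ forall N (n : int) B, (N0 <= N)%N -> (0 < N)%N ->
    (2 * `|n| <= N)%N -> hsum (fourier_term al N n) B ->
    normc B <= K * N%:R / (1 + n%:~R ^+ 2).
Proof.
move=> hal; have [K1 K10 h1] := gs_ray_bound 0 hal.
have [K2 [k0 [K20 k00 h2]]] := second_difference hal.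
exists (4 * K1 + 4 * K2), (Num.bound k0^-1); split; first by rewrite addr_ge0 ?mulr_ge0.
move=> N n B N0N Np nN hB.
have NR : 0 < N%:R :> R by rewrite ltr0n.
have N1 : 1 <= N%:R :> R by rewrite ler1n.
set k : R := (N%:R)^-1; have kp : 0 < k by rewrite invr_gt0.
have kN : k * N%:R = 1 by rewrite /k mulVf // gt_eqF.
have kk0 : 0 < k <= k0.
  rewrite kp /= /k -[leRHS]invrK lef_pV2 ?posrE ?invr_gt0 //.
  apply: le_trans (_ : (Num.bound k0^-1)%:R <= _); last by rewrite ler_nat.
  by rewrite ltW //; apply: le_lt_trans (archi_boundP _) => //; rewrite invr_ge0 ltW.
have b1 : normc B <= 4 * K1 * N%:R.
  have [|_ h] := grid_dominated Np K10 (f := fourier_term al N n).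
    by move=> m; rewrite normc_fourier_term; have := h1 (grid R N m); rewrite addr0.
  apply: le_trans (h _ hB) _; rewrite -[leRHS]mulrA [leRHS]mulrCA ler_wpM2l //; lra.
pose x : R := n%:~R * k.
have b2 : normc B * x ^+ 2 <= 4 * K2 * k.
  have hx : `|x| <= 1 / 2.
    rewrite /x normrM (gtr0_norm kp) -intr_norm -natr_absz.
    rewrite /k ler_pdivrMr // mul1r mulrC ler_pdivlMr // -natrM ler_nat mulnC //.
  have gS m : (grid R N (m + 1))%:C = (grid R N m)%:C + k%:C :> C.
    by rewrite gridS rmorphD.
  have nx : x%:C = n%:~R * k%:C by rewrite rmorphM /= intC.
  have sK : cancel (fun m : int => m + 1) (fun m => m - 1) by move=> m; rewrite addrK.
  have pK : cancel (fun m : int => m - 1) (fun m => m + 1) by move=> m; rewrite subrK.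
  have hp := (hsum_bij _ B sK pK).1 hB; have hm := (hsum_bij _ B pK sK).1 hB.
  have hd := hsumD (hsumB (hsumZ (ee x%:C) hp) (hsumZ 2 hB)) (hsumZ (ee (- x%:C)) hm).
  have gP m : (grid R N (m - 1))%:C = (grid R N m)%:C - k%:C :> C.
    by have := gS (m - 1); rewrite subrK => ->; rewrite addrK.
  have [|_ h] := grid_dominated Np (mulr_ge0 K20 (sqr_ge0 k)) (f :=
    (fun m => ee x%:C * fourier_term al N n (m + 1) - 2 * fourier_term al N n m +
      ee (- x%:C) * fourier_term al N n (m - 1))).
    move=> m; apply: le_trans (h2 k (grid R N m) kk0).
    rewrite /fourier_term gS gP nx !mulrDr !opprD !mulrN !opprK !eeD.
    set E := ee (- (n%:~R * (grid R N m)%:C)); set u := ee (n%:~R * k%:C).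
    have -> : ee (- (n%:~R * k%:C)) = u^-1 by rewrite eeN.
    have u0 : u != 0 by exact: ee_neq0.
    have nE : normc E = 1 by rewrite /E intC normc_ee_realM.
    rewrite -[leRHS]mulr1 -nE -normcM le_eqVlt; apply/orP; left; apply/eqP.
    by congr normc; field.
  have := h _ hd.
  have -> : ee x%:C * B - 2 * B + ee (- x%:C) * B = B * (ee x%:C - 2 + ee (- x%:C)).
    by ring.
  rewrite normcM => h3; have h4 := ee_second_difference hx.
  apply: le_trans (ler_wpM2l (normc_ge0 B) h4) _; apply: le_trans h3 _.
  have -> : 4 * K2 * k = K2 * k ^+ 2 * (4 * N%:R).
    have -> : K2 * k ^+ 2 * (4 * N%:R) = 4 * K2 * k * (k * N%:R) by ring.
    by rewrite kN mulr1.
  rewrite ler_wpM2l ?mulr_ge0 ?sqr_ge0 //; lra.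
have n2 := sqr_ge0 (n%:~R : R).
rewrite ler_pdivlMr; last by lra.
have b3 : normc B * n%:~R ^+ 2 <= 4 * K2 * N%:R.
  have -> : normc B * n%:~R ^+ 2 = normc B * x ^+ 2 * N%:R ^+ 2.
    have -> : normc B * x ^+ 2 * N%:R ^+ 2 = normc B * n%:~R ^+ 2 * (k * N%:R) ^+ 2.
      by rewrite /x; ring.
    by rewrite kN expr1n mulr1.
  apply: le_trans (ler_wpM2r (sqr_ge0 _) b2) _.
  have -> : 4 * K2 * k * N%:R ^+ 2 = 4 * K2 * N%:R * (k * N%:R) by ring.
  by rewrite kN mulr1.
lra.
Qed.

(** The frequencies run over the symmetric system -M <= n < M of residues modulo 2M, as
    [fourier_bound] requires. Orthogonality keeps the grid points m congruent to j, and these are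
    the points l + j/(2M). *)
Lemma finite_inversion al (M : nat) (j : int) (G : C) (B : int -> C) : (0 < M)%N ->
  hsum (fun l : int => gs (al * (l%:~R + j%:~R / (2 * M)%N%:R))) G ->
  (forall n, hsum (fourier_term al (2 * M) n) (B n)) ->
  \sum_(i < 2 * M) B (i%:Z - M%:Z) * ee ((i%:Z - M%:Z)%:~R * (j%:~R / (2 * M)%N%:R)) =
  (2 * M)%N%:R * G.
Proof.
move=> M0 hG hB; set N := (2 * M)%N in hG hB *.
have N0 : (0 < N)%N by rewrite muln_gt0.
have NC : N%:R != 0 :> C by rewrite pnatr_eq0 -lt0n.
have NR : N%:R != 0 :> R by rewrite pnatr_eq0 -lt0n.
have gC m : (grid R N m)%:C = m%:~R / N%:R :> C.
  by rewrite /grid fmorph_div rmorph_int rmorph_nat.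
have h1 := hsum_sum (index_enum 'I_N) (fun (i : 'I_N) (_ : true) =>
  hsumZr (ee ((i%:Z - M%:Z)%:~R * (j%:~R / N%:R))) (hB (i%:Z - M%:Z))).
apply: hsum_uniq h1 _.
pose f (m : int) : C := gs (al * (m%:~R / N%:R)) *
  (if (N %| j - m)%Z then N%:R else 0).
apply: (@eq_hsum _ _ f).
  move=> m /=; rewrite /f -sum_ee_orth // mulr_sumr.
  have [dv|dv] := boolP (N %| j - m)%Z; last first.
    rewrite -mulr_sumr sum_ee_orth // (negbTE dv) mulr0.
    pose w : C := gs (al * (m%:~R / N%:R)) * ee (- (M%:R * ((j - m)%:~R / N%:R))).
    transitivity (w * \sum_(i < N) ee (i%:R * ((j - m)%:~R / N%:R))).
      by rewrite sum_ee_orth // (negbTE dv) mulr0.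
    rewrite mulr_sumr; apply: eq_bigr => i _.
    rewrite /w /fourier_term gC -!mulrA -!eeD; congr (_ * ee _).
    rewrite !rmorphB /= -![(Posz _)%:~R]/(_%:R : C); ring.
  apply: eq_bigr => i _; rewrite /fourier_term gC -mulrA -eeD; congr (_ * _).
  have /dvdzP[q qE] := dv.
  have -> : i%:R * ((j - m)%:~R / N%:R) = (i%:Z * q)%:~R :> C.
    by rewrite qE !rmorphM /= -[(Posz N)%:~R]/(N%:R : C) mulfK.
  rewrite ee_int.
  have -> : - ((i%:Z - M%:Z)%:~R * (m%:~R / N%:R)) +
     (i%:Z - M%:Z)%:~R * (j%:~R / N%:R) = ((i%:Z - M%:Z) * q)%:~R :> C.
    have -> : - ((i%:Z - M%:Z)%:~R * (m%:~R / N%:R)) +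
       (i%:Z - M%:Z)%:~R * (j%:~R / N%:R) =
       (i%:Z - M%:Z)%:~R * ((j - m)%:~R / N%:R) :> C.
      by rewrite (rmorphB _ j) /=; ring.
    by rewrite qE (rmorphM _ q) /= -[(Posz N)%:~R]/(N%:R : C) mulfK // rmorphM.
  by rewrite ee_int.
apply: (hsum_inj (h := fun l : int => j + l * N%:Z)).
- by move=> l l' /addrI/mulIf; apply; lia.
- move=> m hm; rewrite /f; case: ifP => [/dvdzP[q qE]|_]; last by rewrite mulr0.
  by case: (hm (- q)); rewrite mulNr -qE; ring.
- apply: eq_hsum (hsumZ N%:R hG) => l; rewrite /f.
  have -> : (N %| j - (j + l * N%:Z))%Z.
    by rewrite opprD addrA subrr add0r -mulNr dvdz_mull.
  rewrite mulrC; congr (gs (al * _) * _).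
  by rewrite intrD intrM -[(Posz N)%:~R]/(N%:R : C); field.
Qed.

Lemma absum_inv_sqr : absum (fun n : int => ((1 + n%:~R ^+ 2)^-1 : R)%:C : C).
Proof.
pose f (n : nat) : R := (1 + n%:R ^+ 2)^-1.
have f0 n : 0 <= f n by rewrite invr_ge0 addr_ge0 ?sqr_ge0.
have nat_case : forall A : {fset nat}, \sum_(n <- A) f n <= 4.
  move=> A; have sub : (A `<=` [fset i | i in iota 0 (\max_(i <- A) i).+1])%fset.
    apply/fsubsetP => i iA; have : (i < (\max_(i <- A) i).+1)%N.
      by rewrite ltnS; apply: (leq_bigmax_seq (F := id)).
    move: (\max_(i <- A) i).+1 => n iN; apply/imfsetP; exists i => //=.
    by rewrite mem_iota /= add0n.
  apply: le_trans (absum_subset f0 sub) _.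
  rewrite big_fset_iota; move: (\max_(i <- A) i) => n.
  (* The right side telescopes with increments 2/((n+1)(n+2)), which dominate the terms. *)
  have h : \sum_(i < n.+1) f i <= 4 - 2 / n.+1%:R.
    elim: n => [|n IH]; first by rewrite big_ord1 /f expr0n /= addr0; lra.
    rewrite big_ord_recr /=; apply: le_trans (lerD IH (lexx _)) _.
    rewrite /f -!natr1; set x : R := n%:R; have x0 : 0 <= x by rewrite ler0n.
    have p1 : 0 < x + 1 by lra.
    have p2 : 0 < x + 1 + 1 by lra.
    have p3 : 0 < 1 + (x + 1) ^+ 2 by rewrite ltr_wpDr ?sqr_ge0.
    have E : 2 / (x + 1) - 2 / (x + 1 + 1) = 2 / ((x + 1) * (x + 1 + 1)).
      by field; rewrite !gt_eqF.
    have : (1 + (x + 1) ^+ 2)^-1 <= 2 / ((x + 1) * (x + 1 + 1)).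
      by rewrite -[leLHS]div1r ler_pdivrMr // mulrAC ler_pdivlMr ?mulr_gt0 //; nra.
    lra.
  apply: le_trans h _; by rewrite gerBl divr_ge0.
have fa : absum (fun n : nat => (f n)%:C : C).
  by exists 4 => A; under eq_bigr do rewrite normc_nonneg //.
have [S hS] := absum_hsum fa.
have [T hT] : exists T, hsum ((fun n : nat => (f n)%:C : C) \o succn) T.
  by apply: absum_hsum; apply: absum_comp fa; exact: succn_inj.
apply: hsum_absum (hsum_int (S := S) (T := T) _ _).
  by apply: eq_hsum hS.
apply: eq_hsum hT => n; rewrite /= /f NegzE mulrNz sqrrN.
by [].
Qed.

Lemma hsum_finType (T : finType) (f : T -> C) : hsum f (\sum_i f i).
Proof.
have h (j : T) : hsum (fun i => if i == j then f j else 0) (f j).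
  have := @hsum_single R T j (fun i => if i == j then f j else 0).
  by rewrite eqxx; apply=> i /negbTE ->.
apply: eq_hsum (hsum_sum (index_enum T) (fun j (_ : true) => h j)) => i.
rewrite (bigD1 i) //= eqxx big1 ?addr0 // => j; by rewrite eq_sym => /negbTE ->.
Qed.

(** The modulus is a multiple of 2D, so that j/D is a grid point. After division by N, the frequency
    terms outside the window are set to zero, and the terms of [H] times T0(N)/N are subtracted.
    Each difference tends to 0 by [fourier_limit], and [fourier_bound] supplies the domination. The
    limit of T0(N)/N stays unknown here. *)
Lemma theta_limit al (D : nat) (j : int) (G H : C) (T0 : nat -> C) : sector al ->
  (0 < D)%N ->
  hsum (fun l : int => gs (al * (l%:~R + j%:~R / D%:R))) G ->
  hsum (fun n : int => gs (al^-1 * n%:~R) * ee (n%:~R * (j%:~R / D%:R))) H ->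
  (forall N, (0 < N)%N -> hsum (fun m : int => gs ((grid R N m)%:C)) (T0 N)) ->
  forall e, 0 < e -> exists k0, forall k, (k0 <= k)%N ->
    normc (al * G - T0 (2 * (D * k.+1))%N / (2 * (D * k.+1))%N%:R * H) <= e.
Proof.
move=> hal D0 hG hH hT0.
have [K [N0 [K0 hK]]] := fourier_bound hal.
have s1 : sector 1 by rewrite /sector /= normr0 ltr01.
have [K1 K10 hK1] := gs_ray_bound 0 s1.
(* The offset [N0] puts every modulus in the range of [fourier_bound]; it is removed at the end by
   taking k - N0. *)
pose M k := (D * (k + N0).+1)%N; pose N k := (2 * M k)%N.
have M0 k : (0 < M k)%N by rewrite muln_gt0 D0.
have NN k : (0 < N k)%N by rewrite muln_gt0 M0.
have NN0 k : (k + N0 <= N k)%N.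
  apply: leq_trans (_ : (k + N0).+1 <= _)%N => //.
  by rewrite /N /M mulnA leq_pmull // muln_gt0 D0.
have hB k n : {B | hsum (fourier_term al (N k) n) B}.
  apply: cid; apply: absum_hsum; have := absum_gs_grid 0 hal (NN k).
  apply: absum_le => m; instantiate (1 := 1).
  by rewrite normc_fourier_term addr0 mul1r.
pose B k n := sval (hB k n).
have hBs k n : hsum (fourier_term al (N k) n) (B k n) := svalP (hB k n).
pose win k (n : int) := (- (M k)%:Z <= n < (M k)%:Z).
have NR k : 0 < (N k)%:R :> R by rewrite ltr0n.
have NC k : (N k)%:R != 0 :> C by rewrite pnatr_eq0 -lt0n.
pose t k : C := T0 (N k) / (N k)%:R.
pose F k (n : int) : C := ((if win k n then al * B k n / (N k)%:R else 0) -
  gs (al^-1 * n%:~R) * t k) * ee (n%:~R * (j%:~R / D%:R)).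
have nee (n : int) : normc (ee (n%:~R * (j%:~R / D%:R)) : C) = 1.
  rewrite normc_ee_real // (_ : j%:~R / D%:R = (j%:~R / D%:R : R)%:C).
    by rewrite intC ImMr /= mulr0.
  by rewrite fmorph_div rmorph_int rmorph_nat.
have tb k : normc (t k) <= 4 * K1.
  have [|_ h] := grid_dominated (NN k) K10 (f := fun m => gs ((grid R (N k) m)%:C)).
    by move=> m; have := hK1 (grid R (N k) m); rewrite mul1r addr0.
  rewrite /t normcM normcV normc_nat ler_pdivrMr //.
  apply: le_trans (h _ (hT0 _ (NN k))) _.
  rewrite -[leRHS]mulrA [leRHS]mulrCA ler_wpM2l //.
  have : 1 <= (N k)%:R :> R by rewrite ler1n.
  lra.
pose d (n : int) : C := (normc al * K * (1 + n%:~R ^+ 2)^-1)%:C +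
  (4 * K1 * normc (gs (al^-1 * n%:~R)))%:C.
have ad : absum d.
  apply: absumD.
    apply: absum_le absum_inv_sqr => n; instantiate (1 := normc al * K).
    rewrite !normc_nonneg ?mulr_ge0 ?normc_ge0 // invr_ge0 addr_ge0 ?sqr_ge0 //.
  apply: absum_le (absum_gs_int (sector_inv hal)) => n; instantiate (1 := 4 * K1).
  by rewrite normc_nonneg ?mulr_ge0 ?normc_ge0.
have Fd k n : normc (F k n) <= normc (d n).
  have i0 : 0 <= (1 + n%:~R ^+ 2 : R)^-1 by rewrite invr_ge0 addr_ge0 ?sqr_ge0.
  rewrite /d -rmorphD normc_nonneg; last by rewrite addr_ge0 ?mulr_ge0 ?normc_ge0.
  rewrite /F normcM nee mulr1; apply: le_trans (normcB _ _) _; apply: lerD; last first.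
    by rewrite normcM mulrC ler_wpM2r ?normc_ge0.
  case: ifP => [/andP[w1 w2]|_]; last by rewrite normc0 !mulr_ge0 ?normc_ge0.
  rewrite -mulrA !normcM normcV normc_nat -mulrA ler_wpM2l ?normc_ge0 //.
  rewrite ler_pdivrMr //; have := hK (N k) n (B k n) _ (NN k) _ (hBs k n).
  rewrite [K * _ * _]mulrAC; apply.
    by apply: leq_trans (NN0 k); rewrite leq_addl.
  by rewrite /N; move: w1 w2; lia.
have F0 n e : 0 < e -> exists n0, forall k, (n0 <= k)%N -> normc (F k n) <= e.
  move=> e0; have [Kn [Nn [Kn0 hn]]] := fourier_limit n hal.
  exists (maxn (`|n|%N.+1) (maxn Nn (Num.bound (Kn / e)))) => k.
  rewrite !geq_max => /and3P[k1 k2 k3].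
  have kM : (k <= M k)%N.
    by rewrite /M (leq_trans _ (leq_pmull _ D0)) // leqW // leq_addr.
  have kN : (k <= N k)%N by apply: leq_trans kM _; rewrite /N leq_pmull.
  rewrite /F normcM nee mulr1.
  have -> : win k n by rewrite /win; apply/andP; split; lia.
  have -> : al * B k n / (N k)%:R - gs (al^-1 * n%:~R) * t k =
    (al * B k n - gs (al^-1 * n%:~R) * T0 (N k)) / (N k)%:R by rewrite /t; ring.
  rewrite normcM normcV normc_nat ler_pdivrMr //.
  apply: le_trans (hn _ _ _ (leq_trans k2 kN) (NN k) (hT0 _ (NN k)) (hBs k n)) _.
  rewrite mulrC -ler_pdivrMr //.
  apply: le_trans (_ : (Num.bound (Kn / e))%:R <= _).
    by apply: ltW; apply: archi_boundP; rewrite divr_ge0 // ltW.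
  by rewrite ler_nat (leq_trans k3 kN).
have hS k : hsum (F k) (al * G - t k * H).
  have jN : j%:~R / D%:R = (2 * (k + N0).+1%:Z * j)%:~R / (N k)%:R :> C.
    rewrite /N /M !rmorphM /= -![(Posz _)%:~R]/(_%:R : C) natrM [(D * _)%N%:R]natrM.
    have x0 : D%:R != 0 :> C by rewrite pnatr_eq0 -lt0n.
    have y0 : (k + N0).+1%:R != 0 :> C by rewrite pnatr_eq0.
    by move: D%:R (_.+1%:R) x0 y0 => x y x0 y0; field; rewrite x0 y0.
  have hG' := hG; rewrite jN in hG'.
  have fin := finite_inversion (M0 k) hG' (hBs k); rewrite -/(N k) -jN in fin.
  pose h (i : 'I_(N k)) : int := i%:Z - (M k)%:Z.
  pose f (n : int) : C := (if win k n then al * B k n / (N k)%:R else 0) *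
    ee (n%:~R * (j%:~R / D%:R)).
  have hf : hsum f (al * G).
    have -> : al * G = \sum_(i < N k) f (h i).
      have -> : al * G = al / (N k)%:R * ((N k)%:R * G) by field.
      rewrite -fin mulr_sumr; apply: eq_bigr => i _; rewrite /f.
      have -> : win k (h i).
        by rewrite /win /h; have := ltn_ord i; rewrite /N; lia.
      by rewrite -/(h i); ring.
    apply: (hsum_inj (h := h)).
    - by move=> i i' /addIr [] E; apply: val_inj.
    - move=> n hn; rewrite /f; case: ifP => [/andP[w1 w2]|_]; last by rewrite mul0r.
      have ltN : (absz (n + (M k)%:Z)%R < N k)%N by rewrite /N; lia.
      by case: (hn (Ordinal ltN)); rewrite /h /=; lia.
    - exact: hsum_finType.
  have := hsumB hf (hsumZ (t k) hH).
  by apply: eq_hsum => n; rewrite /F /f; ring.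
move=> e e0; have [k0 hk0] := tannery ad Fd F0 hS e0.
exists (k0 + N0)%N => k hk.
have := hk0 (k - N0)%N; rewrite /t /N /M subnK; last by lia.
by apply; lia.
Qed.

Lemma hsum_Re_ge (I : choiceType) (f : I -> C) (S : C) (i0 : I) : hsum f S ->
  (forall i, 0 <= complex.Re (f i)) -> complex.Re (f i0) <= complex.Re S.
Proof.
move=> [_ hS] f0; apply/ler_addgt0Pl => e e0.
have [A hA] := hS e e0; have := hA (i0 |` A)%fset (fsubsetUr _ _).
have : complex.Re (f i0) <= complex.Re (\sum_(i <- (i0 |` A)%fset) f i).
  rewrite (big_fsetD1 i0) ?fset1U1 //= ReD lerDl.
  by elim/big_ind: _ => // x y hx hy; rewrite ReD addr_ge0.
move: (\sum_(i <- _) _) => X hX hN.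
have := le_trans (Re_le_normc _) hN; rewrite ReD ReN ler_norml; lra.
Qed.

(** For al = 1 and j = 0 both series are the same number [th], so [theta_limit] says th (1 -
    T0(N)/N) -> 0. As Re th >= 1, this normalizes T0(N)/N to limit 1 without evaluating an integral.
    The same moduli are used for both limits. *)
Theorem theta_inversion al (D : nat) (j : int) (G H : C) : sector al -> (0 < D)%N ->
  hsum (fun l : int => gs (al * (l%:~R + j%:~R / D%:R))) G ->
  hsum (fun n : int => gs (al^-1 * n%:~R) * ee (n%:~R * (j%:~R / D%:R))) H ->
  al * G = H.
Proof.
move=> hal D0 hG hH.
have s1 : sector 1 by rewrite /sector /= normr0 ltr01.
have hT N : {T | (0 < N)%N -> hsum (fun m : int => gs ((grid R N m)%:C)) T}.
  apply: cid; have [N0|N0] := ltnP 0 N; last by exists 0.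
  have [T hT] := absum_hsum (absum_gs_grid 0 s1 N0); exists T => _.
  by apply: eq_hsum hT => m; rewrite mul1r addr0.
pose T0 N := sval (hT N).
have hT0 N : (0 < N)%N -> hsum (fun m : int => gs ((grid R N m)%:C)) (T0 N) := svalP (hT N).
have [th hth] := absum_hsum (absum_gs_int s1).
have th0 : 0 < normc th.
  have : 1 <= complex.Re th.
    have := hsum_Re_ge 0 hth; rewrite mulr0 /gs expr0n /= mulr0 oppr0 ce0.
    apply => n; rewrite mul1r /gs (_ : - _ = (- (pi * n%:~R ^+ 2))%:C).
      by rewrite ce_real /= expR_ge0.
    by rewrite rmorphN rmorphM rmorphXn /= intC.
  have := Re_le_normc th; rewrite ler_norml; lra.
have hG1 : hsum (fun l : int => gs (1 * (l%:~R + 0%:~R / D%:R))) th.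
  by apply: eq_hsum hth => l; rewrite mul0r addr0.
have hH1 : hsum (fun n : int => gs (1^-1 * n%:~R) * ee (n%:~R * (0%:~R / D%:R))) th.
  by apply: eq_hsum hth => l; rewrite mul0r mulr0 ee0 mulr1 invr1.
apply/eqP; rewrite -subr_eq0; apply/eqP/normc_le0 => e e0.
have e1 : 0 < e / 2 by rewrite divr_gt0.
have H0 : 0 < normc H + 1 by rewrite ltr_wpDl ?normc_ge0.
have e2 : 0 < normc th * (e / 2 / (normc H + 1)) by rewrite mulr_gt0 // divr_gt0.
have [k1 h1] := theta_limit hal D0 hG hH hT0 e1.
have [k2 h2] := theta_limit s1 D0 hG1 hH1 hT0 e2.
have := h1 _ (leq_maxl k1 k2); have := h2 _ (leq_maxr k1 k2).
set u := _ / _; rewrite mul1r.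
have -> : th - u * th = th * (1 - u) by ring.
rewrite normcM ler_pM2l // => hu hG2.
have -> : al * G - H = (al * G - u * H) + - ((1 - u) * H) by ring.
apply: le_trans (normcD _ _) _; rewrite normcN normcM (splitr e) lerD //.
apply: le_trans (ler_wpM2r (normc_ge0 H) hu) _.
by rewrite mulrAC ler_pdivrMr // ler_wpM2l ?(ltW e1) // lerDl.
Qed.

End ThetaInversion.

(** * Quadratic Gauss sums *)

Section GaussSums.
Local Open Scope complex_scope.
Local Open Scope ring_scope.
Variable R : realType.
Local Notation C := (R[i]).

Definition modular (N : nat) (f : int -> C) : Prop :=
  forall m n : int, (N %| m - n)%Z -> f m = f n.

Lemma sum_residues (T : finType) (rho : T -> int) (N : nat) (f : int -> C) :
  (0 < N)%N -> #|T| = N -> (forall x y, (N %| rho x - rho y)%Z -> x = y) ->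
  modular N f -> \sum_(x : T) f (rho x) = \sum_(l < N) f l.
Proof.
move=> N0 cT inj mf.
have lt x : (`|(rho x %% N)%Z| < N)%N.
  have := ltz_pmod (rho x) (d := N); have := modz_ge0 (rho x) (d := N); lia.
pose g x : 'I_N := Ordinal (lt x).
have gE x : (g x : nat)%:Z = (rho x %% N)%Z by rewrite /= gez0_abs // modz_ge0 //; lia.
have gi : injective g.
  move=> x y /(congr1 (fun i : 'I_N => (i : nat)%:Z)); rewrite !gE => /eqP.
  by rewrite eqz_mod_dvd => /inj.
have gb : bijective g by apply: inj_card_bij gi _; rewrite card_ord cT.
rewrite [RHS](reindex g) /=; last exact: onW_bij.
apply: eq_bigr => x _; apply: mf; rewrite -/(g x) gE -eqz_mod_dvd.
by rewrite modz_mod.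
Qed.

Lemma ee_ratio_eq (D : nat) (m n : int) : (0 < D)%N -> (D %| m - n)%Z ->
  ee (m%:~R / D%:R : C) = ee (n%:~R / D%:R).
Proof.
move=> D0 /dvdzP[q qE]; have -> : m = n + q * D by rewrite -qE; ring.
rewrite intrD intrM mulrDl -[(Posz D)%:~R]/(D%:R : C) mulfK; last first.
  by rewrite pnatr_eq0 -lt0n.
by rewrite eeD ee_int mulr1.
Qed.

Definition gsum (a : int) (D : nat) : C := \sum_(l < D) ee ((a * l%:Z ^+ 2)%:~R / D%:R).

Lemma modular_quad (a b : int) (D : nat) : (0 < D)%N ->
  modular D (fun n : int => ee ((a * n ^+ 2 + b * n)%:~R / D%:R)).
Proof.
move=> D0 m n mn; apply: ee_ratio_eq => //.
have -> : a * m ^+ 2 + b * m - (a * n ^+ 2 + b * n) = (m - n) * (a * (m + n) + b).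
  by ring.
exact: dvdz_mulr.
Qed.

Lemma modular_sqr (a : int) (D : nat) : (0 < D)%N ->
  modular D (fun n : int => ee ((a * n ^+ 2)%:~R / D%:R)).
Proof.
move=> D0 m n mn; have := modular_quad a 0 D0 mn.
by rewrite !mul0r !addr0.
Qed.

Lemma gsum_mod a b D : (0 < D)%N -> (D %| a - b)%Z -> gsum a D = gsum b D.
Proof.
move=> D0 ab; apply: eq_bigr => l _; apply: ee_ratio_eq => //.
by rewrite -mulrBl dvdz_mulr.
Qed.

Lemma ord_dvd_inj (D : nat) (x y : 'I_D) : (D %| x%:Z - y%:Z)%Z -> x = y.
Proof.
rewrite -eqz_mod_dvd !modz_small ?ltz_nat ?ltn_ord //.
by move=> /eqP[] /val_inj.
Qed.

(** Completing the square modulo D; [s] plays the role of b/(2a). *)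
Lemma gsum_quad (a b s : int) D : (0 < D)%N -> (D %| 2 * a * s - b)%Z ->
  \sum_(l < D) ee ((a * l%:Z ^+ 2 + b * l%:Z)%:~R / D%:R) =
  gsum a D * ee (- (a * s ^+ 2)%:~R / D%:R).
Proof.
move=> D0 sb.
have -> : gsum a D = \sum_(l < D) ee ((a * (l%:Z + s) ^+ 2)%:~R / D%:R).
  apply: esym; apply: etrans (sum_residues (rho := fun l : 'I_D => l%:Z + s) D0 _ _
    (modular_sqr a D0)) _ => //; first by rewrite card_ord.
  move=> x y; have -> : x%:Z + s - (y%:Z + s) = x%:Z - y%:Z by ring.
  exact: ord_dvd_inj.
rewrite mulr_suml; apply: eq_bigr => l _.
rewrite -eeD -mulrDl -mulrNz -intrD; apply: ee_ratio_eq => //.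
have -> : a * l%:Z ^+ 2 + b * l%:Z - (a * (l%:Z + s) ^+ 2 + - (a * s ^+ 2)) =
   - ((2 * a * s - b) * l%:Z) by ring.
by rewrite -mulrN dvdz_mulr.
Qed.

Lemma gsum_sqr a c D : (0 < D)%N -> coprimez c D -> gsum (a * c ^+ 2) D = gsum a D.
Proof.
move=> D0 cD.
apply: esym; apply: etrans (esym (sum_residues (rho := fun l : 'I_D => c * l%:Z) D0 _ _
  (modular_sqr a D0))) _; last first.
- by apply: eq_bigr => l _; congr (ee (_%:~R / _)); ring.
- move=> x y; rewrite -mulrBr Gauss_dvdzr; last by rewrite coprimez_sym.
  exact: ord_dvd_inj.
- by rewrite card_ord.
Qed.

Lemma dvdz_addK (d x y : int) : (d %| x + y)%Z -> (d %| y)%Z -> (d %| x)%Z.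
Proof.
move=> /dvdzP[p hp] /dvdzP[q hq]; apply/dvdzP; exists (p - q).
by rewrite mulrBl -hp -hq addrK.
Qed.

(** Chinese remainders: x m + y n runs over the residues modulo mn, and the cross term of its square
    is a multiple of mn. *)
Lemma gsumM a m n : (0 < m)%N -> (0 < n)%N -> coprime m n ->
  gsum a (m * n) = gsum (a * m) n * gsum (a * n) m.
Proof.
move=> m0 n0 mn; have mn0 : (0 < m * n)%N by rewrite muln_gt0 m0.
apply: etrans (esym (sum_residues (T := ('I_n * 'I_m)%type)
  (rho := fun p => p.1%:Z * m%:Z + p.2%:Z * n%:Z) mn0 _ _ (modular_sqr a mn0))) _; last first.
- rewrite /gsum big_distrlr /= pair_big /=; apply: eq_bigr => -[x y] _ /=.
  have mC : m%:R != 0 :> C by rewrite pnatr_eq0 -lt0n.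
  have nC : n%:R != 0 :> C by rewrite pnatr_eq0 -lt0n.
  rewrite -eeD.
  have -> : (a * (x%:Z * m%:Z + y%:Z * n%:Z) ^+ 2)%:~R / (m * n)%N%:R =
      ((a * m * x%:Z ^+ 2)%:~R / n%:R + (a * n * y%:Z ^+ 2)%:~R / m%:R) +
      (2 * a * x%:Z * y%:Z)%:~R :> C.
    rewrite natrM !(intrM, intrD, rmorphXn) /=.
    by rewrite -[(Posz m)%:~R]/(m%:R : C) -[(Posz n)%:~R]/(n%:R : C); field;
      rewrite mC nC.
  by rewrite !eeD ee_int mulr1.
- move=> [x y] [x' y'] /= h.
  have E : x%:Z * m%:Z + y%:Z * n%:Z - (x'%:Z * m%:Z + y'%:Z * n%:Z) =
    (x%:Z - x'%:Z) * m%:Z + (y%:Z - y'%:Z) * n%:Z by ring.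
  rewrite E in h; congr pair; apply: ord_dvd_inj.
    have : (n %| (x%:Z - x'%:Z) * m%:Z)%Z.
      apply: (dvdz_addK (y := (y%:Z - y'%:Z) * n%:Z)); last exact: dvdz_mull.
      by apply: dvdz_trans h; rewrite PoszM dvdz_mull.
    by rewrite Gauss_dvdzl // coprimez_sym.
  have : (m %| (y%:Z - y'%:Z) * n%:Z)%Z.
    apply: (dvdz_addK (y := (x%:Z - x'%:Z) * m%:Z)); last exact: dvdz_mull.
    by rewrite addrC; apply: dvdz_trans h; rewrite PoszM dvdz_mulr.
  by rewrite Gauss_dvdzl.
- by rewrite card_prod !card_ord mulnC.
Qed.

(** After replacing x by x + y, the exponent a (x + y)^2 - a y^2 is linear in y, and the sum over y
    vanishes unless D divides 2 a x, that is x = 0. *)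
Lemma gsum_neg a D : odd D -> coprimez a D -> gsum a D * gsum (- a) D = D%:R.
Proof.
move=> oD aD; have D0 : (0 < D)%N by case: D oD aD.
have DC : D%:R != 0 :> C by rewrite pnatr_eq0 -lt0n.
rewrite /gsum mulrC big_distrlr /=.
transitivity (\sum_(y < D) \sum_(x < D)
   ee ((a * x%:Z ^+ 2)%:~R / D%:R) * ee (y%:R * ((2 * a * x%:Z)%:~R / D%:R)) : C).
  apply: eq_bigr => y _.
  have m1 : modular D (fun n : int => ee (((- a) * y%:Z ^+ 2)%:~R / D%:R) *
      ee ((a * n ^+ 2)%:~R / D%:R)).
    by move=> m n mn; rewrite (modular_sqr a D0 mn).
  apply: etrans (esym (sum_residues (rho := fun x : 'I_D => x%:Z + y%:Z) D0 _ _ m1)) _;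
    last first; last by rewrite card_ord.
    apply: eq_bigr => x _; rewrite -!eeD; congr ee.
    rewrite -[y%:R]/((Posz y)%:~R : C) mulrA -!mulrDl -intrM -!intrD.
    by congr (_%:~R / _); ring.
  move=> x x'; have -> : x%:Z + y%:Z - (x'%:Z + y%:Z) = x%:Z - x'%:Z by ring.
  exact: ord_dvd_inj.
rewrite exchange_big /=.
under eq_bigr do rewrite -mulr_sumr sum_ee_orth //.
rewrite (bigD1 (Ordinal D0)) //= expr0n !mulr0 mul0r ee0 mul1r dvdz0 big1 ?addr0 //.
move=> x x0; case: ifP => h; last by rewrite mulr0.
case/negP: x0; apply/eqP; apply: ord_dvd_inj; rewrite subr0.
move: h; rewrite Gauss_dvdzr // coprimezMr (coprimez_sym _ a) aD andbT.
by rewrite coprimezE /= coprimen2.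
Qed.

(** With residues y + z p d, the sum over z is p or 0 according to whether p divides y. Square
    factors thus drop out, as they do from the Jacobi symbol. *)
Lemma gsum_psqr a p d : prime p -> odd p -> (0 < d)%N -> coprimez a p ->
  gsum a (p * (p * d)) = p%:R * gsum a d.
Proof.
move=> pp op d0 ap; have p0 := prime_gt0 pp.
have pd0 : (0 < p * d)%N by rewrite muln_gt0 p0.
have ppd0 : (0 < p * (p * d))%N by rewrite muln_gt0 p0.
have pC : p%:R != 0 :> C by rewrite pnatr_eq0 -lt0n.
have dC : d%:R != 0 :> C by rewrite pnatr_eq0 -lt0n.
apply: etrans (esym (sum_residues (T := ('I_(p * d) * 'I_p)%type)
  (rho := fun u => u.1%:Z + u.2%:Z * (p * d)%N%:Z) ppd0 _ _ (modular_sqr a ppd0))) _;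
  last first.
- rewrite -(pair_big xpredT xpredT (fun (y : 'I_(p * d)) (z : 'I_p) =>
    ee ((a * (y%:Z + z%:Z * (p * d)%N%:Z) ^+ 2)%:~R / (p * (p * d))%N%:R))) /=.
  transitivity (\sum_(y < p * d) ee ((a * y%:Z ^+ 2)%:~R / (p * (p * d))%N%:R) *
      (if (p %| 2 * a * y%:Z)%Z then p%:R else 0) : C).
    apply: eq_bigr => y _; rewrite -sum_ee_orth // mulr_sumr; apply: eq_bigr => z _.
    have -> : (a * (y%:Z + z%:Z * (p * d)%N%:Z) ^+ 2)%:~R / (p * (p * d))%N%:R =
      (a * y%:Z ^+ 2)%:~R / (p * (p * d))%N%:R +
      z%:R * ((2 * a * y%:Z)%:~R / p%:R) + (a * d * z%:Z ^+ 2)%:~R :> C.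
      rewrite !natrM !(intrM, intrD, rmorphXn, PoszM) /=.
      rewrite -[(Posz p)%:~R]/(p%:R : C) -[(Posz d)%:~R]/(d%:R : C).
      by rewrite -[(Posz z)%:~R]/(z%:R : C); field; rewrite pC dC.
    by rewrite !eeD ee_int mulr1.
  have lt (y : 'I_d) : (p * y < p * d)%N by rewrite ltn_pmul2l.
  have lt' (y : 'I_(p * d)) : (y %/ p < d)%N by rewrite ltn_divLR // [(d * p)%N]mulnC.
  rewrite (bigID (fun y : 'I_(p * d) => p %| y)%N) /= [X in _ + X]big1 ?addr0.
    rewrite (reindex_onto (fun y : 'I_d => Ordinal (lt y)) (fun y => Ordinal (lt' y))).
      rewrite /gsum mulr_sumr; apply: eq_big => [y|y _] /=.
        rewrite dvdn_mulr //=; apply/eqP/val_inj; by rewrite /= mulKn.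
      have -> : (p %| 2 * a * (p * y)%N%:Z)%Z by rewrite PoszM mulrCA dvdz_mulr.
      rewrite mulrC; congr (_ * ee _).
      rewrite !natrM !(intrM, rmorphXn, PoszM) /=.
      by rewrite -[(Posz p)%:~R]/(p%:R : C); field; rewrite pC dC.
    by move=> y py; apply/val_inj; rewrite /= mulnC divnK.
  move=> y py; case: ifP => h'; last by rewrite mulr0.
  case/negP: py; move: h'; rewrite Gauss_dvdzr //.
  rewrite coprimezMr (coprimez_sym _ a) ap andbT.
  by rewrite coprimezE /= coprimen2.
- move=> [y z] [y' z'] /= h.
  have E : y%:Z + z%:Z * (p * d)%N%:Z - (y'%:Z + z'%:Z * (p * d)%N%:Z) =
    (y%:Z - y'%:Z) + (z%:Z - z'%:Z) * (p * d)%N%:Z by ring.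
  rewrite E in h.
  have yy : y = y'.
    apply: ord_dvd_inj; apply: (dvdz_addK (y := (z%:Z - z'%:Z) * (p * d)%N%:Z));
      last exact: dvdz_mull.
    by apply: dvdz_trans h; rewrite [X in (_ %| X)%Z]PoszM dvdz_mull.
  congr pair => //; apply: ord_dvd_inj; move: h; rewrite yy subrr add0r [X in (X %| _)%Z]PoszM.
  by rewrite dvdz_mul2r //; lia.
- by rewrite card_prod !card_ord mulnC.
Qed.

End GaussSums.

(** * Squares in a finite field of odd characteristic *)

Section SquareClasses.
Local Open Scope complex_scope.
Local Open Scope ring_scope.
Variable F : finFieldType.
Hypothesis two_neq0 : (2 : F) != 0.

Definition squares : {set F} := [set t | (t != 0) && [exists x : F, x ^+ 2 == t]].

Lemma squares_sqr (x : F) : x != 0 -> x ^+ 2 \in squares.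
Proof.
by move=> x0; rewrite inE sqrf_eq0 x0 /=; apply/existsP; exists x.
Qed.

Lemma sum_over_squares (V : zmodType) (g : F -> V) :
  \sum_(x | x != 0) g (x ^+ 2) = (\sum_(t in squares) g t) *+ 2.
Proof.
rewrite (partition_big (fun x => x ^+ 2) (mem squares)) /=; last exact: squares_sqr.
rewrite -sumrMnl; apply: eq_bigr => t; rewrite inE => /andP[t0 /existsP[y /eqP yt]].
have y0 : y != 0 by apply: contra t0 => /eqP y0; rewrite -yt y0 expr0n.
have yN : y != - y.
  by rewrite -subr_eq0 opprK -mulr2n -mulr_natl mulf_neq0.
rewrite (eq_bigl (fun x => x \in [set y; - y])).
  by rewrite /= finset.big_setU1 ?inE //= finset.big_set1 sqrrN yt mulr2n.
move=> x; rewrite !inE -yt eqf_sqr andb_idl // => /orP[] /eqP -> //.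
by rewrite oppr_eq0.
Qed.

Lemma card_squares : #|[set x : F | x != 0]| = (#|squares| * 2)%N.
Proof.
have := sum_over_squares (fun _ => 1 : int).
rewrite !sumr_const -mulrnA => /eqP; rewrite eqr_nat => /eqP <-.
by apply: eq_card => x; rewrite !inE.
Qed.

(** One inclusion, then a count: squares are exactly half of the nonzero elements. *)
Lemma nonsquare_mul_squares (nu : F) : nu != 0 -> nu \notin squares ->
  [set nu * t | t in squares] = [set x | x != 0] :\: squares.
Proof.
move=> nu0 nuQ; apply/eqP; rewrite eqEcard; apply/andP; split.
  apply/fintype.subsetP => _ /imsetP[t tQ ->]; rewrite finset.in_setD.
  move: (tQ); rewrite inE => /andP[t0 /existsP[y /eqP yt]].
  apply/andP; split; last by rewrite inE mulf_neq0.
  apply: contra nuQ.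
  rewrite !inE nu0 => /andP[_ /existsP[z /eqP zt]]; apply/existsP; exists (z / y).
  by rewrite expr_div_n zt yt mulfK.
have sub : squares \subset [set x | x != 0] by apply/fintype.subsetP => x; rewrite !inE => /andP[].
rewrite cardsD (finset.setIidPr sub) card_squares muln2 -addnn addnK.
by rewrite card_imset //; apply: mulfI.
Qed.

Lemma mem_squaresM (u v : F) : u != 0 -> v != 0 ->
  (u * v \in squares) = ((u \in squares) == (v \in squares)).
Proof.
move=> u0 v0.
have mulQ a b : a \in squares -> b != 0 -> (a * b \in squares) = (b \in squares).
  rewrite inE => /andP[a0 /existsP[x /eqP xa]] b0; rewrite !inE mulf_neq0 //= b0 /=.
  have x0 : x != 0 by apply: contra a0 => /eqP x0; rewrite -xa x0 expr0n.
  apply/existsP/existsP => -[y /eqP yb].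
    by exists (y / x); rewrite expr_div_n yb xa mulrC mulKf.
  by exists (x * y); rewrite exprMn xa yb.
have [uQ|uQ] := boolP (u \in squares); first by rewrite mulQ // eqb_id.
have [vQ|vQ] := boolP (v \in squares); first by rewrite mulrC mulQ // (negbTE uQ).
have /finset.setP/(_ v) := nonsquare_mul_squares u0 uQ.
rewrite finset.in_setD vQ [X in _ = X]inE v0 => /imsetP[t tQ vE].
rewrite vE mulrA; move: (tQ); rewrite inE => /andP[t0 _].
have uuQ : u * u \in squares by rewrite -expr2 squares_sqr.
by have := mulQ _ _ uuQ t0; rewrite tQ !inE.
Qed.

(** The values x^2 and nu x^2 together cover every element twice. For an additive character the
    right side vanishes, so twisting a Gauss sum by a nonsquare changes its sign. *)
Lemma sum_nonsquare (V : zmodType) (g : F -> V) (nu : F) :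
  nu != 0 -> nu \notin squares ->
  \sum_x g (x ^+ 2) + \sum_x g (nu * x ^+ 2) = (\sum_x g x) *+ 2.
Proof.
move=> nu0 nuQ.
have split0 (f : F -> V) : \sum_x f x = f 0 + \sum_(x | x != 0) f x by rewrite (bigD1 0).
rewrite !split0 expr0n /= mulr0 (sum_over_squares g) (sum_over_squares (fun t => g (nu * t))).
rewrite addrACA -mulr2n -!mulrnDl; congr (_ *+ 2); congr (_ + _).
have -> : \sum_(t in squares) g (nu * t) = \sum_(t in [set nu * t | t in squares]) g t.
  by rewrite big_imset //= => x y _ _; apply: mulfI.
rewrite nonsquare_mul_squares // [RHS](bigID (mem squares)) /=; congr (_ + _).
  by apply: eq_bigl => x; rewrite !inE; case: (x == 0).
by apply: eq_bigl => x; rewrite finset.in_setD !inE andbC.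
Qed.

End SquareClasses.

(** * The Legendre symbol through squares in the prime field *)

Section LegendreSymbol.
Local Open Scope complex_scope.
Local Open Scope ring_scope.
Variable p : nat.
Hypotheses (p_pr : prime p) (p_odd : odd p).

Lemma Fp_int_eq0 (m : int) : ((m%:~R : 'F_p) == 0) = (p %| m)%Z.
Proof.
have nat_case (n : nat) : ((n%:R : 'F_p) == 0) = (p %| n)%N.
  by rewrite (dvdn_pcharf (pchar_Fp p_pr)).
case: m => n; first exact: nat_case.
by rewrite NegzE mulrNz oppr_eq0 nat_case.
Qed.

Lemma Fp_two_neq0 : (2 : 'F_p) != 0.
Proof.
have := Fp_int_eq0 2; rewrite -[2%:~R]/(2 : 'F_p) => ->.
by rewrite dvdzE /= dvdn_prime2 //; apply: contraTneq p_odd => ->.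
Qed.

Lemma kronecker_primeE (m : int) : ~~ (p %| m)%Z ->
  kronecker_prime m p = (-1) ^+ (m%:~R \notin squares ('F_p)).
Proof.
move=> pm; rewrite /kronecker_prime (negbTE pm).
have -> : (p == 2%N) = false by apply: contraTF p_odd => /eqP ->.
have -> : [exists x : 'I_p, (x%:Z ^+ 2 == m %[mod p])%Z] = (m%:~R \in squares ('F_p)).
  rewrite inE Fp_int_eq0 pm /=; apply/existsP/existsP => -[x hx].
    exists (x%:Z)%:~R; rewrite -subr_eq0 -rmorphXn -rmorphB Fp_int_eq0.
    by rewrite -eqz_mod_dvd.
  have xp : (x < p)%N by rewrite -[X in (_ < X)%N](Fp_cast p_pr).
  exists (Ordinal xp); rewrite eqz_mod_dvd -Fp_int_eq0 rmorphB rmorphXn /= subr_eq0.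
  by rewrite -[(Posz x)%:~R]/((x : nat)%:R : 'F_p) natr_Zp.
by case: (_ \in _).
Qed.

End LegendreSymbol.

(** * The Kronecker symbol and products of Gauss sums *)

Section KroneckerSymbol.
Local Open Scope complex_scope.
Local Open Scope ring_scope.

Lemma kronecker_prime_sign (m : int) (p : nat) : prime p -> odd p -> ~~ (p %| m)%Z ->
  kronecker_prime m p ^+ 2 = 1.
Proof.
move=> pp op pm; by rewrite kronecker_primeE // -exprM mulnC exprM sqrrN !expr1n.
Qed.

Lemma kronecker_primeM (m n : int) (p : nat) : prime p -> odd p ->
  ~~ (p %| m)%Z -> ~~ (p %| n)%Z ->
  kronecker_prime (m * n) p = kronecker_prime m p * kronecker_prime n p.
Proof.
move=> pp op pm pn.
have pmn : ~~ (p %| m * n)%Z by rewrite -Fp_int_eq0 // rmorphM mulf_neq0 // Fp_int_eq0.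
rewrite !kronecker_primeE // rmorphM /= mem_squaresM ?Fp_int_eq0 ?Fp_two_neq0 //.
by case: (_ \in _); case: (_ \in _).
Qed.

(** A range of primes that does not depend on D, so that symbols with different D compare factor by
    factor. *)
Lemma kronecker_natE (m : int) (D N : nat) : (0 < D < N)%N ->
  kronecker m D = \prod_(0 <= q < N | prime q) kronecker_prime m q ^+ logn q D.
Proof.
move=> /andP[D0 DN].
rewrite /kronecker; have -> : (D%:Z == 0) = false by lia.
have -> : (D%:Z < 0) = false by lia.
rewrite /= mul1r.
have per : perm_eq (primes D) [seq q <- index_iota 0 N | q \in primes D].
  apply: uniq_perm; rewrite ?primes_uniq ?filter_uniq ?iota_uniq // => q.
  rewrite mem_filter mem_index_iota andb_idr // mem_primes => /and3P[_ _ qD] /=.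
  by apply: leq_ltn_trans DN; apply: dvdn_leq.
rewrite (perm_big _ per) big_filter [LHS]big_mkcond [RHS]big_mkcond /=.
apply: eq_bigr => q _; rewrite mem_primes D0 /=.
case pq: (prime q) => //=; case: ifP => // qD.
by rewrite (@lognE q D) pq D0 qD expr0.
Qed.

Lemma kronecker_dvdM (m : int) (x y : nat) : (0 < x)%N -> (0 < y)%N ->
  kronecker m (x * y)%N = kronecker m x * kronecker m y.
Proof.
move=> x0 y0; have xy0 : (0 < x * y)%N by rewrite muln_gt0 x0.
have h1 : (0 < x < (x * y).+1)%N by rewrite x0 ltnS leq_pmulr.
have h2 : (0 < y < (x * y).+1)%N by rewrite y0 ltnS leq_pmull.
have h3 : (0 < x * y < (x * y).+1)%N by rewrite xy0 ltnS /=.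
rewrite (kronecker_natE m h1) (kronecker_natE m h2) (kronecker_natE m h3).
rewrite -big_split /=; apply: eq_bigr => q _.
by rewrite lognM // exprD.
Qed.

Lemma odd_prime_dvd (D q : nat) : odd D -> (q %| D)%N -> odd q.
Proof. by move=> oD /dvdnP[k E]; move: oD; rewrite E oddM => /andP[]. Qed.

Lemma coprimez_prime_ndvd (m : int) (D q : nat) : prime q -> (q %| D)%N ->
  coprimez m D -> ~~ (q %| m)%Z.
Proof.
move=> pq qD mD; apply/negP => qm.
have : (q %| gcdn `|m| D)%N by rewrite dvdn_gcd qD andbT.
by move: mD; rewrite coprimezE /= /coprime => /eqP ->; rewrite dvdn1; case: eqP pq => // ->.
Qed.

Lemma kroneckerM (m n : int) (D : nat) : odd D -> coprimez m D -> coprimez n D ->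
  kronecker (m * n) D = kronecker m D * kronecker n D.
Proof.
move=> oD mD nD; have D0 : (0 < D)%N by case: D oD mD nD.
have h : (0 < D < D.+1)%N by rewrite D0 ltnS /=.
rewrite !(kronecker_natE _ h) -big_split /=; apply: eq_bigr => q pq.
have [qD|qD] := boolP (q %| D)%N; last first.
  by rewrite (@lognE q D) pq D0 (negbTE qD) !expr0 mulr1.
have oq := odd_prime_dvd oD qD.
by rewrite kronecker_primeM ?(coprimez_prime_ndvd pq qD) // exprMn.
Qed.

Lemma kronecker_sign (m : int) (D : nat) : odd D -> coprimez m D ->
  kronecker m D ^+ 2 = 1.
Proof.
move=> oD mD; have D0 : (0 < D)%N by case: D oD mD.
have h : (0 < D < D.+1)%N by rewrite D0 ltnS /=.
rewrite !(kronecker_natE _ h) -prodrXl; apply: big1 => q pq.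
have [qD|qD] := boolP (q %| D)%N; last first.
  by rewrite (@lognE q D) pq D0 (negbTE qD) expr0 expr1n.
have oq := odd_prime_dvd oD qD.
rewrite -exprM mulnC exprM kronecker_prime_sign ?expr1n //.
exact: coprimez_prime_ndvd mD.
Qed.

Lemma kronecker1 (D : nat) : (0 < D)%N -> odd D -> kronecker 1 D = 1.
Proof.
move=> D0 oD; have c1 : coprimez 1 D by rewrite coprimezE /= coprime1n.
by have := kronecker_sign oD c1; rewrite expr2 -kroneckerM // mulr1.
Qed.

Lemma kronecker_mul_sqr (m c : int) (D : nat) : odd D -> coprimez m D -> coprimez c D ->
  kronecker (m * c ^+ 2) D = kronecker m D.
Proof.
move=> oD mD cD; rewrite kroneckerM //; last by rewrite expr2 coprimezMl cD.
by rewrite expr2 kroneckerM // -expr2 kronecker_sign // mulr1.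
Qed.

Variable R : realType.
Local Notation C := (R[i]).
Local Notation gsum := (@gsum R).

Section PrimeModulus.
Variable p : nat.
Hypotheses (p_pr : prime p) (p_odd : odd p).

Definition Fp_ee (t : 'F_p) : C := ee ((t : nat)%:R / p%:R).

Lemma Fp_ee_int (n : int) : Fp_ee n%:~R = ee (n%:~R / p%:R).
Proof.
apply: (@ee_ratio_eq R p ((n%:~R : 'F_p) : nat)%:Z n (prime_gt0 p_pr)).
rewrite -Fp_int_eq0 // rmorphB /= subr_eq0.
by rewrite -[X in X == _]/(((n%:~R : 'F_p) : nat)%:R : 'F_p) natr_Zp.
Qed.

Lemma Fp_int_nat (x : 'F_p) : ((x : nat)%:Z)%:~R = x.
Proof. exact: natr_Zp. Qed.

Lemma gsum_Fp (a : int) : gsum a p = \sum_(x : 'F_p) Fp_ee (a%:~R * x ^+ 2).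
Proof.
have p0 := prime_gt0 p_pr.
apply: etrans (esym (sum_residues (rho := fun x : 'F_p => (x : nat)%:Z) p0 _ _
  (modular_sqr R a p0))) _.
- exact: card_Fp.
- move=> x y; rewrite -Fp_int_eq0 // rmorphB /= !Fp_int_nat subr_eq0; by move/eqP.
- apply: eq_bigr => x _.
  by rewrite -Fp_ee_int rmorphM rmorphXn /= Fp_int_nat.
Qed.

Lemma sum_Fp_ee (u : 'F_p) : u != 0 -> \sum_(x : 'F_p) Fp_ee (u * x) = 0.
Proof.
move=> u0; have p0 := prime_gt0 p_pr.
rewrite -(reindex_inj (mulfI u0) (P := xpredT) (F := Fp_ee)) /=.
have m1 : modular p (fun n : int => ee (n%:~R / p%:R) : C).
  by move=> m n mn; apply: ee_ratio_eq.
have := sum_residues (rho := fun x : 'F_p => (x : nat)%:Z) p0 (card_Fp p_pr) _ m1.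
rewrite -[X in _ = X]/(\sum_(l < p) ee ((l : nat)%:R / p%:R)) => E.
rewrite [LHS]E.
  have := @sum_ee_orth R p 1 p0; rewrite -[1%:~R]/(1 : C) div1r.
  have -> : (p %| 1)%Z = false.
    by rewrite dvdzE /= dvdn1; apply/negbTE; apply: contraTneq p_pr => ->.
  by [].
move=> x y; rewrite -Fp_int_eq0 // rmorphB /= !Fp_int_nat subr_eq0; by move/eqP.
Qed.

(** The sum of b is compared with that of -a: if -ab is a square c^2 then b a^2 = -a c^2 and they
    agree, otherwise b is -a times a nonsquare and they are opposite. Then [gsum_neg] applies. *)
Lemma gsum_prime_pair (a b : int) : coprimez a p -> coprimez b p ->
  gsum a p * gsum b p = (kronecker_prime (- (a * b)) p)%:~R * p%:R.
Proof.
move=> ap bp; have p0 := prime_gt0 p_pr.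
have pa := coprimez_prime_ndvd p_pr (dvdnn p) ap.
have pb := coprimez_prime_ndvd p_pr (dvdnn p) bp.
have a0 : (a%:~R : 'F_p) != 0 by rewrite Fp_int_eq0.
have b0 : (b%:~R : 'F_p) != 0 by rewrite Fp_int_eq0.
have pab : ~~ (p %| - (a * b))%Z.
  by rewrite -Fp_int_eq0 // rmorphN rmorphM oppr_eq0 mulf_neq0.
rewrite kronecker_primeE //.
have [sq|nsq] := boolP (_ \in squares _); last first.
  have nb : gsum b p = - gsum (- a) p.
    apply/eqP; rewrite -addr_eq0 addrC; apply/eqP.
    pose nu : 'F_p := - b%:~R / a%:~R.
    have nu0 : nu != 0 by rewrite mulf_neq0 ?invr_eq0 ?oppr_eq0.
    have nuQ : nu \notin squares ('F_p).
      have -> : nu = (- (a * b))%:~R * (a%:~R^-1) ^+ 2.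
        by rewrite /nu rmorphN rmorphM /=; field.
      rewrite mem_squaresM ?Fp_two_neq0 //; last first.
      - by rewrite expf_neq0 // invr_eq0.
      - by rewrite Fp_int_eq0.
      by rewrite (negbTE nsq) squares_sqr // invr_eq0.
    have E : b%:~R = (- a)%:~R * nu :> 'F_p by rewrite /nu mulrNz; field.
    have := sum_nonsquare (Fp_two_neq0 p_pr p_odd)
      (fun t => Fp_ee ((- a)%:~R * t)) nu0 nuQ.
    rewrite sum_Fp_ee ?mul0rn; last by rewrite mulrNz oppr_eq0.
    rewrite !gsum_Fp E; under [X in _ + X = _]eq_bigr do rewrite mulrA.
    exact.
  by rewrite nb mulrN gsum_neg // expr1 mulN1r.
rewrite expr0 mul1r -(gsum_neg R p_odd ap); congr (_ * _).
move: sq; rewrite inE => /andP[_ /existsP[y /eqP yE]].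
pose c := (y : nat)%:Z.
have cE : (c%:~R : 'F_p) = y by exact: Fp_int_nat.
have y0 : y != 0.
  by move: pab; rewrite -Fp_int_eq0 // -yE sqrf_eq0.
have cp : coprimez c p.
  rewrite coprimez_sym coprimezE /= prime_coprime //.
  by have := Fp_int_eq0 p_pr c; rewrite cE (negbTE y0) dvdzE => <-.
rewrite -(gsum_sqr R b p0 ap) -(gsum_sqr R (- a) p0 cp).
apply: gsum_mod => //; rewrite -Fp_int_eq0 //.
have -> : b * a ^+ 2 - - a * c ^+ 2 = a * (c * c - - (a * b)) by ring.
by rewrite intrM intrB intrM cE -expr2 yE subrr mulr0.
Qed.

End PrimeModulus.

(** Induction on D, removing its least prime p: twice if p^2 divides D, otherwise once by Chinese
    remainders, where the extra factors p^2 and d^2 in the symbols are harmless. A pair of sums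
    satisfies a closed formula, unlike a single one, whose value depends on D modulo 4. *)
Lemma gsum_pair (D : nat) (a b : int) : odd D -> coprimez a D -> coprimez b D ->
  gsum a D * gsum b D = (kronecker (- (a * b)) D)%:~R * D%:R.
Proof.
elim/ltn_ind: D a b => D IH a b oD aD bD.
have D0 : (0 < D)%N by case: D oD {IH aD bD}.
have [D1|D1] := eqVneq D 1%N.
  rewrite D1 /gsum !big_ord1 /= expr0n !mulr0 mul0r ee0 mulr1.
  have -> : kronecker (- (a * b)) 1%N = 1; last by rewrite mul1r.
  rewrite (@kronecker_natE _ 1 2) // big1 // => q pq.
  by rewrite (@lognE q 1) pq /= Euclid_dvd1 // expr0.
pose p := pdiv D; pose d := (D %/ p)%N.
have D2 : (1 < D)%N by case: D D0 D1 {IH oD aD bD p d} => [|[|]].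
have pp : prime p by exact: pdiv_prime.
have p0 := prime_gt0 pp; have p1 := prime_gt1 pp.
have pD : (p %| D)%N by exact: pdiv_dvd.
have op := odd_prime_dvd oD pD.
have DE : D = (p * d)%N by rewrite /d mulnC divnK.
have d0 : (0 < d)%N by move: D0; rewrite DE muln_gt0 => /andP[].
have od : odd d by move: oD; rewrite DE oddM => /andP[].
have dD : (d < D)%N by rewrite DE ltn_Pmull.
move: aD bD; rewrite {1 2}DE PoszM !coprimezMr => /andP[ap ad] /andP[bp bd].
have [pd|pd] := boolP (p %| d)%N.
  pose d' := (d %/ p)%N.
  have dE : d = (p * d')%N by rewrite /d' mulnC divnK.
  have d'0 : (0 < d')%N by move: d0; rewrite dE muln_gt0 => /andP[].
  have od' : odd d' by move: od; rewrite dE oddM => /andP[].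
  have d'D : (d' < D)%N by apply: leq_trans dD; rewrite ltnS dE leq_pmull.
  move: ad bd; rewrite {1 2}dE PoszM !coprimezMr => /andP[_ ad'] /andP[_ bd'].
  have mp : coprimez (- (a * b)) p by rewrite /coprimez gcdNz -/(coprimez _ _) coprimezMl ap.
  have E : kronecker (- (a * b)) (p * (p * d'))%N = kronecker (- (a * b)) d'.
    rewrite kronecker_dvdM // ?muln_gt0 ?p0 // kronecker_dvdM // mulrA -expr2.
    by rewrite kronecker_sign // mul1r.
  by rewrite DE dE !gsum_psqr // mulrACA IH // E !natrM; ring.
have cpd : coprime p d by rewrite prime_coprime.
have dp : coprimez d p by rewrite coprimezE /= coprime_sym.
have pd' : coprimez p d by rewrite coprimezE.
have nab : coprimez (- (a * b)) p by rewrite /coprimez gcdNz -/(coprimez _ _) coprimezMl ap.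
have nab' : coprimez (- (a * b)) d by rewrite /coprimez gcdNz -/(coprimez _ _) coprimezMl ad.
rewrite DE !gsumM // mulrACA IH // ?coprimezMl ?ad ?bd //.
rewrite gsum_prime_pair ?coprimezMl ?ap ?bp //.
rewrite kronecker_dvdM //.
have kp (m : int) : kronecker m p = kronecker_prime m p.
  rewrite /kronecker; have -> : (p%:Z == 0) = false by lia.
  have -> : (p%:Z < 0) = false by lia.
  by rewrite /= mul1r primes_prime // big_seq1 logn_prime // eqxx.
have -> : - (a * p%:Z * (b * p%:Z)) = - (a * b) * p%:Z ^+ 2 by ring.
have -> : - (a * d%:Z * (b * d%:Z)) = - (a * b) * d%:Z ^+ 2 by ring.
rewrite -kp !kronecker_mul_sqr // intrM natrM; ring.
Qed.

(** Divide the formula for the pair (a, 1) by the one for (1, 1), which also shows that the sum of 1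
    is nonzero. *)
Lemma gsum_kronecker (D : nat) (a : int) : odd D -> coprimez a D ->
  gsum a D = (kronecker a D)%:~R * gsum 1 D.
Proof.
move=> oD aD; have D0 : (0 < D)%N by case: D oD aD.
have c1 : coprimez 1 D by rewrite coprimezE /= coprime1n.
have cN : coprimez (- 1) D by rewrite coprimezE /= coprime1n.
have DC : D%:R != 0 :> C by rewrite pnatr_eq0 -lt0n.
have e1 := gsum_pair oD c1 c1; have ea := gsum_pair oD aD c1.
rewrite mulr1 in e1; rewrite mulr1 -mulN1r kroneckerM // in ea.
have n0 : gsum 1 D != 0.
  apply/eqP => h; move: e1; rewrite h mul0r => /esym/eqP.
  rewrite mulf_eq0 (negbTE DC) orbF intr_eq0 => /eqP k0.
  by have := kronecker_sign oD cN; rewrite k0 expr0n.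
apply: (mulIf n0); rewrite ea -mulrA e1 intrM; ring.
Qed.

Lemma gsum_prod (I : finType) (a : I -> int) (w D : nat) : odd D -> #|I| = w.*2 ->
  (forall i, coprimez (a i) D) ->
  \prod_i gsum (a i) D = (kronecker ((-1) ^+ w * \prod_i a i) D)%:~R * D%:R ^+ w.
Proof.
move=> oD cI aD; have D0 : (0 < D)%N by case: D oD aD.
have c1 : coprimez 1 D by rewrite coprimezE /= coprime1n.
have cN : coprimez (- 1) D by rewrite coprimezE /= coprime1n.
have e1 := gsum_pair oD c1 c1; rewrite mulr1 in e1.
under eq_bigr do rewrite gsum_kronecker //.
rewrite big_split /= prodr_const cI -mul2n exprM expr2 e1 exprMn.
have prodM (r : seq I) : coprimez (\prod_(i <- r) a i) D /\
    (kronecker (\prod_(i <- r) a i) D)%:~R = \prod_(i <- r) (kronecker (a i) D)%:~R :> C.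
  elim: r => [|i r [IH1 IH2]]; first by rewrite !big_nil kronecker1.
  by rewrite !big_cons coprimezMl aD IH1 kroneckerM // intrM IH2.
have powM : coprimez ((- 1) ^+ w) D /\ kronecker ((- 1) ^+ w) D = kronecker (- 1) D ^+ w.
  elim: w {cI} => [|w [IH1 IH2]]; first by rewrite !expr0 kronecker1.
  by rewrite !exprS coprimezMl cN IH1 kroneckerM // IH2.
have [h1 h2] := prodM (index_enum I); have [h3 h4] := powM.
rewrite kroneckerM // intrM h4 h2 rmorphXn /=; ring.
Qed.

End KroneckerSymbol.

(** * Transformation of theta under the modular group *)

Section ThetaTransformation.
Local Open Scope complex_scope.
Local Open Scope ring_scope.
Variable R : realType.
Local Notation C := (R[i]).

Definition csq (t : C) : C := sqrtc t.

Lemma csq_sqr (t : C) : csq t ^+ 2 = t. Proof. exact: sqr_sqrtc. Qed.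

Lemma csq_sector (t : C) : 0 < complex.Re t -> sector (csq t).
Proof.
move=> t0; have a0 : 0 <= complex.Re (csq t).
  by case: t {t0} => a b; rewrite /csq /= sqrtr_ge0.
move: t0; rewrite -{1}(csq_sqr t) expr2 ReM -!expr2 subr_gt0 /sector.
move: (complex.Re _) (complex.Im _) a0 => p q p0.
rewrite -(real_normK (num_real q)) ltr_sqr ?nnegrE //.
Qed.

Lemma sector_Re (a : C) : sector a -> 0 < complex.Re a.
Proof. by apply: le_lt_trans. Qed.

(** Fixes the branch of the root: it yields [csq_scale], hence automorphy factors common to all
    rescalings of the variable. *)
Lemma sector_sqr_inj (a b : C) : sector a -> sector b -> a ^+ 2 = b ^+ 2 -> a = b.
Proof.
move=> /sector_Re ha /sector_Re hb /eqP; rewrite eqf_sqr => /orP[/eqP //|/eqP E].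
by move: ha; rewrite {}E ReN oppr_gt0 => /(lt_trans hb); rewrite ltxx.
Qed.

Lemma sector_scale (r : R) (a : C) : 0 < r -> sector a -> sector (r%:C * a).
Proof.
by move=> r0; rewrite /sector ReMr ImMr normrM (gtr0_norm r0) ltr_pM2l.
Qed.

Lemma csq_scale (r : R) (t : C) : 0 < r -> 0 < complex.Re t ->
  csq (r%:C * t) = (Num.sqrt r)%:C * csq t.
Proof.
move=> r0 t0; apply: sector_sqr_inj.
- by apply: csq_sector; rewrite ReMr mulr_gt0.
- by apply: sector_scale; rewrite ?sqrtr_gt0 //; apply: csq_sector.
by rewrite exprMn !csq_sqr -rmorphXn sqr_sqrtr // ltW.
Qed.

(** Turns the upper half-plane into the right one, normalized so that gs(csq(rot z) n) = e(n^2
    z). *)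
Definition rot (z : C) : C := - (2 * 'i * z).

Lemma Re_rot z : complex.Re (rot z) = 2 * complex.Im z.
Proof. by rewrite /rot !ReImE /=; ring. Qed.

Lemma rotZ (r : R) (z : C) : rot (r%:C * z) = r%:C * rot z.
Proof. by rewrite /rot; ring. Qed.

Lemma rot_neq0 (z : C) : z != 0 -> rot z != 0.
Proof.
move=> z0; rewrite /rot oppr_eq0 !mulf_neq0 // ?pnatr_eq0 //.
by apply/eqP => /(congr1 (fun z => complex.Im z))/eqP; rewrite /= oner_eq0.
Qed.

Lemma cpi2iE : cpi2i R = 2 * pi%:C * 'i.
Proof. by apply: complex_eq; rewrite !ReImE /=; ring. Qed.

Lemma complex_i_inv : ('i : C)^-1 = - 'i.
Proof.
have i2 : 'i ^+ 2 = -1 :> C by exact: sqr_i.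
have i0 : 'i != 0 :> C by apply/eqP => h; move: i2; rewrite h expr0n => /eqP;
   rewrite eq_sym oppr_eq0 oner_eq0.
by apply: (mulfI i0); rewrite divff // mulrN -expr2 i2 opprK.
Qed.

Lemma gs_rot (N : nat) (z x : C) : gs (N%:R * csq (rot z) * x) = ee ((N%:R * x) ^+ 2 * z).
Proof.
rewrite /gs /ee cpi2iE; congr ce.
have -> : (N%:R * csq (rot z) * x) ^+ 2 = N%:R ^+ 2 * csq (rot z) ^+ 2 * x ^+ 2 by ring.
by rewrite csq_sqr /rot; ring.
Qed.

Lemma gs_rot_inv (N : nat) (z x : C) : (0 < N)%N -> z != 0 ->
  gs ((N%:R * csq (rot z))^-1 * x) = ee (- (x ^+ 2 / (4 * N%:R ^+ 2 * z))).
Proof.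
move=> N0 z0; rewrite /gs /ee cpi2iE; congr ce.
have NC : N%:R != 0 :> C by rewrite pnatr_eq0 -lt0n.
have -> : ((N%:R * csq (rot z))^-1 * x) ^+ 2 =
    (N%:R ^+ 2)^-1 * (csq (rot z) ^+ 2)^-1 * x ^+ 2.
  by rewrite !exprMn exprVn exprMn invfM.
rewrite csq_sqr /rot invrN !invfM complex_i_inv.
by field; rewrite NC z0.
Qed.

Lemma upper_neq0 (z : C) : 0 < complex.Im z -> z != 0.
Proof. by move=> h; apply/eqP => E; move: h; rewrite E ltxx. Qed.

Lemma sector_rot (N : nat) (z : C) : (0 < N)%N -> 0 < complex.Im z ->
  sector (N%:R * csq (rot z)).
Proof.
move=> N0 z0; rewrite natC; apply: sector_scale; first by rewrite ltr0n.
by apply: csq_sector; rewrite Re_rot mulr_gt0.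
Qed.

Definition dft (N : nat) (f : int -> C) (k : int) : C :=
  \sum_(l < N) f l * ee (k%:~R * (l%:R / N%:R)).

(** The sum is split into residue classes l + k N = N (k + l/N). The inversion is applied to each
    class, and the phases it produces assemble into the finite Fourier transform of [f]. *)
Lemma periodic_theta (N : nat) (f : int -> C) (z V : C) : (0 < N)%N -> modular N f ->
  0 < complex.Im z -> hsum (fun n : int => f n * ee (n%:~R ^+ 2 * z)) V ->
  hsum (fun k : int => dft N f k * ee (- (k%:~R ^+ 2 / (4 * N%:R ^+ 2 * z))))
    (N%:R * csq (rot z) * V).
Proof.
move=> N0 mf z0 hV; have zn := upper_neq0 z0; set al := N%:R * csq (rot z).
have hal : sector al by exact: sector_rot.
have NC : N%:R != 0 :> C by rewrite pnatr_eq0 -lt0n.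
have Vl (l : 'I_N) : {S | hsum (fun k : int => ee ((l%:R + k%:~R * N%:R) ^+ 2 * z)) S}.
  apply: cid; apply: absum_hsum.
  have inj : injective (fun k : int => l%:Z + k * N%:Z).
    by move=> k k' /addrI/mulIf; apply; lia.
  have := absum_comp inj (hsum_absum (theta_hsum z0)); congr absum.
  by apply/funext => k; rewrite /= intrD intrM.
have Hl (l : 'I_N) : {S | hsum (fun n : int => gs (al^-1 * n%:~R) *
    ee (n%:~R * ((l%:Z)%:~R / N%:R))) S}.
  apply: cid; apply: absum_hsum; apply: absum_le (absum_gs_int (sector_inv hal)) => n.
  instantiate (1 := 1); rewrite mul1r normcM normc_ee_real ?mulr1 //.
  rewrite (intC R n) (_ : _ / _ = (l%:R / N%:R : R)%:C) ?ImMr /= ?mulr0 //.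
  by rewrite fmorph_div !rmorph_nat.
have inv (l : 'I_N) : al * sval (Vl l) = sval (Hl l).
  apply: (theta_inversion hal N0 _ (svalP (Hl l))).
  apply: eq_hsum (svalP (Vl l)) => k; rewrite gs_rot; congr (ee (_ ^+ 2 * _)).
  by rewrite -[(Posz l)%:~R]/(l%:R : C); field.
have VE : V = \sum_(l < N) f l * sval (Vl l).
  have lt (n : int) : (absz (n %% N)%Z < N)%N.
    have := ltz_pmod n (d := N); have := modz_ge0 n (d := N); lia.
  pose p (n : int) : 'I_N := Ordinal (lt n).
  have pE n : (p n : nat)%:Z = (n %% N)%Z by rewrite /= gez0_abs // modz_ge0 //; lia.
  apply: hsum_uniq (hsum_finType _).
  apply: (hsum_regroup (p := p) hV) => l.
  apply: (hsum_inj (h := fun k : int => l%:Z + k * N%:Z)).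
  - by move=> k k' /addrI/mulIf; apply; lia.
  - move=> n hn; case: eqP => // nl; case: (hn (n %/ N)%Z).
    by rewrite -nl pE addrC -divz_eq.
  - apply: eq_hsum (hsumZ (f l) (svalP (Vl l))) => k.
    have -> : p (l%:Z + k * N%:Z) == l.
      apply/eqP/val_inj; suff [] : (p (l%:Z + k * N%:Z) : nat)%:Z = l%:Z by [].
      rewrite pE addrC modzMDl modz_small //.
      by rewrite ltz_nat ltn_ord.
    rewrite -(mf (l%:Z + k * N%:Z) l); last by rewrite addrAC subrr add0r dvdz_mull.
    by rewrite intrD intrM.
have -> : al * V = \sum_(l < N) f l * sval (Hl l).
  by rewrite VE mulr_sumr; apply: eq_bigr => l _; rewrite -inv; ring.
have h := hsum_sum (index_enum 'I_N) (fun (l : 'I_N) (_ : true) => hsumZ (f l) (svalP (Hl l))).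
apply: eq_hsum h => k; rewrite -gs_rot_inv // -/al /dft mulr_suml.
apply: eq_bigr => l _; rewrite -[(Posz l)%:~R]/(l%:R : C); ring.
Qed.

Lemma theta_law (tau : C) : 0 < complex.Im tau ->
  hsum (fun k : int => ee (- (k%:~R ^+ 2 / (4 * tau)))) (csq (rot tau) * theta tau).
Proof.
move=> t0.
have m1 : modular 1 (fun _ : int => 1 : C) by [].
have h : hsum (fun n : int => 1 * ee (n%:~R ^+ 2 * tau)) (theta tau).
  by apply: eq_hsum (theta_hsum t0) => n; rewrite mul1r.
have := periodic_theta (ltn0Sn 0) m1 t0 h; rewrite mul1r.
apply: eq_hsum => k; rewrite /dft big_ord1 mul0r mulr0 ee0 !mul1r expr1n mulr1.
by [].
Qed.

(** Here 4c is the inverse of -a modulo D, so the transform of e(a n^2 / D) is the Gauss sum times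
    e(c k^2 / D). The hypothesis on 1/z makes this phase cancel, leaving the series that [theta_law]
    gives for [tau]. *)
Lemma gauss_transform (a c : int) (D : nat) (tau z : C) : (0 < D)%N ->
  (D %| 4 * a * c + 1)%Z -> 0 < complex.Im tau -> 0 < complex.Im z ->
  z^-1 = 4 * c%:~R * D%:R + D%:R ^+ 2 / tau ->
  D%:R * csq (rot z) * theta (a%:~R / D%:R + z) =
  gsum R a D * (csq (rot tau) * theta tau).
Proof.
move=> D0 acD t0 z0 zE.
have DC : D%:R != 0 :> C by rewrite pnatr_eq0 -lt0n.
have tn := upper_neq0 t0; have zn := upper_neq0 z0.
have im : complex.Im (a%:~R / D%:R + z) = complex.Im z.
  rewrite ImD (_ : a%:~R / D%:R = (a%:~R / D%:R : R)%:C) ?add0r //.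
  by rewrite fmorph_div rmorph_int rmorph_nat.
have h : hsum (fun n : int => ee ((a * n ^+ 2)%:~R / D%:R) * ee (n%:~R ^+ 2 * z))
    (theta (a%:~R / D%:R + z)).
  have := @theta_hsum R (a%:~R / D%:R + z); rewrite im => /(_ z0).
  apply: eq_hsum => n; rewrite -eeD; congr ee.
  by rewrite intrM rmorphXn /=; ring.
have P := periodic_theta D0 (modular_sqr R a D0) z0 h.
apply: hsum_uniq P _; apply: eq_hsum (hsumZ (gsum R a D) (theta_law t0)) => k.
have -> : dft D (fun n : int => ee ((a * n ^+ 2)%:~R / D%:R)) k =
    gsum R a D * ee ((c * k ^+ 2)%:~R / D%:R).
  have -> : ee ((c * k ^+ 2)%:~R / D%:R) =
      ee (- (a * (- (2 * c * k)) ^+ 2)%:~R / D%:R) :> C.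
    rewrite -mulrNz; apply: ee_ratio_eq => //.
    have -> : c * k ^+ 2 - - (a * (- (2 * c * k)) ^+ 2) =
      (4 * a * c + 1) * (c * k ^+ 2) by ring.
    exact: dvdz_mulr.
  rewrite -(gsum_quad R (b := k)) //; last first.
    have -> : 2 * a * - (2 * c * k) - k = (4 * a * c + 1) * - k by ring.
    exact: dvdz_mulr.
  apply: eq_bigr => l _; rewrite -eeD; congr ee.
  by rewrite [in RHS]intrD !intrM -[(Posz l)%:~R]/(l%:R : C); ring.
rewrite -mulrA -eeD; congr (_ * ee _).
have -> : k%:~R ^+ 2 / (4 * D%:R ^+ 2 * z) = k%:~R ^+ 2 / (4 * D%:R ^+ 2) * z^-1.
  by field; rewrite ?DC ?zn.
rewrite zE intrM rmorphXn /=; field; by rewrite ?DC ?tn.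
Qed.

Lemma Im_inv (w : C) : complex.Im w^-1 = - complex.Im w / (complex.Re w ^+ 2 + complex.Im w ^+ 2).
Proof. by case: w => a b /=; rewrite mulNr. Qed.

Lemma cocycle_neq0 (c d : int) (tau : C) : 0 < complex.Im tau -> (c, d) != (0, 0) ->
  c%:~R * tau + d%:~R != 0.
Proof.
move=> t0 cd; apply/eqP => h; move/eqP: cd; apply.
have := congr1 (fun w => complex.Im w) h; rewrite ImD (intC R c) (intC R d) ImMr /= addr0.
move/eqP; rewrite mulf_eq0 (gt_eqF t0) orbF intr_eq0 => /eqP c0.
move: h; rewrite c0 mul0r add0r => /eqP; rewrite intr_eq0 => /eqP ->.
by [].
Qed.

Lemma Im_moebius (a b c d : int) (tau : C) : a * d - b * c = 1 -> 0 < complex.Im tau ->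
  0 < complex.Im ((a%:~R * tau + b%:~R) / (c%:~R * tau + d%:~R)).
Proof.
move=> det t0.
have w0 : c%:~R * tau + d%:~R != 0.
  by apply: cocycle_neq0 => //; apply/eqP => -[c0 d0]; move: det; rewrite c0 d0 !mulr0.
have detR : (a%:~R : R) * d%:~R - b%:~R * c%:~R = 1 by rewrite -!intrM -intrB det.
move: w0 t0; case: tau => x y; rewrite /= => w0 y0.
rewrite (intC R a) (intC R b) (intC R c) (intC R d) in w0 *.
rewrite ImM Im_inv /= !mul0r !subr0 !addr0.
set u := c%:~R * x + d%:~R; set v := c%:~R * y.
have n0 : 0 < u ^+ 2 + v ^+ 2.
  rewrite lt0r addr_ge0 ?sqr_ge0 // andbT paddr_eq0 ?sqr_ge0 // !sqrf_eq0.
  apply: contra w0 => /andP[/eqP u0 /eqP v0].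
  apply/eqP; apply: complex_eq; rewrite /= ?mul0r ?subr0 ?addr0 //.
have -> : (a%:~R * x + b%:~R) * (- v / (u ^+ 2 + v ^+ 2)) +
    a%:~R * y * (u / (u ^+ 2 + v ^+ 2)) =
    ((a%:~R * d%:~R - b%:~R * c%:~R) * y) / (u ^+ 2 + v ^+ 2).
  by rewrite /v /u; field; rewrite -/u -/v gt_eqF.
by rewrite detR mul1r divr_gt0.
Qed.

(** The image of [tau] is B/D + tau/(D (c tau + D)). The root [S] is chosen before [r]; the two
    conditions on [r] are the integrality that [gauss_transform] requires. *)
Lemma theta_mult (A B c : int) (D : nat) (tau : C) : (0 < D)%N -> A * D%:Z - B * c = 1 ->
  0 < complex.Im tau -> exists S : C, S ^+ 2 = D%:R * (c%:~R * tau + D%:R) /\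
  forall (r : R) (a c' : int), 0 < r -> a%:~R = r * B%:~R -> c%:~R = 4 * r * c'%:~R ->
    theta (r%:C * ((A%:~R * tau + B%:~R) / (c%:~R * tau + D%:R))) =
    gsum R a D / D%:R * S * theta (r%:C * tau).
Proof.
move=> D0 det t0.
have DC : D%:R != 0 :> C by rewrite pnatr_eq0 -lt0n.
have tn := upper_neq0 t0.
have w0 : c%:~R * tau + D%:R != 0.
  have := @cocycle_neq0 c D tau t0; apply; apply/eqP => -[_ E]; by rewrite E in D0.
have detC : (A%:~R : C) * D%:R - B%:~R * c%:~R = 1.
  by rewrite -[D%:R]/((Posz D)%:~R : C) -!intrM -intrB det.
set w := c%:~R * tau + D%:R in w0 *.
pose z0 : C := tau / (D%:R * w).
have gE : (A%:~R * tau + B%:~R) / w = B%:~R / D%:R + z0.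
  have -> : B%:~R / D%:R + z0 = (B%:~R * w + tau) / (D%:R * w) by rewrite /z0; field;
     rewrite ?DC ?w0.
  have -> : B%:~R * w + tau = D%:R * (A%:~R * tau + B%:~R).
    rewrite /w -[in LHS](mul1r tau) -[in X in _ + X * _]detC; ring.
  by field; rewrite ?DC ?w0.
have iz0 : 0 < complex.Im z0.
  have := @Im_moebius A B c D tau det t0; rewrite -[(Posz D)%:~R]/(D%:R : C) -/w gE ImD.
  rewrite (_ : B%:~R / D%:R = (B%:~R / D%:R : R)%:C) ?add0r //.
  by rewrite fmorph_div rmorph_int rmorph_nat.
have zn := upper_neq0 iz0.
have qz : csq (rot z0) != 0.
  by apply: sector_neq0; apply: csq_sector; rewrite Re_rot mulr_gt0.
exists (csq (rot tau) / csq (rot z0)); split.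
  rewrite expr_div_n !csq_sqr.
  have -> : rot tau = D%:R * w * rot z0 by rewrite /rot /z0; field; rewrite ?DC ?w0.
  by rewrite mulfK // rot_neq0.
move=> r a c' r0 aE cE.
have rC : r%:C != 0 :> C by apply/eqP => -[] h; move: r0; rewrite h ltxx.
have aC : a%:~R = r%:C * B%:~R :> C by rewrite (intC R a) (intC R B) aE rmorphM.
have cC : c%:~R = 4 * r%:C * c'%:~R :> C.
  by rewrite (intC R c) (intC R c') cE !rmorphM rmorph_nat.
have i1 : 0 < complex.Im (r%:C * tau) by rewrite ImMr mulr_gt0.
have i2 : 0 < complex.Im (r%:C * z0) by rewrite ImMr mulr_gt0.
have ac : (D %| 4 * a * c' + 1)%Z.
  have E : 4 * a * c' = B * c.
    apply/eqP; rewrite -(eqr_int R) !intrM aE cE; apply/eqP; ring.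
  by rewrite E -det addrC subrK dvdz_mull.
have zE : (r%:C * z0)^-1 = 4 * c'%:~R * D%:R + D%:R ^+ 2 / (r%:C * tau).
  have -> : (r%:C * z0)^-1 = D%:R * w / (r%:C * tau) by rewrite /z0; field; rewrite ?DC ?rC ?tn ?w0.
  by rewrite /w cC; field; rewrite ?rC ?tn.
have -> : r%:C * ((A%:~R * tau + B%:~R) / w) = a%:~R / D%:R + r%:C * z0.
  by rewrite gE aC; ring.
have E := gauss_transform D0 ac i1 i2 zE.
(* Both sides acquire the same factor sqrt r, which is why [S] can serve every [r]. *)
rewrite !rotZ !csq_scale // ?Re_rot ?mulr_gt0 // in E.
have sC : (Num.sqrt r)%:C != 0 :> C.
  by apply/eqP => -[] h; move: r0; rewrite -sqrtr_gt0 h ltxx.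
apply: (mulfI (mulf_neq0 DC (mulf_neq0 sC qz))).
rewrite E; move: (theta _) => th; field; by rewrite ?DC ?qz.
Qed.

(** The image of [tau] is A/c - 1/(c w) with w = c tau + d, and p A / (8c) has period 8c in the
    exponent. For z = -p/(8 c w) the exponent k^2 / (4 (8c)^2 z) is -k^2 w / (32 c p): the part in
    [tau] gives q^(k^2/(32p)), and the part in [d] is a phase moved into the coefficients. *)
Lemma theta_cusp (A B : int) (c : nat) (d : int) : (0 < c)%N -> A * d - B * c%:Z = 1 ->
  exists s : C -> C, (forall tau, 0 < complex.Im tau ->
     s tau ^+ 2 = (2 * 'i)^-1 * (c%:R * tau + d%:~R)) /\
  forall p : nat, (0 < p)%N -> exists F, qseries (32 * p) F /\
    forall tau, 0 < complex.Im tau ->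
    theta (p%:R / 8 * ((A%:~R * tau + B%:~R) / (c%:R * tau + d%:~R))) = s tau * F tau.
Proof.
move=> c0 det.
have cC : c%:R != 0 :> C by rewrite pnatr_eq0 -lt0n.
pose w (tau : C) : C := c%:R * tau + d%:~R.
have w0 tau : 0 < complex.Im tau -> w tau != 0.
  move=> t0; have := @cocycle_neq0 c d tau t0; apply; apply/eqP => -[E _].
  by rewrite E in c0.
have detC : (A%:~R : C) * d%:~R - B%:~R * c%:R = 1.
  by rewrite -[c%:R]/((Posz c)%:~R : C) -!intrM -intrB det.
have Iw tau : 0 < complex.Im tau -> 0 < complex.Im (- (w tau)^-1).
  move=> t0; rewrite ImN Im_inv mulNr opprK.
  have Iwt : 0 < complex.Im (w tau).
    by rewrite /w ImD (natC R c) (intC R d) ImMr /= addr0 mulr_gt0 // ltr0n.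
  by rewrite divr_gt0 // ltr_wpDl ?sqr_ge0 // exprn_gt0.
exists (fun tau => (csq (rot (- (w tau)^-1)))^-1); split.
  move=> tau t0; rewrite exprVn csq_sqr /rot -/(w tau).
  by rewrite mulrN opprK !invfM invrK.
move=> p p0; pose N := (8 * c)%N.
have N0 : (0 < N)%N by rewrite muln_gt0.
have NC : N%:R != 0 :> C by rewrite pnatr_eq0 -lt0n.
have pC : p%:R != 0 :> C by rewrite pnatr_eq0 -lt0n.
have NE : N%:R = 8 * c%:R :> C by rewrite natrM.
pose f (n : int) : C := ee ((p%:Z * A * n ^+ 2)%:~R / N%:R).
have mf : modular N f := modular_sqr R (p%:Z * A) N0.
pose a (k : int) : C := dft N f k * ee (k%:~R ^+ 2 * (d%:~R / (32 * c%:R * p%:R))).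
have ub (k : int) : normc (a k) <= N%:R.
  have -> : normc (a k) = normc (dft N f k).
    rewrite normcM normc_ee_real ?mulr1 //.
    have -> : k%:~R ^+ 2 * (d%:~R / (32 * c%:R * p%:R)) =
       (k%:~R ^+ 2 * (d%:~R / (32 * c%:R * p%:R)) : R)%:C.
      by rewrite rmorphM rmorphXn fmorph_div !rmorphM /= !rmorph_int !rmorph_nat.
    by [].
  apply: le_trans (normc_sum _ _ _) _.
  have -> : N%:R = \sum_(l < N) (1 : R) by rewrite sumr_const card_ord.
  apply: ler_sum => l _; rewrite normcM /f !normc_ee_real ?mulr1 //.
    rewrite (intC R k) (_ : _ / _ = (l%:R / N%:R : R)%:C) ?ImMr /= ?mulr0 //.
    by rewrite fmorph_div !rmorph_nat.
  rewrite (_ : _ / _ = ((p%:Z * A * l%:Z ^+ 2)%:~R / N%:R : R)%:C) //.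
  by rewrite fmorph_div rmorph_int rmorph_nat.
have h0 : (0 < 32 * p)%N by rewrite muln_gt0.
have [F qF hF] := qseries_theta h0 ub.
pose rr : R := p%:R / 8 / c%:R.
have rr0 : 0 < rr by rewrite !divr_gt0 ?ltr0n.
have rrC : rr%:C = p%:R / 8 / c%:R :> C by rewrite !fmorph_div !rmorph_nat.
have sr : (Num.sqrt rr)%:C != 0 :> C.
  by apply/eqP => -[] h; move: rr0; rewrite -sqrtr_gt0 h ltxx.
exists (fun tau => (N%:R * (Num.sqrt rr)%:C)^-1 * F tau); split.
  exact: qseriesZ.
move=> tau t0; have wn := w0 tau t0; rewrite -/(w tau).
pose z : C := rr%:C * (- (w tau)^-1).
have iz : 0 < complex.Im z by rewrite ImMr mulr_gt0 ?Iw.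
have zn := upper_neq0 iz.
have gE : p%:R / 8 * ((A%:~R * tau + B%:~R) / w tau) = (p%:Z * A)%:~R / N%:R + z.
  have -> : A%:~R * tau + B%:~R = (A%:~R * w tau - 1) / c%:R.
    have -> : A%:~R * w tau - 1 = c%:R * (A%:~R * tau + B%:~R).
      have -> : A%:~R * w tau - 1 = A%:~R * w tau - (A%:~R * d%:~R - B%:~R * c%:R).
        by rewrite detC.
      by rewrite /w; ring.
    by rewrite [RHS]mulrC mulKf.
  rewrite /z rrC NE intrM -[(Posz p)%:~R]/(p%:R : C); field; by rewrite cC wn.
have im : complex.Im ((p%:Z * A)%:~R / N%:R + z) = complex.Im z.
  rewrite ImD (_ : _ / _ = ((p%:Z * A)%:~R / N%:R : R)%:C) ?add0r //.
  by rewrite fmorph_div rmorph_int rmorph_nat.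
have h : hsum (fun n : int => f n * ee (n%:~R ^+ 2 * z))
    (theta ((p%:Z * A)%:~R / N%:R + z)).
  have := @theta_hsum R ((p%:Z * A)%:~R / N%:R + z); rewrite im => /(_ iz).
  apply: eq_hsum => n; rewrite -eeD; congr ee.
  by rewrite [in RHS]intrM rmorphXn /=; ring.
have P := periodic_theta N0 mf iz h.
have E : F tau = N%:R * csq (rot z) * theta ((p%:Z * A)%:~R / N%:R + z).
  apply: hsum_uniq (hF _ t0) _; apply: eq_hsum P => k.
  rewrite /a -[RHS]mulrA -eeD; congr (_ * ee _).
  rewrite natrM /z rrC NE.
  have -> : k%:~R ^+ 2 * (d%:~R / (32 * c%:R * p%:R)) + k%:~R ^+ 2 / (32 * p%:R) * tau =
     k%:~R ^+ 2 / (32 * c%:R * p%:R) * w tau by rewrite /w; field; rewrite cC pC.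
  by field; rewrite cC pC wn.
have qw : csq (rot (- (w tau)^-1)) != 0.
  by apply: sector_neq0; apply: csq_sector; rewrite Re_rot mulr_gt0 // Iw.
rewrite gE E /z rotZ csq_scale // ?Re_rot ?mulr_gt0 ?Iw //.
by field; rewrite NC sr qw.
Qed.

End ThetaTransformation.

(** * The function of the theorem and its transformation law *)

Section EtaQuotient.
Local Open Scope complex_scope.
Local Open Scope ring_scope.
Variable R : realType.
Local Notation C := (R[i]).

Lemma ratC_nat (n : nat) : ((n%:R : R)%:C) = n%:R :> C.
Proof. by rewrite rmorph_nat. Qed.

Lemma theta_int (x : C) (m : int) : 0 < complex.Im x -> theta (x + m%:~R) = theta x :> C.
Proof.
move=> x0; have h := @theta_hsum R (x + m%:~R).
rewrite ImD (intC R m) /= addr0 -(intC R m) in h.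
apply: hsum_uniq (h x0) _; apply: eq_hsum (theta_hsum x0) => n.
by rewrite mulrDr eeD -rmorphXn -intrM ee_int mulr1.
Qed.

Lemma Psi_int (x : C) (m : int) : Psi (x + m%:~R) = Psi x :> C.
Proof.
rewrite /Psi; congr csum; apply/funext => n; rewrite !qpowE psi_exponent.
have -> : n%:R * (n%:R + 1) / 2 = ('C(n.+1, 2))%:Z%:~R :> C.
  rewrite -[_%:~R]/('C(n.+1, 2)%:R : C) natr1 -natrM mulnC.
  have -> : (n.+1 * n = 'C(n.+1, 2) * 2)%N by rewrite bin2 muln2 halfK oddM oddS andNb subn0.
  by rewrite natrM mulfK.
by rewrite mulrDr eeD -intrM ee_int mulr1.
Qed.

(** Classically eta(2 c tau)^2 / eta(c tau), for the Dedekind eta function. *)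
Definition eta_psi (c : nat) (tau : C) : C := ee (c%:R * tau / 8) * Psi (c%:R * tau).

Definition eta_quotient (v k : nat) (b : 'I_v -> nat) (c : 'I_k -> nat) (tau : C) : C :=
  (\prod_(i < v) theta ((b i)%:R * tau : C)) * \prod_(j < k) eta_psi (c j) tau.

Lemma eta_quotientE (v k : nat) (b : 'I_v -> nat) (c : 'I_k -> nat) (tau : C) :
  qpow ((\sum_(j < k) c j)%N%:R / 8) tau * psi_st b c tau = eta_quotient b c tau :> C.
Proof.
rewrite /psi_st /eta_quotient /eta_psi big_split /= qpowE.
have -> : ee (ratr ((\sum_(j < k) c j)%N%:R / 8) * tau) =
    \prod_(j < k) ee ((c j)%:R * tau / 8) :> C.
  have -> : ratr ((\sum_(j < k) c j)%N%:R / 8) = \sum_(j < k) (c j)%:R / 8 :> C.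
    by rewrite fmorph_div /= !rmorph_nat natr_sum mulr_suml.
  rewrite mulr_suml.
  elim/big_rec2 : _ => [|i y1 y2 _ IH]; first by rewrite ee0.
  by rewrite eeD IH mulrAC.
by rewrite mulrCA.
Qed.

Lemma Im_natM (n : nat) (tau : C) : (0 < n)%N -> 0 < complex.Im tau ->
  0 < complex.Im (n%:R * tau).
Proof. by move=> n0 t0; rewrite (natC R n) ImMr mulr_gt0 // ltr0n. Qed.

Lemma eta_psi_theta (c : nat) (tau : C) : (0 < c)%N -> 0 < complex.Im tau ->
  eta_psi c tau = (theta (c%:R / 8 * tau) - theta ((4 * c)%N%:R / 8 * tau)) / 2.
Proof.
move=> c0 t0; rewrite /eta_psi psi_theta ?Im_natM //.
rewrite (_ : c%:R * tau / 8 = c%:R / 8 * tau); last by ring.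
rewrite (_ : c%:R * tau / 2 = (4 * c)%N%:R / 8 * tau) // natrM; by field.
Qed.

Lemma eta_psi_int (c : nat) (tau : C) (m : int) :
  eta_psi c (tau + m%:~R) = ee (c%:R * m%:~R / 8) * eta_psi c tau.
Proof.
rewrite /eta_psi mulrDr -[c%:R * m%:~R]/((Posz c)%:~R * m%:~R : C) -intrM Psi_int.
by rewrite mulrDl eeD; ring.
Qed.

Lemma eta_quotient_int (v k : nat) (b : 'I_v -> nat) (c : 'I_k -> nat) (tau : C) (m : int) :
  (forall i, (0 < b i)%N) -> 0 < complex.Im tau ->
  eta_quotient b c (tau + m%:~R) =
  ee ((\sum_(j < k) c j)%N%:R * m%:~R / 8) * eta_quotient b c tau.
Proof.
move=> b0 t0; rewrite /eta_quotient.
have -> : \prod_(i < v) theta ((b i)%:R * (tau + m%:~R) : C) =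
    \prod_(i < v) theta ((b i)%:R * tau : C).
  apply: eq_bigr => i _; rewrite mulrDr -[X in theta (_ + X * _)]/((Posz (b i))%:~R : C).
  by rewrite -intrM theta_int // Im_natM.
have -> : \prod_(j < k) eta_psi (c j) (tau + m%:~R) =
    (\prod_(j < k) ee ((c j)%:R * m%:~R / 8)) * \prod_(j < k) eta_psi (c j) tau.
  by rewrite -big_split; apply: eq_bigr => j _; rewrite eta_psi_int.
have -> : \prod_(j < k) ee ((c j)%:R * m%:~R / 8) =
    ee ((\sum_(j < k) c j)%N%:R * m%:~R / 8) :> C.
  rewrite natr_sum !mulr_suml.
  elim/big_rec2 : _ => [|i y1 y2 _ IH]; first by rewrite ee0.
  by rewrite eeD IH.
by rewrite mulrCA.
Qed.

Lemma ee_imag (x : R) : ee (x%:C * 'i) = (expR (- (2 * pi * x)))%:C :> C.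
Proof.
rewrite /ee -ce_real; congr ce; apply: complex_eq; rewrite !ReImE /=; ring.
Qed.

Lemma hsum_pos_neq0 (I : choiceType) (f : I -> C) (S : C) (g : I -> R) (i0 : I) :
  hsum f S -> (forall i, f i = (expR (g i))%:C) -> S != 0.
Proof.
move=> hS fE; have := hsum_Re_ge i0 hS; rewrite fE /= => h.
have /h : forall i, 0 <= complex.Re (f i) by move=> i; rewrite fE /= expR_ge0.
by move=> p; apply/eqP => S0; move: p; rewrite S0 /= leNgt expR_gt0.
Qed.

(** On the imaginary axis all terms of the series are positive reals. Nonvanishing at one point lets
    the converse cancel the function. *)
Lemma eta_quotient_neq0 (v k : nat) (b : 'I_v -> nat) (c : 'I_k -> nat) :
  (forall i, (0 < b i)%N) -> (forall j, (0 < c j)%N) ->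
  eta_quotient b c ('i : C) != 0.
Proof.
move=> b0 c0; have i0 : 0 < complex.Im ('i : C) by rewrite /= ltr01.
rewrite /eta_quotient mulf_neq0 //; apply/prodf_neq0 => i _.
  have h := theta_hsum (Im_natM (b0 i) i0).
  apply: (hsum_pos_neq0 (g := fun n : int => - (2 * pi * (n%:~R ^+ 2 * (b i)%:R))) 0 h).
  move=> n; rewrite -ee_imag rmorphM rmorphXn /= -intC rmorph_nat; congr ee; ring.
have h := two_psi (Im_natM (c0 i) i0).
have := hsum_pos_neq0 (g := fun n : int =>
  - (2 * pi * ((2 * n%:~R + 1) ^+ 2 / 8 * (c i)%:R))) 0 h.
have -> : 2 * (ee ((c i)%:R * 'i / 8) * Psi ((c i)%:R * 'i)) = 2 * eta_psi (c i) 'i :> C.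
  by [].
move=> p; have : 2 * eta_psi (c i) 'i != 0 :> C.
  apply: p => n; rewrite -ee_imag; congr ee.
  rewrite rmorphM fmorph_div rmorphXn rmorphD rmorphM /= -intC !rmorph_nat rmorph1; ring.
by apply: contra => /eqP ->; rewrite mulr0.
Qed.

Lemma ee_eighth (h : nat) : ee (h%:R / 8 : C) = 1 -> (8 %| h)%N.
Proof.
rewrite {1}(divn_eq h 8) natrD natrM mulrDl mulfK ?pnatr_eq0 // eeD ee_nat mul1r => E.
rewrite /dvdn; apply/negPn/negP => h0.
have : (0 < h %% 8 < 8)%N by rewrite lt0n h0 ltn_pmod.
by move=> /(@ee_ratio_neq1 R); rewrite E eqxx.
Qed.

Lemma prod_coprimez (I : Type) (r : seq I) (a : I -> int) (D : nat) :
  (forall i, coprimez (a i) D) -> coprimez (\prod_(i <- r) a i) D.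
Proof.
move=> h; elim/big_ind: _ => //; first by rewrite coprimezE /= coprime1n.
by move=> x y hx hy; rewrite coprimezMl hx.
Qed.

Lemma exp_coprimez (a : int) (n D : nat) : coprimez a D -> coprimez (a ^+ n) D.
Proof.
move=> h; elim: n => [|n IH]; first by rewrite expr0 coprimezE /= coprime1n.
by rewrite exprS coprimezMl h.
Qed.

(** On the left are the arguments of the Gauss sums. As v + k is even, the factor B1^(v+k) is a
    square, and 8^v is a square times 8 or 1 according to the parity of v. This is the origin of the
    8 in the character; the 4 is a square. *)
Lemma kronecker_chi_num (v k w : nat) (b : 'I_v -> nat) (c : 'I_k -> nat) (B1 : int)
    (D : nat) : odd D -> (v + k = w.*2)%N ->
  (forall i, coprime (b i) D) -> (forall j, coprime (c j) D) -> coprimez B1 D ->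
  kronecker ((-1) ^+ w * ((\prod_(i < v) ((b i)%:Z * (8 * B1))) *
    \prod_(j < k) ((c j)%:Z * B1))) D = kronecker (chi_num b c) D.
Proof.
move=> oD vk bD cD BD.
have N1 : coprimez (- 1) D by rewrite coprimezE /= coprime1n.
have c2 : coprimez 2 D by rewrite coprimezE /= coprime2n.
have c8 : coprimez 8 D by rewrite (_ : 8 = 2 ^+ 3) // exp_coprimez.
pose P : int := (-1) ^+ w * (\prod_(i < v) (b i)%:Z * \prod_(j < k) (c j)%:Z).
have PD : coprimez P D.
  rewrite /P !coprimezMl exp_coprimez // !prod_coprimez // => i; by rewrite coprimezE.
have v2 : (odd v = odd k).
  by have := congr1 odd vk; rewrite oddD odd_double; case: (odd v); case: (odd k).
have prodZ (n : nat) (f : 'I_n -> nat) : (\prod_(i < n) f i)%N%:Z = \prod_(i < n) (f i)%:Z.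
  by elim/big_rec2: _ => // i x y _ <-; rewrite PoszM.
have -> : chi_num b c = P * (if ~~ odd v then 4 else 8).
  rewrite /chi_num vk doubleK -v2 andbb /P !prodZ; ring.
have -> : (-1) ^+ w * ((\prod_(i < v) ((b i)%:Z * (8 * B1))) *
    \prod_(j < k) ((c j)%:Z * B1)) = P * 8 ^+ odd v * (8 ^+ v./2 * B1 ^+ w) ^+ 2.
  rewrite !big_split /= !prodr_const !card_ord /P exprMn.
  have -> : (8 : int) ^+ v = 8 ^+ odd v * (8 ^+ v./2) ^+ 2.
    by rewrite -exprM -exprD muln2 odd_double_half.
  have E : B1 ^+ v * B1 ^+ k = (B1 ^+ w) ^+ 2 by rewrite -exprD vk -exprM muln2.
  rewrite -E; ring.
have c8w : coprimez (8 ^+ v./2 * B1 ^+ w) D by rewrite coprimezMl !exp_coprimez.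
rewrite kronecker_mul_sqr //; last by rewrite coprimezMl PD exp_coprimez.
case: (odd v) => /=; first by rewrite expr1.
by rewrite expr0 mulr1 (_ : 4 = 2 ^+ 2) // kronecker_mul_sqr.
Qed.

(** Applies [theta_mult] with r = b_i, c_j/8 and c_j/2. Integrality of r B asks for 8 | B, and that
    of q/(4r) is what 4 b_i | q and 2 c_j | q provide. *)
Lemma eta_quotient_transform (v k w : nat) (b : 'I_v -> nat) (c : 'I_k -> nat)
    (A B q : int) (D : nat) (tau : C) :
  odd D -> (v + k = w.*2)%N -> A * D%:Z - B * q = 1 ->
  (8 %| \sum_(j < k) c j)%N ->
  (forall i, (0 < b i)%N) -> (forall j, (0 < c j)%N) ->
  (forall i, (4 * b i)%N%:Z %| q)%Z -> (forall j, (2 * c j)%N%:Z %| q)%Z ->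
  0 < complex.Im tau ->
  eta_quotient b c ((A%:~R * tau + B%:~R) / (q%:~R * tau + D%:R)) =
  (kronecker (chi_num b c) D)%:~R * (q%:~R * tau + D%:R) ^+ w * eta_quotient b c tau.
Proof.
move=> oD vk det h8 b0 c0 bq cq t0.
have D0 : (0 < D)%N by case: D oD det.
have DC : D%:R != 0 :> C by rewrite pnatr_eq0 -lt0n.
have W0 : q%:~R * tau + D%:R != 0.
  have := @cocycle_neq0 R q D tau t0; apply; apply/eqP => -[_ E]; by rewrite E in D0.
(* Translating on the left by [- B * D], we may assume that [8] divides [B]. *)
have [B1 B1E] : exists B1, B - B * D%:Z * D%:Z = 8 * B1.
  (* The square of the odd number D is 1 modulo 8. *)
  exists (B * ((1 - D%:Z * D%:Z) %/ 8)%Z).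
  have D8 : (8 %| 1 - D%:Z * D%:Z)%Z.
    have -> : D%:Z = (D./2)%:Z * 2 + 1.
      by rewrite -[in LHS](odd_double_half D) oD -muln2; lia.
    have [e|o] := boolP (odd D./2).
      by have := odd_double_half D./2; rewrite e => <-; apply/dvdzP;
        exists (- ((D./2)./2)%:Z * (2 * (D./2)./2%:Z + 3) - 1); lia.
    have := odd_double_half D./2; rewrite (negbTE o) => <-; apply/dvdzP.
    by exists (- ((D./2)./2)%:Z * (2 * (D./2)./2%:Z + 1)); lia.
  have E : 1 - D%:Z * D%:Z = 8 * ((1 - D%:Z * D%:Z) %/ 8)%Z.
    by rewrite [RHS]mulrC divzK.
  by rewrite mulrCA -E; ring.
pose A' := A - B * D%:Z * q; pose B' := B - B * D%:Z * D%:Z.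
have det' : A' * D%:Z - B' * q = 1 by rewrite -det /A' /B'; ring.
have -> : (A%:~R * tau + B%:~R) / (q%:~R * tau + D%:R) =
    (A'%:~R * tau + B'%:~R) / (q%:~R * tau + D%:R) + (B * D%:Z)%:~R.
  rewrite /A' /B' !intrB !intrM -[(Posz D)%:~R]/(D%:R : C); field; exact: W0.
have i1 : 0 < complex.Im ((A'%:~R * tau + B'%:~R) / (q%:~R * tau + D%:R)).
  exact: (@Im_moebius R A' B' q D).
rewrite eta_quotient_int //.
have -> : ee ((\sum_(j < k) c j)%N%:R * (B * D%:Z)%:~R / 8) = 1 :> C.
  have /dvdnP[e ->] := h8; rewrite natrM mulrAC mulfK // ?pnatr_eq0 //.
  by rewrite -[e%:R]/((Posz e)%:~R : C) -intrM ee_int.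
rewrite mul1r.
have [S [S2 hS]] := theta_mult D0 det' t0.
set x := (A'%:~R * tau + B'%:~R) / _ in hS *.
have qD : coprimez q D.
  apply/coprimezP; exists (- B', A'); rewrite /= -[RHS]det'; ring.
have B1D : coprimez B1 D.
  apply/coprimezP; exists (- (8 * q), A'); rewrite /= -[RHS]det' /B' B1E; ring.
have dvdD (m n : nat) : ((n * m)%N%:Z %| q)%Z -> coprime m D.
  move=> /dvdzP[e E]; move: qD; rewrite E PoszM mulrA coprimezMl => /andP[_].
  by rewrite coprimezE.
have bD i : coprime (b i) D by apply: dvdD (bq i).
have cD j : coprime (c j) D by apply: dvdD (cq j).
have th i : theta ((b i)%:R * x) =
    gsum R ((b i)%:Z * (8 * B1)) D / D%:R * S * theta ((b i)%:R * tau) :> C.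
  have /dvdzP[e E] := bq i.
  have := hS (b i)%:R ((b i)%:Z * (8 * B1)) e; rewrite ratC_nat; apply.
  - by rewrite ltr0n.
  - by rewrite -B1E intrM.
  - by rewrite E intrM -[(Posz _)%:~R]/((4 * b i)%N%:R : R) natrM mulrC.
have ep j : eta_psi (c j) x = gsum R ((c j)%:Z * B1) D / D%:R * S * eta_psi (c j) tau.
  have /dvdzP[e E] := cq j.
  (* The two theta values whose difference is [eta_psi] have Gauss sums of c_j B1 and 4 c_j B1.
     These agree, 4 being a square prime to D, so the difference is multiplied by one common
     factor. *)
  have h1 := hS ((c j)%:R / 8) ((c j)%:Z * B1) (4 * e).
  have h2 := hS ((c j)%:R / 2) ((c j)%:Z * B1 * 2 ^+ 2) e.
  rewrite fmorph_div /= !rmorph_nat in h1.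
  rewrite fmorph_div /= !rmorph_nat in h2.
  rewrite !eta_psi_theta //.
  rewrite (_ : (4 * c j)%N%:R / 8 = (c j)%:R / 2 :> C); last by rewrite natrM; field.
  rewrite h1; first last.
  - by rewrite E !intrM -[(Posz _)%:~R]/((2 * c j)%N%:R : R) natrM; field.
  - by rewrite -/B' /B' B1E !intrM; field.
  - by rewrite divr_gt0 // ltr0n.
  rewrite h2; first last.
  - by rewrite E !intrM -[(Posz _)%:~R]/((2 * c j)%N%:R : R) natrM; field.
  - by rewrite -/B' /B' B1E !intrM; field.
  - by rewrite divr_gt0 // ltr0n.
  rewrite gsum_sqr //; last by rewrite coprimezE /= coprime2n.
  by ring.
pose a (y : 'I_v + 'I_k) : int :=
  match y with inl i => (b i)%:Z * (8 * B1) | inr j => (c j)%:Z * B1 end.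
have aD y : coprimez (a y) D.
  have c8 : coprimez 8 D.
    by rewrite (_ : 8 = 2 ^+ 3) // exp_coprimez // coprimezE /= coprime2n.
  by case: y => i; rewrite /= !coprimezMl B1D ?c8 ?coprimezE /= ?bD ?cD.
have cI : #|{: 'I_v + 'I_k}| = w.*2 by rewrite card_sum !card_ord.
have := gsum_prod R oD cI aD; rewrite !big_sumType /= => G.
rewrite kronecker_chi_num // in G.
rewrite /eta_quotient.
under eq_bigr do rewrite th.
under [X in _ * X]eq_bigr do rewrite ep.
have split4 (n : nat) (g y : 'I_n -> C) (d s : C) :
    \prod_(i < n) (g i / d * s * y i) =
    (\prod_(i < n) g i) * d^-1 ^+ n * s ^+ n * \prod_(i < n) y i.
  by rewrite !big_split /= !prodr_const !card_ord.
rewrite !split4; set Gb := \prod_(i < v) gsum R _ D in G *.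
set Gc := \prod_(j < k) gsum R _ D in G *.
set Tb := \prod_(i < v) theta _; set Tc := \prod_(j < k) eta_psi _ _.
have Sw : S ^+ v * S ^+ k = D%:R ^+ w * (q%:~R * tau + D%:R) ^+ w.
  by rewrite -exprD vk -muln2 mulnC exprM S2 exprMn.
have Dw : D%:R^-1 ^+ v * D%:R^-1 ^+ k * D%:R ^+ w * D%:R ^+ w = 1 :> C.
  by rewrite -exprD vk -mulrA -exprD addnn -exprMn mulVf // expr1n.
transitivity ((Gb * Gc) * (D%:R^-1 ^+ v * D%:R^-1 ^+ k) * (S ^+ v * S ^+ k) * (Tb * Tc)).
  by ring.
rewrite G Sw.
transitivity ((kronecker (chi_num b c) D)%:~R * (q%:~R * tau + D%:R) ^+ w *
  (D%:R^-1 ^+ v * D%:R^-1 ^+ k * D%:R ^+ w * D%:R ^+ w) * (Tb * Tc)); first by ring.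
by rewrite Dw mulr1.
Qed.

End EtaQuotient.

(** * Cusps, the character and the equivalence *)

Section Modularity.
Local Open Scope complex_scope.
Local Open Scope classical_set_scope.
Local Open Scope ring_scope.
Variable R : realType.
Local Notation C := (R[i]).

Lemma det_mx2E (g : 'M[int]_2) : \det g = g 0 0 * g 1 1 - g 0 1 * g 1 0.
Proof.
rewrite (expand_det_row _ 0) !big_ord_recl big_ord0 addr0 /cofactor !det_mx11 !mxE /=.
rewrite expr0 expr1 mul1r mulN1r mulrN.
by congr (_ * g _ _ - g _ _ * g _ _); apply: val_inj.
Qed.

Lemma det2 (g : 'M[int]_2) : SL2Z g -> g 0 0 * g 1 1 - g 0 1 * g 1 0 = 1.
Proof. by rewrite /SL2Z det_mx2E. Qed.

Lemma moebiusE (g : 'M[int]_2) (tau : C) :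
  moebius g tau = ((g 0 0)%:~R * tau + (g 0 1)%:~R) / ((g 1 0)%:~R * tau + (g 1 1)%:~R) :> C.
Proof. by []. Qed.

Lemma theta_translate (p : nat) (m : int) : (0 < p)%N ->
  qseries (32 * p) (fun tau : C => theta (p%:R / 8 * (tau + m%:~R))).
Proof.
move=> p0; have -> : (32 * p = 8 * (4 * p))%N by rewrite mulnA.
apply: qseries_scale => //; first by rewrite muln_gt0.
pose a (n : int) : C := ee (n%:~R ^+ 2 * (p%:R / 8 * m%:~R)).
apply: (@qseries_gen R int (fun n => p * `|n| ^ 2)%N a) => tau t0.
have E (n : int) : (p * `|n| ^ 2)%N%:R / 8 = n%:~R ^+ 2 * (p%:R / 8) :> C.
  rewrite (intC R n) -rmorphXn intr_sqr_absz -natrX rmorph_nat natrM; ring.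
have im : complex.Im (p%:R / 8 * (tau + m%:~R)) = p%:R / 8 * complex.Im tau.
  by rewrite (ImMnat p 8) ImD (intC R m) /= addr0.
have pos : 0 < complex.Im (p%:R / 8 * (tau + m%:~R)).
  by rewrite im mulr_gt0 // divr_gt0 // ltr0n.
apply: eq_hsum (theta_hsum pos) => n.
by rewrite E /a -eeD; congr ee; ring.
Qed.

(** Reduces to [theta_cusp] by passing to -g when the lower left entry is negative, and to a
    translation when it is zero; [kappa] absorbs the constants of these cases. *)
Lemma theta_all_cusps (g : 'M[int]_2) : SL2Z g ->
  exists (s : C -> C) (kappa : C), (forall tau, 0 < complex.Im tau ->
     s tau ^+ 2 = kappa * ((g 1 0)%:~R * tau + (g 1 1)%:~R)) /\
  forall p : nat, (0 < p)%N -> exists F, qseries (32 * p) F /\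
    forall tau, 0 < complex.Im tau -> theta (p%:R / 8 * moebius g tau) = s tau * F tau.
Proof.
move=> /det2 det.
suff: exists (s : C -> C) (kappa : C), (forall tau, 0 < complex.Im tau ->
     s tau ^+ 2 = kappa * ((g 1 0)%:~R * tau + (g 1 1)%:~R)) /\
  forall p : nat, (0 < p)%N -> exists F, qseries (32 * p) F /\
    forall tau, 0 < complex.Im tau -> theta (p%:R / 8 *
      (((g 0 0)%:~R * tau + (g 0 1)%:~R) / ((g 1 0)%:~R * tau + (g 1 1)%:~R))) =
      s tau * F tau by [].
move: (g 0 0) (g 0 1) (g 1 0) (g 1 1) det => A B c d det.
have [c0|c0|c0] := ltgtP c 0.
- have cE : (`|c|%N)%:Z = - c by lia.
  have cn : (0 < `|c|)%N by lia.
  have det' : - A * - d - - B * `|c|%N%:Z = 1 by rewrite cE -det; ring.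
  have [s [s2 hs]] := theta_cusp R cn det'.
  have wE tau : (`|c|%N)%:R * tau + (- d)%:~R = - (c%:~R * tau + d%:~R) :> C.
    by rewrite -[(`|c|%N)%:R]/((`|c|%N)%:Z%:~R : C) cE !mulrNz; ring.
  exists s, (- (2 * 'i)^-1); split => [tau t0|p p0].
    by rewrite s2 // wE mulrN mulNr.
  have [F [qF hF]] := hs p p0; exists F; split => // tau t0.
  rewrite -hF // wE !mulrNz; congr (theta (_ * _)).
  by rewrite mulNr -opprD invrN mulrNN.
- have cE : (`|c|%N)%:Z = c by lia.
  have cn : (0 < `|c|)%N by lia.
  have det' : A * d - B * `|c|%N%:Z = 1 by rewrite cE.
  have [s [s2 hs]] := theta_cusp R cn det'.
  have wE : (`|c|%N)%:R = c%:~R :> C by rewrite -[LHS]/((`|c|%N)%:Z%:~R : C) cE.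
  exists s, (2 * 'i)^-1; split => [tau t0|p p0].
    by rewrite s2 // wE.
  have [F [qF hF]] := hs p p0; exists F; split => // tau t0.
  by rewrite -hF // wE.
- have Ad : A * d = 1 by rewrite -det c0; ring.
  have AdC : (A%:~R : C) * d%:~R = 1 by rewrite -intrM Ad.
  have dn : `|d|%N = 1%N.
    by have /eqP := congr1 absz Ad; rewrite abszM muln_eq1 => /andP[_ /eqP].
  have d2 : d * d = 1 by have [->|->] : d = 1 \/ d = -1 by lia.
  have dC : (d%:~R : C) != 0 by rewrite intr_eq0; apply/eqP => d0; rewrite d0 mulr0 in Ad.
  exists (fun _ => 1), d%:~R; split => [tau t0|p p0].
    by rewrite c0 mul0r add0r -intrM d2 expr1n.
  exists (fun tau => theta (p%:R / 8 * (tau + (B * d)%:~R))); split.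
    exact: theta_translate.
  move=> tau t0; rewrite mul1r c0 mul0r add0r; congr (theta (_ * _)).
  have di : (d%:~R : C)^-1 = d%:~R.
    by apply: (mulfI dC); rewrite divff // -intrM d2.
  by rewrite di intrM mulrDl mulrAC AdC mul1r.
Qed.

(** In theta(p tau / 8) the values of p are 8 b_i, c_j and 4 c_j, all divisors of 48; hence one
    denominator 32 * 48. The common root [s] occurs v + k = 2w times, so only its square matters. *)
Lemma eta_quotient_cusps (v k w : nat) (b : 'I_v -> nat) (c : 'I_k -> nat)
    (g : 'M[int]_2) : SL2Z g -> (v + k = w.*2)%N ->
  (forall i, b i \in [:: 1; 2; 3; 6]%N) -> (forall j, c j \in [:: 1; 2; 3; 4; 6]%N) ->
  exists F : C -> C, qseries (32 * 48) F /\ forall tau, 0 < complex.Im tau ->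
    eta_quotient b c (moebius g tau) =
    ((g 1 0)%:~R * tau + (g 1 1)%:~R) ^+ w * F tau.
Proof.
move=> sg vk hb hc; have [s [kappa [s2 hs]]] := theta_all_cusps sg.
have Ig tau : 0 < complex.Im tau -> 0 < complex.Im (moebius g tau : C).
  by move=> t0; rewrite moebiusE; apply: Im_moebius => //; exact: det2.
have scale (p : nat) : (p %| 48)%N -> exists F : C -> C, qseries (32 * 48) F /\
    forall tau, 0 < complex.Im tau -> theta (p%:R / 8 * moebius g tau) = s tau * F tau.
  move=> /dvdnP[m mE]; have p0 : (0 < p)%N by case: p mE => //; rewrite muln0.
  have m0 : (0 < m)%N by case: m mE.
  have [F [qF hF]] := hs p p0; exists F; split => //.
  have E : (32 * p * m = 32 * 48)%N by rewrite -mulnA [(p * m)%N]mulnC -mE.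
  by rewrite -E; apply: qseries_scale; rewrite ?muln_gt0.
have th i : exists F : C -> C, qseries (32 * 48) F /\
    forall tau, 0 < complex.Im tau -> theta ((b i)%:R * moebius g tau : C) = s tau * F tau.
  have [|F [qF hF]] := scale (8 * b i)%N.
    by have := hb i; rewrite !inE => /or4P[] /eqP ->.
  have E : ((8 * b i)%N%:R : C) / 8 = (b i)%:R by rewrite natrM mulrC mulKf.
  by exists F; split=> [//|tau t0]; rewrite -E; exact: hF.
have ep j : exists F : C -> C, qseries (32 * 48) F /\
    forall tau, 0 < complex.Im tau -> eta_psi (c j) (moebius g tau : C) = s tau * F tau.
  have [|F [qF hF]] := scale (c j).
    by have := hc j; rewrite !inE => /or4P[| | |/orP[]] /eqP ->.
  have [|G [qG hG]] := scale (4 * c j)%N.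
    by have := hc j; rewrite !inE => /or4P[| | |/orP[]] /eqP ->.
  have cj : (0 < c j)%N by have := hc j; rewrite !inE => /or4P[| | |/orP[]] /eqP ->.
  exists (fun tau => 2^-1 * (F tau + (-1) * G tau)); split.
    by apply: qseriesZ; apply: qseriesD => //; apply: qseriesZ.
  move=> tau t0; rewrite eta_psi_theta // ?hF ?hG //; last exact: Ig.
  ring.
pose Th i := sval (cid (th i)); pose Ep j := sval (cid (ep j)).
have hTh i : qseries (32 * 48) (Th i) /\ forall tau, 0 < complex.Im tau ->
  theta ((b i)%:R * moebius g tau : C) = s tau * Th i tau := svalP (cid (th i)).
have hEp j : qseries (32 * 48) (Ep j) /\ forall tau, 0 < complex.Im tau ->
  eta_psi (c j) (moebius g tau : C) = s tau * Ep j tau := svalP (cid (ep j)).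
exists (fun tau => kappa ^+ w * (\prod_(i < v) Th i tau * \prod_(j < k) Ep j tau)).
split.
  apply: qseriesZ; apply: qseriesM; apply: qseries_prod => i.
    exact: (hTh i).1.
  exact: (hEp i).1.
move=> tau t0; rewrite /eta_quotient.
under eq_bigr do rewrite (hTh _).2 //.
under [X in _ * X]eq_bigr do rewrite (hEp _).2 //.
rewrite !big_split /= !prodr_const !card_ord.
set P := \prod_(i < v) _; set Q := \prod_(j < k) _.
have : s tau ^+ v * s tau ^+ k = kappa ^+ w * ((g 1 0)%:~R * tau + (g 1 1)%:~R) ^+ w.
  by rewrite -exprD vk -muln2 mulnC exprM s2 // exprMn.
move=> E; transitivity (s tau ^+ v * s tau ^+ k * (P * Q)); first by ring.
by rewrite E; ring.
Qed.

Lemma kronecker_opp (m : int) (n : nat) : (0 < n)%N ->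
  kronecker m (- n%:Z) = (if m < 0 then -1 else 1) * kronecker m n.
Proof.
move=> n0; rewrite /kronecker abszN.
have -> : (- n%:Z == 0) = false by lia.
have -> : (n%:Z == 0) = false by lia.
have -> : (- n%:Z < 0) by lia.
have -> : (n%:Z < 0) = false by lia.
by rewrite /= mul1r.
Qed.

(** Computes the value of the character at -1: it matches the sign of the weight [w], as -1 acts
    trivially on the upper half-plane. *)
Lemma chi_num_lt0 (v k w : nat) (b : 'I_v -> nat) (c : 'I_k -> nat) :
  (v + k = w.*2)%N -> (forall i, (0 < b i)%N) -> (forall j, (0 < c j)%N) ->
  (if chi_num b c < 0 then -1 else 1 : int) = (-1) ^+ w.
Proof.
move=> vk b0 c0; rewrite /chi_num vk doubleK -!mulrA.
set X := (if _ then 4 else 8) * _.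
have X0 : 0 < X.
  rewrite mulr_gt0 //; first by case: ifP.
  by rewrite mulr_gt0 // ltz_nat prodn_gt0.
rewrite -signr_odd; case: (odd w); rewrite ?expr1 ?expr0.
  by rewrite mulN1r oppr_lt0 X0.
by rewrite mul1r ltNge (ltW X0).
Qed.

Lemma dvdn_mul_biglcm (n M : nat) (I : eqType) (r : seq I) (f : I -> nat) i : i \in r ->
  (n * \big[lcmn/1%N]_(j <- r) f j %| M)%N -> (n * f i %| M)%N.
Proof.
move=> ir; apply: dvdn_trans; rewrite dvdn_mul //.
by rewrite (big_rem i ir) /= dvdn_lcml.
Qed.

Theorem eta_quotient_modular (v k : nat) (b : 'I_v -> nat) (c : 'I_k -> nat) (M : nat) :
  (0 < v)%N -> ~~ odd (v + k) ->
  (forall i, b i \in [:: 1; 2; 3; 6]%N) -> (forall j, c j \in [:: 1; 2; 3; 4; 6]%N) ->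
  (forall i, (4 * b i %| M)%N) -> (forall j, (2 * c j %| M)%N) ->
  modular_form (v + k)./2 M (chi'' R b c) (eta_quotient b c : R[i]^o -> R[i]^o)
  <-> (8 %| \sum_(j < k) c j)%N.
Proof.
move=> v0 vk hb hc bM cM; set w := (v + k)./2.
have vkw : (v + k = w.*2)%N.
  by rewrite -[LHS]odd_double_half (negbTE vk).
have b0 i : (0 < b i)%N by have := hb i; rewrite !inE => /or4P[] /eqP ->.
have c0 j : (0 < c j)%N by have := hc j; rewrite !inE => /or4P[| | |/orP[]] /eqP ->.
split.
  move=> [_ inv _]; apply: (@ee_eighth R).
  (* The matrix (1, 1; 0, 1), of cocycle 1 and character value 1. *)
  pose T : 'M[int]_2 := \matrix_(i < 2, j < 2) (if (i == ord_max) && (j == ord0) then 0 else 1).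
  have TE : (T 0 0 = 1) * (T 0 1 = 1) * (T 1 0 = 0) * (T 1 1 = 1) by rewrite !mxE.
  have gT : Gamma0 M T.
    by split; rewrite ?/SL2Z ?det_mx2E ?TE // ?dvdz0 // mulr0 subr0.
  have i0 : 0 < complex.Im ('i : C) by rewrite /= ltr01.
  have := inv T 'i gT i0; rewrite /cocycle moebiusE !TE.
  have -> : chi'' R b c 1 = 1 :> C.
    by rewrite /chi'' (@kronecker_natE _ 1 2) // big1 // => q pq;
      rewrite (@lognE q 1) pq /= Euclid_dvd1 // expr0.
  have -> : (1%:~R * 'i + 1%:~R) / (0%:~R * 'i + 1%:~R) = 'i + 1%:~R :> C.
    by rewrite mul0r add0r divr1 mul1r.
  rewrite eta_quotient_int // mulr1 => E.
  have n0 := eta_quotient_neq0 R b0 c0.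
  apply: (mulIf n0); rewrite mul1r E.
  have -> : (0%:~R * 'i + 1%:~R : C) = 1 by rewrite mul0r add0r.
  have one : (1 : C) * 1 ^+ w * eta_quotient b c 'i = eta_quotient b c 'i.
    by rewrite expr1n !mul1r.
  exact: one.
move=> h8; split.
(* The expansion at the cusp infinity gives holomorphy. *)
- have [|F [qF hF]] := eta_quotient_cusps (g := 1%:M) _ vkw hb hc; first exact: det1.
  apply: (@qseries_derivable R (32 * 48)).
  apply: qseries_eq qF => tau t0; have := hF tau t0.
  rewrite moebiusE !mxE /= mul0r add0r expr1n mul1r => <-.
  by rewrite divr1 mul1r addr0.
- move=> g tau [sg Mg] t0; rewrite /upper_half_plane in t0.
  have det := det2 sg; rewrite moebiusE /cocycle.
  have bq i : ((4 * b i)%N%:Z %| g 1%R 0%R)%Z by apply: dvdz_trans Mg; rewrite dvdzE /= bM.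
  have cq j : ((2 * c j)%N%:Z %| g 1%R 0%R)%Z by apply: dvdz_trans Mg; rewrite dvdzE /= cM.
  (* As [v] is positive, some 4 b_i divides the lower left entry, which is therefore even; the
     determinant 1 then forces the diagonal entries to be odd. *)
  have od : odd (absz (g 1%R 1%R)).
    have /dvdzP[e E] := bq (Ordinal v0).
    move: det; rewrite E PoszM.
    move: (g 0 0) (g 0 1) (g 1 1) (b _) => A B d m det.
    have [n nE] : exists n, A * d = 1 + 2 * n.
      exists (B * (e * (2 * m%:Z))); rewrite -[X in _ = X + _]det; ring.
    have : odd (absz (A * d)%R) by rewrite nE; lia.
    by rewrite abszM oddM => /andP[].
  move: bq cq od det; rewrite /chi''.
  move: (g 0 0) (g 0 1) (g 1 0) (g 1 1) => A B q d bq cq od det.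
  have [d0|d0] := leP 0 d.
    have dE : d = `|d|%N by rewrite gez0_abs.
    rewrite dE in det *.
    exact: (@eta_quotient_transform R v k w b c A B q `|d|%N tau od vkw det).
  (* For d < 0 the law is applied to -g. The sign of the w-th power of the cocycle is the one by
     which the symbol at d differs from the symbol at |d|. *)
  have dE : d = - `|d|%N%:Z by lia.
  set D := `|d|%N in od dE *.
  have D0 : (0 < D)%N by case: (D) od.
  have det' : - A * D%:Z - - B * - q = 1 by rewrite -det dE; ring.
  have bq' i : ((4 * b i)%N%:Z %| - q)%Z.
    by have /dvdzP[e ->] := bq i; rewrite -mulNr dvdz_mull.
  have cq' j : ((2 * c j)%N%:Z %| - q)%Z.
    by have /dvdzP[e ->] := cq j; rewrite -mulNr dvdz_mull.
  have := @eta_quotient_transform R v k w b c (- A) (- B) (- q) D tau od vkw det' h8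
    b0 c0 bq' cq' t0.
  have wE : (- q)%:~R * tau + D%:R = - (q%:~R * tau + d%:~R) :> C.
    by rewrite dE !mulrNz opprD opprK mulNr.
  have nE : (- A)%:~R * tau + (- B)%:~R = - (A%:~R * tau + B%:~R) :> C.
    by rewrite !mulrNz; ring.
  rewrite wE nE invrN mulrNN => ->; congr (_ * _).
  rewrite exprNn mulrA; congr (_ * _).
  rewrite [in RHS]dE kronecker_opp // (chi_num_lt0 vkw b0 c0) intrM mulrC.
  by rewrite rmorphXn /= rmorphN1.
- move=> g sg; have [F [[a ha] hF]] := eta_quotient_cusps sg vkw hb hc.
  exists (32 * 48)%N, a; split => // tau t0.
  have -> : slash w g (eta_quotient b c : R[i]^o -> R[i]^o) tau = F tau :> C.
    rewrite /slash; have -> := hF tau t0.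
    have w0 : (g 1 0)%:~R * tau + (g 1 1)%:~R != 0 :> C.
      apply: cocycle_neq0 => //; apply/eqP => -[E1 E2].
      by have := det2 sg; rewrite E1 E2 !mulr0.
    by apply: mulKf; rewrite expf_neq0.
  have E : (fun n => a n * qpow (n%:R / (32 * 48)%N%:R) tau) =
      (fun n => a n * ee (n%:R / (32 * 48)%N%:R * tau)) :> (nat -> R[i]^o).
    by apply/funext => n; rewrite qpowE fmorph_div /= !rmorph_nat.
  by rewrite E; exact: hsum_series (ha tau t0).
Qed.

End Modularity.

Unset Implicit Arguments.

Theorem theorem1p3 (R : realType) (v k : nat) (b : 'I_v -> nat) (c : 'I_k -> nat)
  (hv : (0 < v)%N) (hk : (0 < k)%N) (hvk : ~~ odd (v + k))
  (hb : forall i, b i \in [:: 1; 2; 3; 6]%N)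
  (hc : forall j, c j \in [:: 1; 2; 3; 4; 6]%N) :
  let h := (\sum_(j < k) c j)%N in
  let M := lcmn (4 * \big[lcmn/1%N]_(i < v) b i) (2 * \big[lcmn/1%N]_(j < k) c j) in
  modular_form (v + k)./2 M (chi'' R b c)
    (fun tau : R[i]^o => (qpow (h%:R / 8) tau * psi_st b c tau)%R)
  <-> h = 0 %[mod 8].
Proof.
move=> h M.
have -> : (fun tau : R[i]^o => (qpow (h%:R / 8) tau * psi_st b c tau)%R) =
    (eta_quotient b c : R[i]^o -> R[i]^o).
  by apply/funext => tau; exact: eta_quotientE.
have bM i : (4 * b i %| M)%N.
  by apply: (dvdn_mul_biglcm (mem_index_enum i)); exact: dvdn_lcml.
have cM j : (2 * c j %| M)%N.
  by apply: (dvdn_mul_biglcm (mem_index_enum j)); exact: dvdn_lcmr.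
have [to from] := eta_quotient_modular R hv hvk hb hc bM cM.
split=> [/to/eqP|h8]; first by rewrite mod0n.
by apply: from; rewrite /dvdn -/h h8 mod0n.
Qed.
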